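(* Let $\Omega\subset\mathbb{R}^3$ be a nonempty open bounded convex set with $C^2$ boundary, let $\lambda_0,\mu_0,\rho_0>0$, $d_0>0$, $0<m_0\le M_0$, $t_0>0$, and let $B_{r_0}(\bar x)\subset\mathbb{R}^3\setminus\overline{\Omega}$ be an open ball of radius $r_0>0$. Let $q$ be a real-valued function such that $x\mapsto q(|x|)$ belongs to $C^2_0(\Omega)$, $\operatorname{supp} q\subset[-\tfrac{d_0}{2},\tfrac{d_0}{2}]$ and $\int_{\mathbb{R}^3}q(|x|)\,dx=1$. Let $M^{(1)},M^{(2)}$ be real $3\times 3$ matrices that are nonzero, symmetric, with vanishing trace, and satisfy $m_0\le|M^{(j)}|\le M_0$ for $j=1,2$; let $P^{(1)},P^{(2)}\in\Omega_{d_0}$; and set $$\mathbf{f}^{(j)}(x)=-M^{(j)}\nabla\big(q(|x-P^{(j)}|)\big),\qquad j=1,2.$$ Let $(\mathbf{u}^{(j)},S^{(j)})$, $j=1,2$, be the (weak) solutions of the elasto-gravitational system (described in the context) with source $\mathbf{f}=\mathbf{f}^{(j)}$ and constant coefficients $\lambda_0,\mu_0,\rho_0$. If $$\nabla S^{(1)}=\nabla S^{(2)}\quad\text{in }B_{r_0}(\bar x)\times[0,t_0],$$ then $M^{(1)}=M^{(2)}$ and $P^{(1)}=P^{(2)}$.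
   Context: For $h>0$, $\Omega_h:=\{x\in\Omega:\operatorname{dist}(x,\partial\Omega)>h\}$. For a matrix $A$, $|A|=\sqrt{A\cdot A}$ with $A\cdot B=A_{ij}B_{ij}$ (summation over repeated indices). The function $x\mapsto q(|x|)$ is extended by zero to $\mathbb{R}^3$. The isotropic stiffness tensor is $C_{ijk\ell}=\lambda_0\delta_{ij}\delta_{k\ell}+\mu_0(\delta_{ik}\delta_{j\ell}+\delta_{i\ell}\delta_{jk})$, acting on matrices by $(\mathbb{C}A)_{ij}=C_{ijk\ell}A_{k\ell}$. Elasto-gravitational system with source $\mathbf{f}\in H^1(\Omega,\mathbb{R}^3)$ (independent of $t$): first, $\mathbf{u}=\mathbf{u}(x,t)$ is the solution of $$\rho_0\mathbf{u}_{tt}-\operatorname{div}(\mathbb{C}\nabla\mathbf{u})=\mathbf{f}\ \text{ in }\Omega\times[0,\infty),\qquad(\mathbb{C}\nabla\mathbf{u})\cdot\nu=0\ \text{ on }\partial\Omega\times[0,\infty),\qquad\mathbf{u}(x,0)=\mathbf{u}_t(x,0)=0\ \text{ in }\Omega,$$ where $\nu$ is the outward normal to $\partial\Omega$, with $\mathbf{u}\in C([0,\infty);H^2(\Omega,\mathbb{R}^3))$, $\mathbf{u}_t\in C([0,\infty);H^1(\Omega,\mathbb{R}^3))$, $\mathbf{u}_{tt}\in C([0,\infty);L^2(\Omega,\mathbb{R}^3))$. Second, for each $t\ge0$, $S(\cdot,t)$ is the weak solution of the transmission problem for the gravitational potential ($\Delta S=-\rho_0\operatorname{div}\mathbf{u}$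 in $\Omega$, $\Delta S=0$ in $\mathbb{R}^3\setminus\overline\Omega$, with transmission conditions on $\partial\Omega$ and $S\to0$ at infinity), that is, the unique $S(\cdot,t)\in H^1(\mathbb{R}^3)$ with $$\int_{\mathbb{R}^3}\nabla S(\cdot,t)\cdot\nabla\phi\,dx=-\int_\Omega\rho_0\,\mathbf{u}(\cdot,t)\cdot\nabla\phi\,dx\qquad\forall\phi\in H^1(\mathbb{R}^3).$$ *)

(* Defs.v *)
From HB Require Import structures.
From mathcomp Require Import all_boot all_order all_algebra.
From mathcomp Require Import all_classical all_reals all_analysis.
Set Implicit Arguments.
Unset Strict Implicit.
Unset Printing Implicit Defensive.
Import Order.TTheory GRing.Theory Num.Theory.
Import numFieldNormedType.Exports.
Local Open Scope classical_set_scope.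
Local Open Scope ring_scope.

(** Euclidean geometry of row vectors. The library norm [`|x|] on ['rV_n] is
    the maximum norm: it gives the same topology and the same bounded sets,
    but not the same balls. *)

Definition enorm (R : realType) (n : nat) (x : 'rV[R]_n) : R :=
  Num.sqrt (\sum_i x 0 i ^+ 2).

Definition eball (R : realType) (n : nat) (c : 'rV[R]_n) (r : R) :
    set 'rV[R]_n :=
  [set x | enorm (x - c) < r].

Definition boundary (T : topologicalType) (A : set T) : set T :=
  closure A `\` interior A.

Definition edist (R : realType) (n : nat) (x : 'rV[R]_n) (A : set 'rV[R]_n) :
    R :=
  inf [set enorm (x - y) | y in A].

Definition inner_set (R : realType) (n : nat) (Omega : set 'rV[R]_n) (h : R) :
    set 'rV[R]_n :=
  [set x | Omega x /\ h < edist x (boundary Omega)].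

Definition frob (R : realType) (A : 'M[R]_3) : R :=
  Num.sqrt (\sum_i \sum_j A i j * A i j).

(** Classical differentiability. *)

Definition pd (R : realType) (n : nat) (i : 'I_n) (f : 'rV[R]_n -> R) :
    'rV[R]_n -> R :=
  fun x => 'D_(delta_mx 0 i) f x.

Fixpoint Ck (R : realType) (n k : nat) (f : 'rV[R]_n -> R) : Prop :=
  continuous f /\
  if k is k'.+1 then
    forall i, (forall x, derivable f x (delta_mx 0 i)) /\ Ck k' (pd i f)
  else True.

Definition supp (R : realType) (T : topologicalType) (f : T -> R) : set T :=
  closure [set x | f x != 0].

Definition Ck_c (R : realType) (n k : nat) (Omega : set 'rV[R]_n)
    (f : 'rV[R]_n -> R) : Prop :=
  [/\ Ck k f, compact (supp f) & supp f `<=` Omega].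

Definition test_function (R : realType) (n : nat) (Omega : set 'rV[R]_n)
    (phi : 'rV[R]_n -> R) : Prop :=
  forall k, Ck_c k Omega phi.

(** Lebesgue measure on R^2 and R^3 is the product measure on [R * R] and
    [R * R * R]; sets and functions on ['rV_n] are pulled back along the
    coordinate maps [vec2] and [vec3]. *)

Definition vec2 (R : realType) (p : R * R) : 'rV[R]_2 :=
  \row_i [:: p.1; p.2]`_i.

Definition vec3 (R : realType) (p : R * R * R) : 'rV[R]_3 :=
  \row_i [:: p.1.1; p.1.2; p.2]`_i.

Definition leb2 (R : realType) :=
  (@lebesgue_measure R \x @lebesgue_measure R)%E.
HB.instance Definition _ (R : realType) := Measure.on (@leb2 R).

Definition leb3 (R : realType) :=
  (@leb2 R \x @lebesgue_measure R)%E.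
HB.instance Definition _ (R : realType) := Measure.on (@leb3 R).

Definition Int3 (R : realType) (Omega : set 'rV[R]_3) (f : 'rV[R]_3 -> R) : R :=
  \int[@leb3 R]_(p in @vec3 R @^-1` Omega) f (vec3 p).

Definition ae3 (R : realType) (Omega : set 'rV[R]_3) (P : 'rV[R]_3 -> Prop) :
    Prop :=
  {ae @leb3 R, forall p, Omega (vec3 p) -> P (vec3 p)}.

(** Square integrable functions and Sobolev functions, as honest functions
    representing their almost-everywhere classes; only the values on [Omega]
    matter. *)

Definition L2norm2 (R : realType) (Omega : set 'rV[R]_3) (f : 'rV[R]_3 -> R) :
    \bar R :=
  (\int[@leb3 R]_(p in @vec3 R @^-1` Omega) ((f (vec3 p)) ^+ 2)%:E)%E.

Definition L2 (R : realType) (Omega : set 'rV[R]_3) (f : 'rV[R]_3 -> R) : Prop :=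
  measurable_fun (@vec3 R @^-1` Omega) (f \o @vec3 R) /\
  (L2norm2 Omega f < +oo)%E.

Definition is_wderiv (R : realType) (Omega : set 'rV[R]_3) (i : 'I_3)
    (f g : 'rV[R]_3 -> R) : Prop :=
  L2 Omega g /\
  forall phi, test_function Omega phi ->
    Int3 Omega (fun x => f x * pd i phi x) =
    - Int3 Omega (fun x => g x * phi x).

(** A representative of the weak derivative, unique almost everywhere when it
    exists (and zero when there is none in L2). *)
Definition wderiv (R : realType) (Omega : set 'rV[R]_3) (i : 'I_3)
    (f : 'rV[R]_3 -> R) : 'rV[R]_3 -> R :=
  xget (fun=> 0) [set g | is_wderiv Omega i f g].

Fixpoint Hk (R : realType) (k : nat) (Omega : set 'rV[R]_3)
    (f : 'rV[R]_3 -> R) : Prop :=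
  L2 Omega f /\
  if k is k'.+1 then
    forall i, (exists g, is_wderiv Omega i f g) /\ Hk k' Omega (wderiv Omega i f)
  else True.

(** Squared H^k norm; mixed derivatives are counted with multiplicity. *)
Fixpoint Hnorm2 (R : realType) (k : nat) (Omega : set 'rV[R]_3)
    (f : 'rV[R]_3 -> R) : \bar R :=
  (L2norm2 Omega f +
   if k is k'.+1 then \sum_(i < 3) Hnorm2 k' Omega (wderiv Omega i f) else 0)%E.

(** [v] is in C([0, oo); H^k(Omega)). *)
Definition C_Hk (R : realType) (k : nat) (Omega : set 'rV[R]_3)
    (v : R -> 'rV[R]_3 -> R) : Prop :=
  forall t, 0 <= t ->
    Hk k Omega (v t) /\
    Hnorm2 k Omega (fun x => v s x - v t x)
      @[s --> within [set s : R | 0 <= s] (nbhs t)] --> 0%E.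

(** [vt] is the time derivative of [v] on [0, oo), one-sided at 0, with the
    difference quotients converging in L2(Omega). *)
Definition time_deriv (R : realType) (Omega : set 'rV[R]_3)
    (v vt : R -> 'rV[R]_3 -> R) : Prop :=
  forall t, 0 <= t ->
    L2norm2 Omega (fun x => (s - t)^-1 * (v s x - v t x) - vt t x)
      @[s --> within [set s : R | 0 <= s] (dnbhs t)] --> 0%E.

(** Boundary charts. In the rotated coordinates [y = x *m Q], [Omega] is near
    [p] the region strictly above the graph of the C^2 function [gamma]. *)

Definition chart (R : realType) (Omega : set 'rV[R]_3) (p : 'rV[R]_3) (r : R)
    (Q : 'M[R]_(2 + 1)) (gamma : 'rV[R]_2 -> R) : Prop :=
  [/\ 0 < r, Q *m Q^T = 1%:M, Ck 2 gamma &
      forall x : 'rV[R]_(2 + 1), eball p r x ->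
        (Omega x <-> gamma (lsubmx (x *m Q)) < (x *m Q) 0 (rshift 2 ord0))].

Definition C2_boundary (R : realType) (Omega : set 'rV[R]_3) : Prop :=
  forall p, boundary Omega p ->
    exists r Q gamma, chart Omega p r Q gamma.

Definition graph_pt (R : realType) (Q : 'M[R]_(2 + 1)) (gamma : 'rV[R]_2 -> R)
    (z : 'rV[R]_2) : 'rV[R]_3 :=
  row_mx z (gamma z)%:M *m Q^T.

Definition area_elt (R : realType) (gamma : 'rV[R]_2 -> R) (z : 'rV[R]_2) : R :=
  Num.sqrt (1 + \sum_i pd i gamma z ^+ 2).

(** Outward unit normal at [graph_pt Q gamma z]. *)
Definition normal (R : realType) (Q : 'M[R]_(2 + 1)) (gamma : 'rV[R]_2 -> R)
    (z : 'rV[R]_2) : 'rV[R]_3 :=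
  (area_elt gamma z)^-1 *:
    (row_mx (\row_i pd i gamma z) (- 1)%:M *m Q^T).

Definition patch (R : realType) (p : 'rV[R]_3) (r : R)
    (Q : 'M[R]_(2 + 1)) (gamma : 'rV[R]_2 -> R) : set (R * R) :=
  [set z | eball p r (graph_pt Q gamma (vec2 z))].

(** [g] is the trace of [w] in H^1(Omega) on the boundary: [w] is the H^1 limit
    of functions that are C^1 up to the boundary and whose boundary values
    converge to [g] in L2 of the surface measure. As the boundary is compact,
    the latter is convergence in L2 over the patch of every chart. *)
Definition is_trace (R : realType) (Omega : set 'rV[R]_3)
    (w g : 'rV[R]_3 -> R) : Prop :=
  Hk 1 Omega w /\
  exists wn : nat -> 'rV[R]_3 -> R,
    [/\ forall n, Ck 1 (wn n),
        Hnorm2 1 Omega (fun x => wn n x - w x) @[n --> \oo] --> 0%E &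
        forall p r Q gamma, boundary Omega p -> chart Omega p r Q gamma ->
          measurable_fun (patch p r Q gamma)
            (fun z => g (graph_pt Q gamma (vec2 z))) /\
          (\int[@leb2 R]_(z in patch p r Q gamma)
             ((wn n (graph_pt Q gamma (vec2 z)) -
               g (graph_pt Q gamma (vec2 z))) ^+ 2 *
              area_elt gamma (vec2 z))%:E)%E @[n --> \oo] --> 0%E].

(** [A i j] are the entries of a matrix field in H^1(Omega): [A nu = 0] on the
    boundary in the sense of traces. *)
Definition normal_trace_zero (R : realType) (Omega : set 'rV[R]_3)
    (A : 'I_3 -> 'I_3 -> 'rV[R]_3 -> R) : Prop :=
  exists T : 'I_3 -> 'I_3 -> 'rV[R]_3 -> R,
    (forall i j, is_trace Omega (A i j) (T i j)) /\
    forall p r Q gamma, boundary Omega p -> chart Omega p r Q gamma ->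
      {ae @leb2 R, forall z, patch p r Q gamma z -> forall i,
        \sum_j T i j (graph_pt Q gamma (vec2 z)) *
               normal Q gamma (vec2 z) 0 j = 0}.

(** The elasto-gravitational system. *)

Definition stiffness (R : realType) (lambda0 mu0 : R) (i j k l : 'I_3) : R :=
  lambda0 * ((i == j)%:R * (k == l)%:R) +
  mu0 * ((i == k)%:R * (j == l)%:R + (i == l)%:R * (j == k)%:R).

Definition stress (R : realType) (Omega : set 'rV[R]_3) (lambda0 mu0 : R)
    (v : 'rV[R]_3 -> 'rV[R]_3) (i j : 'I_3) : 'rV[R]_3 -> R :=
  fun x => \sum_k \sum_l
    stiffness lambda0 mu0 i j k l * wderiv Omega l (fun y => v y 0 k) x.

Definition elastic_solution (R : realType) (Omega : set 'rV[R]_3)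
    (lambda0 mu0 rho0 : R) (f : 'rV[R]_3 -> 'rV[R]_3)
    (u : R -> 'rV[R]_3 -> 'rV[R]_3) : Prop :=
  exists ut utt : R -> 'rV[R]_3 -> 'rV[R]_3,
    (forall i,
      [/\ C_Hk 2 Omega (fun t x => u t x 0 i),
          C_Hk 1 Omega (fun t x => ut t x 0 i),
          C_Hk 0 Omega (fun t x => utt t x 0 i),
          time_deriv Omega (fun t x => u t x 0 i) (fun t x => ut t x 0 i) &
          time_deriv Omega (fun t x => ut t x 0 i) (fun t x => utt t x 0 i)]) /\
    [/\ forall t, 0 <= t -> ae3 Omega (fun x => forall i,
          rho0 * utt t x 0 i -
            \sum_j wderiv Omega j (stress Omega lambda0 mu0 (u t) i j) x =
          f x 0 i),
        forall t, 0 <= t ->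
          normal_trace_zero Omega (stress Omega lambda0 mu0 (u t)),
        ae3 Omega (fun x => u 0 x = 0) &
        ae3 Omega (fun x => ut 0 x = 0)].

Definition gravity_solution (R : realType) (Omega : set 'rV[R]_3) (rho0 : R)
    (u : R -> 'rV[R]_3 -> 'rV[R]_3) (S : R -> 'rV[R]_3 -> R) : Prop :=
  forall t, 0 <= t ->
    Hk 1 [set: 'rV[R]_3] (S t) /\
    forall phi, Hk 1 [set: 'rV[R]_3] phi ->
      Int3 setT (fun x => \sum_i wderiv setT i (S t) x * wderiv setT i phi x) =
      - Int3 Omega (fun x => \sum_i rho0 * u t x 0 i * wderiv setT i phi x).

(** [- M grad (q(|x - P|))] *)
Definition source (R : realType) (q : R -> R) (M : 'M[R]_3) (P x : 'rV[R]_3) :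
    'rV[R]_3 :=
  \row_i - \sum_j M i j * pd j (fun y => q (enorm (y - P))) x.

(* Main.v *)
Require Import Defs.
From HB Require Import structures.
From mathcomp Require Import all_boot all_order all_algebra.
From mathcomp Require Import all_classical all_reals all_analysis.
From mathcomp Require Import measurable_realfun ring lra.
Set Implicit Arguments.
Unset Strict Implicit.
Unset Printing Implicit Defensive.
Import Order.TTheory GRing.Theory Num.Theory.
Import numFieldNormedType.Exports.
Local Open Scope classical_set_scope.
Local Open Scope ring_scope.

(** Why the theorem is true. Fix a point [y] of the observation ball, write
    z = x - y, and test gravity against phi(x) = z_e G(|z|^2), where
    G(s) = s^(-3/2) for s between a and r^2, and G is smoothed out below a and
    cut off beyond 2 r^2 ([kern], [field]). Where G is a pure power, phi is a
    component of the Newtonian field z / |z|^3.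

    The fields z_i G(|z|^2) form a gradient, so two integrations by parts turn
    the integral of grad S . grad phi into that of (d_e S) div(z G(|z|^2))
    ([flux_identity]). The divergence vanishes for a < |z|^2 < r^2 and beyond
    2 r^2. When a is small, the region |z|^2 <= a lies in the ball where the
    two gravity fields agree; on the outer shell the divergence is of size
    r^(-3) on a volume of order r^3, so by Cauchy-Schwarz its contribution
    tends to 0 as r grows. Since the weak form of gravity on the other side
    sees phi on Omega only, where it does not depend on r, the displacements
    satisfy int_Omega (u1 - u2) . grad phi = 0 for all times up to t0
    ([dipole_orthogonal]).

    Differentiating this twice in time at t = 0, where the displacements and
    hence the elastic forces vanish and the equation of motion reads
    rho0 u_tt = f, gives int f1 . grad phi = int f2 . grad phi
    ([elastic_source_pairing]).

    An integration by parts makes int f . grad phi the integral of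
    q(|x - P|) H(x) with H = sum_ij M_ij d_i d_j phi. Near P this H is
    harmonic, so its mean against the radial weight q is H(P) ([mean_value],
    [source_pairing]). Explicitly, H(P) is three times the derivative in y_e of
    the potential z^T M z / |z|^5, z = P - y ([quadrupole_kern],
    [is_derive_moment_potential]). So the potentials of the two moments differ
    by a constant on the ball.

    Along a line, each potential is a quadratic polynomial times the power
    -5/2 of another one; squaring twice gives a polynomial identity, whose
    degrees force the constant to be 0 ([potentials_agree]). The squared
    identity then holds at every y. At y = P1, if P2 is another point, one
    side vanishes to order 10 and the other to order 4 only, unless M1 = 0
    ([moment_center_unique]). Once P1 = P2, the quadratic forms coincide
    ([moment_unique]). *)

(** * Directional C^k calculus *)

Section ContinuousMaps.
Context (R : realType) (T : topologicalType).
Implicit Types f g : T -> R.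

Lemma cont_mul f g : continuous f -> continuous g -> continuous (fun x => f x * g x).
Proof. by move=> cf cg x; apply: cvgM; [exact: cf|exact: cg]. Qed.

Lemma cont_add f g : continuous f -> continuous g -> continuous (fun x => f x + g x).
Proof. by move=> cf cg x; apply: cvgD; [exact: cf|exact: cg]. Qed.

Lemma cont_norm f : continuous f -> continuous (fun x => `|f x|).
Proof. by move=> cf x; apply: cvg_norm; exact: cf. Qed.

Lemma cont_comp (U : topologicalType) (g : U -> R) (f : T -> U) :
  continuous g -> continuous f -> continuous (fun x => g (f x)).
Proof. by move=> cg cf x; apply: (@continuous_comp _ _ _ f g); [exact: cf|exact: cg]. Qed.

End ContinuousMaps.

Section LambdaDerivatives.
Context (R : realType) (V : normedModType R).
Implicit Types (f g : V -> R) (x w : V).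

(** The derivation rules are stated for explicit lambda terms, so that they
    nest into terms whose derivative is read off by unification. *)
Lemma is_derive_mul f g x w df dg :
  is_derive x w f df -> is_derive x w g dg ->
  is_derive x w (fun y => f y * g y) (f x * dg + g x * df).
Proof. by move=> fd gd; apply: is_deriveM. Qed.

Lemma is_derive_add f g x w df dg :
  is_derive x w f df -> is_derive x w g dg ->
  is_derive x w (fun y => f y + g y) (df + dg).
Proof. by move=> fd gd; apply: is_deriveD. Qed.

Lemma is_derive_sub f g x w df dg :
  is_derive x w f df -> is_derive x w g dg ->
  is_derive x w (fun y => f y - g y) (df - dg).
Proof. by move=> fd gd; apply: is_deriveB. Qed.

Lemma is_derive_const (c : R) x w : is_derive x w (fun=> c) 0.
Proof. exact: is_derive_cst. Qed.

Lemma is_derive_mulcl (c : R) f x w df :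
  is_derive x w f df -> is_derive x w (fun y => c * f y) (c * df).
Proof.
move=> fd; have := is_derive_mul (is_derive_const c x w) fd.
by rewrite mulr0 addr0.
Qed.

End LambdaDerivatives.

Section DirectionalCk.
Context (R : realType) (V : normedModType R) (I : Type) (v : I -> V).
Implicit Types f g : V -> R.

(** Derivatives are taken along a family of directions: the coordinate axes
    give [Ck], the single direction 1 gives the C^k functions of a real
    variable, and both classes share one proof of each closure property. *)
Fixpoint Cd (k : nat) f : Prop :=
  continuous f /\
  if k is k'.+1 then
    forall i, (forall x, derivable f x (v i)) /\ Cd k' (fun x => 'D_(v i) f x)
  else True.

Lemma Cd_cont k f : Cd k f -> continuous f.
Proof. by case: k => [|k] []. Qed.

Lemma Cd_intro k f : continuous f ->
  (forall i, exists2 g, (forall x, is_derive x (v i) f (g x)) & Cd k g) ->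
  Cd k.+1 f.
Proof.
move=> cf df; split => // i; have [g fg Cg] := df i; split.
  by move=> x; have [] := fg x.
suff -> : (fun x => 'D_(v i) f x) = g by [].
by apply/funext => x; have [] := fg x.
Qed.

Lemma Cd_is_derive k f i : Cd k.+1 f ->
  forall x, is_derive x (v i) f ('D_(v i) f x).
Proof. by move=> [_ /(_ i)[df _]] x; exact: derivableP. Qed.

Lemma Cd_deriv k f i : Cd k.+1 f -> Cd k (fun x => 'D_(v i) f x).
Proof. by move=> [_ /(_ i)[]]. Qed.

Lemma Cd_pred k f : Cd k.+1 f -> Cd k f.
Proof.
elim: k f => [f /Cd_cont//|k IH f [cf df]]; split=> // i.
by have [d1 /IH d2] := df i.
Qed.

Lemma Cd_cst k (c : R) : Cd k (fun=> c).
Proof.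
elim: k c => [|k IH] c; first by split=> //; exact: cst_continuous.
apply: Cd_intro; first exact: cst_continuous.
by move=> i; exists (fun=> 0) => [x|]; [exact: is_derive_cst|exact: IH].
Qed.

Lemma CdD k f g : Cd k f -> Cd k g -> Cd k (fun x => f x + g x).
Proof.
elim: k f g => [|k IH] f g Cf Cg.
  by split=> // x; apply: cvgD; [exact: (Cd_cont Cf)|exact: (Cd_cont Cg)].
apply: Cd_intro.
  by move=> x; apply: cvgD; [exact: (Cd_cont Cf)|exact: (Cd_cont Cg)].
move=> i; exists (fun x => 'D_(v i) f x + 'D_(v i) g x).
  by move=> x; apply: is_deriveD; [exact: (Cd_is_derive i Cf)|exact: (Cd_is_derive i Cg)].
by apply: IH; exact: Cd_deriv.
Qed.

Lemma CdM k f g : Cd k f -> Cd k g -> Cd k (fun x => f x * g x).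
Proof.
elim: k f g => [|k IH] f g Cf Cg.
  by split=> // x; apply: cvgM; [exact: (Cd_cont Cf)|exact: (Cd_cont Cg)].
apply: Cd_intro.
  by move=> x; apply: cvgM; [exact: (Cd_cont Cf)|exact: (Cd_cont Cg)].
move=> i; exists (fun x => f x * 'D_(v i) g x + g x * 'D_(v i) f x).
  by move=> x; apply: is_deriveM; [exact: (Cd_is_derive i Cf)|exact: (Cd_is_derive i Cg)].
by apply: CdD; apply: IH; try exact: Cd_deriv; exact: Cd_pred.
Qed.

Lemma CdN k f : Cd k f -> Cd k (fun x => - f x).
Proof.
move=> Cf; have -> : (fun x => - f x) = (fun x => (-1) * f x).
  by apply/funext => x; rewrite mulN1r.
by apply: CdM => //; exact: Cd_cst.
Qed.

Lemma CdB k f g : Cd k f -> Cd k g -> Cd k (fun x => f x - g x).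
Proof. by move=> Cf Cg; apply: CdD => //; exact: CdN. Qed.

Lemma Cd_sum k (J : Type) (r : seq J) (F : J -> V -> R) :
  (forall j, Cd k (F j)) -> Cd k (fun x => \sum_(j <- r) F j x).
Proof.
move=> CF; elim: r => [|j r IH].
  by under eq_fun do rewrite big_nil; apply: Cd_cst.
by under eq_fun do rewrite big_cons; apply: CdD.
Qed.

Lemma Cd_prod k (J : Type) (r : seq J) (F : J -> V -> R) :
  (forall j, Cd k (F j)) -> Cd k (fun x => \prod_(j <- r) F j x).
Proof.
move=> CF; elim: r => [|j r IH].
  by under eq_fun do rewrite big_nil; apply: Cd_cst.
by under eq_fun do rewrite big_cons; apply: CdM.
Qed.

Lemma is_derive_chain f (g : R -> R) x w df b :
  is_derive x w f df -> is_derive (f x) 1 g b ->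
  is_derive x w (fun y => g (f y)) (b * df).
Proof.
move=> [fx <-] gx.
have f1 : is_derive (0 : R) 1 (fun h : R => f (h *: w + x)) ('D_w f x).
  apply: DeriveDef; first exact: (derivable1P f x w).1 fx.
  rewrite /derive; set g1 := (X in fmap X _); set g2 := (X in _ = lim (fmap X _)).
  suff -> : g1 = g2 by []; rewrite /g1 /g2; apply/funext => h /=.
  by rewrite addr0 scale0r add0r [_%:A]mulr1.
have E0 : f (0 *: w + x) = f x by rewrite scale0r add0r.
have gx' : is_derive (f ((0 : R) *: w + x)) 1 g b by rewrite E0.
have [d1 d2] := @is_derive1_comp _ g (fun h : R => f (h *: w + x)) 0 _ _ gx' f1.
apply: DeriveDef; first exact: (derivable1P (fun y => g (f y)) x w).2 d1.
rewrite -d2 /derive; set g1 := (X in fmap X _); set g2 := (X in _ = lim (fmap X _)).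
suff -> : g1 = g2 by []; rewrite /g1 /g2; apply/funext => h /=.
by rewrite addr0 scale0r add0r [_%:A]mulr1.
Qed.

Lemma CdV k f : (forall x, f x != 0) -> Cd k f -> Cd k (fun x => (f x)^-1).
Proof.
move=> f0; have cV h : continuous h -> (forall x, h x != 0) ->
    continuous (fun x : V => (h x : R)^-1).
  by move=> ch h0 x; apply: cvgV => //; exact: ch.
elim: k => [|k IH] Cf.
  by split=> //; apply: cV => //; exact: (Cd_cont Cf).
apply: Cd_intro; first by apply: cV => //; exact: (Cd_cont Cf).
move=> i.
exists (fun x => - ((f x)^-1 * (f x)^-1) * 'D_(v i) f x).
  move=> x; have [d1 d2] := Cd_is_derive i Cf x.
  apply: DeriveDef; first exact: derivableV.
  by rewrite deriveV// -exprVn expr2.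
apply: CdM; last exact: Cd_deriv.
by apply: CdN; apply: CdM; apply: IH; exact: Cd_pred.
Qed.

Lemma Cd_ln k f : (forall x, 0 < f x) -> Cd k f -> Cd k (fun x => ln (f x)).
Proof.
move=> f0 Cf; have cl : continuous (fun x => ln (f x)).
  move=> x; apply: (@continuous_comp _ _ _ f (@ln R)).
    exact: (Cd_cont Cf).
  exact: continuous_ln.
case: k Cf => [|k] Cf; first by split.
apply: Cd_intro => // i; exists (fun x => (f x)^-1 * 'D_(v i) f x).
  move=> x; apply: is_derive_chain; first exact: (Cd_is_derive i Cf).
  exact: is_derive1_ln.
apply: CdM; last exact: Cd_deriv.
by apply: CdV => [x|]; [rewrite gt_eqF|exact: Cd_pred].
Qed.

End DirectionalCk.

Definition C1d (R : realType) (k : nat) (g : R -> R) : Prop :=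
  @Cd R R unit (fun=> 1) k g.

Section DirectionalComp.
Context (R : realType) (V : normedModType R) (I : Type) (v : I -> V).

Lemma Cd_comp k (g : R -> R) (f : V -> R) :
  C1d k g -> Cd v k f -> Cd v k (fun x => g (f x)).
Proof.
have cc (h : R -> R) (e : V -> R) : continuous h -> continuous e ->
    continuous (fun x => h (e x)).
  by move=> ch ce x; apply: (@continuous_comp _ _ _ e h); [exact: ce|exact: ch].
elim: k g => [|k IH] g Cg Cf.
  by split=> //; apply: cc; [exact: (Cd_cont Cg)|exact: (Cd_cont Cf)].
apply: Cd_intro; first by apply: cc; [exact: (Cd_cont Cg)|exact: (Cd_cont Cf)].
move=> i; exists (fun x => 'D_1 g (f x) * 'D_(v i) f x).
  move=> x; apply: is_derive_chain; first exact: (Cd_is_derive i Cf).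
  exact: (Cd_is_derive tt Cg).
apply: CdM; last exact: Cd_deriv.
exact: (IH (fun y => 'D_1 g y) (Cd_deriv tt Cg) (Cd_pred Cf)).
Qed.

Lemma C1d_expR k : C1d k (@expR R).
Proof.
elim: k => [|k IH]; first by split=> //; exact: continuous_expR.
apply: Cd_intro; first exact: continuous_expR.
by move=> _; exists expR => // x; exact: is_derive_expR.
Qed.

End DirectionalComp.

Lemma CkE (R : realType) (n k : nat) (f : 'rV[R]_n -> R) :
  Ck k f = Cd (fun i : 'I_n => delta_mx 0 i : 'rV[R]_n) k f.
Proof.
elim: k f => [//|k IH] f /=; congr (_ /\ _).
by apply: eq_forall => i; congr (_ /\ _); rewrite -IH.
Qed.

Lemma C1d_id (R : realType) k : C1d k (fun x : R => x).
Proof.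
case: k => [|k]; first by split=> // x; exact: cvg_id.
apply: Cd_intro => [x|_]; first exact: cvg_id.
by exists (fun=> 1); [move=> x; exact: is_derive_id | exact: Cd_cst].
Qed.

Lemma C1d_is_derive (R : realType) k (g : R -> R) : C1d k.+1 g ->
  forall x : R, is_derive x 1 g ('D_1 g x).
Proof. by move=> Cg x; exact: (Cd_is_derive tt Cg x). Qed.

Lemma C1d_derive (R : realType) k (g : R -> R) : C1d k.+1 g ->
  C1d k (fun x => 'D_1 g x).
Proof. by move=> Cg; exact: (Cd_deriv tt Cg). Qed.

Lemma C1d_pred (R : realType) k (g : R -> R) : C1d k.+1 g -> C1d k g.
Proof. exact: Cd_pred. Qed.

(** * A smooth step function *)

Section SmoothStep.
Context (R : realType).
Implicit Types (x s a r : R) (m k : nat).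

(** The functions x^(-m) exp(-1/x), extended by 0. Each derivative of one is a
    combination of others, which makes the whole family smooth. *)
Definition flat m x : R := if 0 < x then x^-1 ^+ m * expR (- x^-1) else 0.

Lemma flat_ge0 m x : 0 <= flat m x.
Proof.
rewrite /flat; case: ifPn => // x0.
by rewrite mulr_ge0 ?expR_ge0// exprn_ge0// invr_ge0 ltW.
Qed.

Lemma flat_le0 m x : x <= 0 -> flat m x = 0.
Proof. by rewrite /flat leNgt => /negbTE ->. Qed.

Lemma flat_gt0 x : 0 < x -> 0 < flat 0 x.
Proof. by move=> x0; rewrite /flat x0 expr0 mul1r expR_gt0. Qed.

(** As exp(1/x) >= (1/(k x))^k with k = m + 2, each [flat m] decays
    quadratically at 0, which gives the derivative 0 there. *)
Lemma flat_quad m x : `|flat m x| <= m.+2%:R ^+ m.+2 * x ^+ 2.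
Proof.
rewrite ger0_norm ?flat_ge0// /flat; case: ifPn => [x0|_]; last first.
  by rewrite mulr_ge0 ?sqr_ge0// exprn_ge0.
set k := m.+2; have k0 : 0 < k%:R :> R by rewrite ltr0n.
have kx : 0 < k%:R * x by rewrite mulr_gt0.
rewrite expRN ler_pdivrMr ?expR_gt0//.
have e1 : (k%:R * x)^-1 <= expR ((k%:R * x)^-1).
  by rewrite (le_trans _ (expR_ge1Dx _))// lerDr.
have xE : x^-1 = k%:R * (k%:R * x)^-1 by rewrite invfM mulrA divff ?mul1r ?gt_eqF.
rewrite [in expR _]xE expRM_natl.
have e2 : ((k%:R * x)^-1) ^+ k <= expR ((k%:R * x)^-1) ^+ k.
  by rewrite lerXn2r ?nnegrE ?expR_ge0// invr_ge0 ltW.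
apply: (@le_trans _ _ (k%:R ^+ k * x ^+ 2 * ((k%:R * x)^-1) ^+ k)); last first.
  by rewrite ler_wpM2l// mulr_ge0 ?sqr_ge0// exprn_ge0.
have kk : k%:R ^+ k * k%:R^-1 ^+ k = 1 :> R.
  by rewrite -exprMn divff ?gt_eqF// expr1n.
have xx : x ^+ 2 * x^-1 ^+ 2 = 1 by rewrite -exprMn divff ?gt_eqF// expr1n.
have -> : k%:R ^+ k * x ^+ 2 * (k%:R * x)^-1 ^+ k = x^-1 ^+ m.
  rewrite invfM exprMn mulrACA kk mul1r /k -(addn2 m) exprD mulrCA xx.
  by rewrite mulr1.
by [].
Qed.

Lemma is_derive_quad_bound (f : R -> R) (C : R) :
  (forall x, `|f x| <= C * x ^+ 2) -> is_derive (0 : R) 1 f 0.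
Proof.
move=> fC; have f0 : f 0 = 0.
  by apply/eqP; rewrite -normr_le0 (le_trans (fC 0))// expr0n mulr0.
have C0 : 0 <= C by have := fC 1; rewrite expr1n mulr1; exact: le_trans.
have cv : h^-1 *: (f (h *: 1 + 0) - f 0) @[h --> 0^'] --> (0 : R).
  apply/cvgrPdist_le => /= e e0; near=> h.
  rewrite f0 subr0 sub0r normrN [_%:A]mulr1 addr0 normrM normfV.
  have h0 : 0 < `|h| by rewrite normr_gt0; near: h; exact: nbhs_dnbhs_neq.
  rewrite ler_pdivrMl// (le_trans (fC h))// -[h ^+ 2]real_normK ?num_real//.
  rewrite expr2 mulrCA ler_wpM2l//.
  rewrite (@le_trans _ _ ((C + 1) * `|h|)) ?ler_wpM2r ?lerDl//.
  rewrite -ler_pdivlMl ?ltr_wpDl// mulrC.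
  near: h; apply: dnbhs0_le; rewrite divr_gt0 ?ltr_wpDl//.
apply: DeriveDef; first by apply/cvg_ex; exists 0.
exact: cvg_lim.
Unshelve. all: by end_near. Qed.

Lemma is_derive_flat m x :
  is_derive x 1 (flat m) (flat m.+2 x - m%:R * flat m.+1 x).
Proof.
have [x0|x0|->] := ltgtP x 0.
- rewrite !flat_le0 ?ltW// mulr0 subr0.
  apply: (@near_eq_is_derive R R R (fun=> 0)).
  near=> y; rewrite flat_le0// ltW//; near: y; exact: lt_nbhsl.
- rewrite /flat x0.
  have dV : is_derive x 1 (fun y : R => y^-1) (- x^-1 ^+ 2).
    have [] := @is_deriveV R id x 1 1 (lt0r_neq0 x0) (is_derive_id _ _).
    by move=> d1 d2; apply: DeriveDef => //; rewrite d2 exprVn [_%:A]mulr1.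
  have dX : is_derive x 1 (fun y : R => y^-1 ^+ m) (m%:R * x^-1 ^+ m.-1 * (- x^-1 ^+ 2)).
    apply: (is_derive_chain (g := fun z : R => z ^+ m) dV).
    apply: DeriveDef; first exact: exprn_derivable.
    by rewrite exp_derive [_ *: 1]mulr1.
  have dE : is_derive x 1 (fun y : R => expR (- y^-1)) (expR (- x^-1) * x^-1 ^+ 2).
    apply: is_derive_chain.
    by rewrite -[x^-1 ^+ 2]opprK; exact: is_deriveN.
  have [d1 d2] := is_deriveM dX dE.
  apply: (@near_eq_is_derive R R R (fun y => y^-1 ^+ m * expR (- y^-1))).
    near=> y; suff -> : 0 < y by [].
    near: y; exact: lt_nbhsr.
  apply: DeriveDef => //; rewrite d2 /GRing.scale /=.
  case: m {dX d1 d2} => [|m] /=; first by rewrite !mul0r expr0; ring.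
  by rewrite !exprS; ring.
- rewrite !flat_le0// mulr0 subr0; apply: is_derive_quad_bound; exact: flat_quad.
Unshelve. all: by end_near. Qed.

Lemma C1d_flat k m : C1d k (flat m).
Proof.
have cf j : continuous (flat j).
  move=> x; apply/differentiable_continuous/derivable1_diffP.
  by have [] := is_derive_flat j x.
elim: k m => [|k IH] m; first by split.
apply: Cd_intro => // _.
exists (fun x => flat m.+2 x - m%:R * flat m.+1 x); first exact: is_derive_flat.
by apply: CdB; [exact: IH|apply: CdM; [exact: Cd_cst|exact: IH]].
Qed.

Definition step x : R := flat 0 x / (flat 0 x + flat 0 (1 - x)).

Let den_gt0 x : 0 < flat 0 x + flat 0 (1 - x).
Proof.
have [x0|x0] := ltP 0 x.
  by rewrite ltr_pwDl ?flat_gt0// flat_ge0.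
by rewrite ltr_wpDl ?flat_ge0// flat_gt0//; lra.
Qed.

Lemma step_le0 x : x <= 0 -> step x = 0.
Proof. by move=> x0; rewrite /step flat_le0// mul0r. Qed.

Lemma step_ge1 x : 1 <= x -> step x = 1.
Proof.
move=> x1; rewrite /step (@flat_le0 _ (1 - x)) ?subr_le0// addr0 divff//.
by rewrite gt_eqF// flat_gt0// (lt_le_trans ltr01).
Qed.

Lemma step_ge0 x : 0 <= step x.
Proof. by rewrite /step divr_ge0 ?flat_ge0// ltW. Qed.

Lemma step_le1 x : step x <= 1.
Proof. by rewrite /step ler_pdivrMr// mul1r lerDl flat_ge0. Qed.

Lemma C1d_step k : C1d k step.
Proof.
apply: CdM; first exact: C1d_flat.
apply: CdV => [x|]; first by rewrite gt_eqF.
apply: CdD; first exact: C1d_flat.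
apply: Cd_comp; first exact: C1d_flat.
by apply: CdB; [exact: Cd_cst|exact: C1d_id].
Qed.

Lemma derive_near_cst (f : R -> R) x (b : R) :
  (\near x, f x = b) -> 'D_1 f x = 0.
Proof. by move=> fb; rewrite (near_eq_derive _ (g := cst b) fb) derive_cst. Qed.

(** The derivative of [step] is continuous, and it vanishes outside the segment
    from 0 to 1. *)
Lemma step_derive_bound : exists2 C : R, 0 <= C & forall x, `|'D_1 step x| <= C.
Proof.
have cs : continuous (fun x => 'D_1 step x) := Cd_cont (C1d_derive (C1d_step 1)).
have cw : {within `[0, 1], continuous (fun x => `|'D_1 step x|)}.
  apply: continuous_subspaceT => x.
  by apply: cvg_norm; exact: cs.
have [c _ cmax] := EVT_max ler01 cw.
exists `|'D_1 step c| => // x.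
have [x0|x0] := ltP x 0.
  rewrite (@derive_near_cst _ x 0) ?normr0//; near=> y; rewrite step_le0// ltW//.
  by near: y; exact: lt_nbhsl.
have [x1|x1] := ltP 1 x.
  rewrite (@derive_near_cst _ x 1) ?normr0//; near=> y; rewrite step_ge1// ltW//.
  by near: y; exact: lt_nbhsr.
by apply: cmax; rewrite in_itv/= x0.
Unshelve. all: by end_near. Qed.

End SmoothStep.

(** * The truncated Newtonian kernel *)

Section Kernel.
Context (R : realType).
Implicit Types (s a r : R).

(** s^(-3/2) for s > 0. *)
Definition pow32 s : R := expR (- (3 / 2) * ln s).

(** The identity above [a], lifted to positive values below, so that negative
    powers of it are smooth on the whole line. *)
Definition lift_low a s : R := s * step (s / a) + a * (1 - step (s / a)).

Lemma lift_low_gt0 a s : 0 < a -> 0 < lift_low a s.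
Proof.
move=> a0; rewrite /lift_low.
have [s0|s0] := leP s 0.
  rewrite step_le0 ?mulr0 ?add0r ?subr0 ?mulr1//.
  by rewrite pmulr_lle0 ?invr_gt0.
have := step_ge0 (s / a); have := step_le1 (s / a).
set t := step _ => t1 t0.
have [->|tn0] := eqVneq t 0; first by rewrite mulr0 add0r subr0 mulr1.
have tp : 0 < t by rewrite lt0r tn0.
by apply: ltr_pwDl; [exact: mulr_gt0|apply: mulr_ge0; rewrite ?subr_ge0// ltW].
Qed.

Lemma lift_low_id a s : 0 < a -> a <= s -> lift_low a s = s.
Proof.
move=> a0 sa; rewrite /lift_low step_ge1 ?subrr ?mulr0 ?mulr1 ?addr0//.
by rewrite ler_pdivlMr ?mul1r.
Qed.

Lemma C1d_scale k a : C1d k (fun s => s / a).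
Proof. by apply: CdM; [exact: C1d_id|exact: Cd_cst]. Qed.

(** The power s^(-3/2), made smooth below [a] and cut off smoothly between
    [r ^+ 2] and [2 * r ^+ 2]. *)
Definition kern a r s : R :=
  pow32 (lift_low a s) * (1 - step (s / r ^+ 2 - 1)).

Lemma C1d_kern k a r : 0 < a -> C1d k (kern a r).
Proof.
move=> a0; have Cs0 : C1d k (fun s => step (s / a)).
  by apply: Cd_comp; [exact: C1d_step|exact: C1d_scale].
apply: CdM; last first.
  apply: CdB; first exact: Cd_cst.
  apply: Cd_comp; first exact: C1d_step.
  by apply: CdB; [exact: C1d_scale|exact: Cd_cst].
apply: (Cd_comp (C1d_expR _ _)).
apply: CdM; first exact: Cd_cst.
apply: Cd_ln => [x|]; first exact: lift_low_gt0.
apply: CdD; apply: CdM => //; [exact: C1d_id|exact: Cd_cst|].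
by apply: CdB => //; exact: Cd_cst.
Qed.

Lemma kern_far a r s : 0 < r -> 2 * r ^+ 2 <= s -> kern a r s = 0.
Proof.
move=> r0 rs; rewrite /kern step_ge1 ?subrr ?mulr0//.
by rewrite lerBrDr ler_pdivlMr ?exprn_gt0.
Qed.

Lemma kern_mid a r s : 0 < a -> 0 < r -> a <= s <= r ^+ 2 ->
  kern a r s = pow32 s.
Proof.
move=> a0 r0 /andP[as1 sr]; rewrite /kern lift_low_id// step_le0 ?subr0 ?mulr1//.
by rewrite subr_le0 ler_pdivrMr ?exprn_gt0// mul1r.
Qed.

Lemma is_derive_pow32 s : 0 < s -> is_derive s 1 pow32 (- (3 / 2) * pow32 s / s).
Proof.
move=> s0.
have dl : is_derive s 1 (fun y : R => - (3 / 2) * ln y) (- (3 / 2) * s^-1).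
  exact: (is_derive_mulcl (- (3 / 2)) (is_derive1_ln s0)).
have d := is_derive_chain (g := expR) dl (is_derive_expR _).
by apply: (is_derive_eq d); rewrite /pow32; ring.
Qed.

(** With z = x - y and s = |z|^2, the quantity D is the divergence of z kern(s).
    The exponent -3/2 is the one for which 3 G + 2 s G' = 0 when G is the pure
    power; what remains is the derivative of the cutoff, which lives where s is
    of order r^2 and is of size s^(-1/2) r^(-2). *)
Lemma kern_div : exists2 C : R, 0 <= C & forall a r s, 0 < a -> 0 < r ->
  a < r ^+ 2 -> a < s ->
  let D := 3 * kern a r s + 2 * s * 'D_1 (kern a r) s in
  (`|D| <= C / r ^+ 3) /\ (s < r ^+ 2 \/ 2 * r ^+ 2 < s -> D = 0).
Proof.
have [C C0 stepC] := step_derive_bound R.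
exists (2 * C) => [|a r s a0 r0 ar as1 D]; first by rewrite mulr_ge0.
have s0 : 0 < s := lt_trans a0 as1.
have r20 : 0 < r ^+ 2 by rewrite exprn_gt0.
set c := fun t : R => 1 - step (t / r ^+ 2 - 1).
have dstep : is_derive (s / r ^+ 2 - 1) 1 (@step R) ('D_1 (@step R) (s / r ^+ 2 - 1)).
  exact: (C1d_is_derive (C1d_step R 1)).
have dlin : is_derive s 1 (fun t : R => t / r ^+ 2 - 1) (r ^+ 2)^-1.
  have d := is_derive_sub (is_derive_mul (is_derive_id s 1)
    (is_derive_const ((r ^+ 2)^-1) s 1)) (is_derive_const (1 : R) s 1).
  by apply: (is_derive_eq d); rewrite mulr0 add0r subr0 mulr1.
have dc : is_derive s 1 c (- ('D_1 (@step R) (s / r ^+ 2 - 1) / r ^+ 2)).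
  have d := is_derive_sub (is_derive_const (1 : R) s 1) (is_derive_chain dlin dstep).
  by apply: (is_derive_eq d); rewrite sub0r.
have dk : 'D_1 (kern a r) s = pow32 s * (- ('D_1 (@step R) (s / r ^+ 2 - 1) / r ^+ 2))
     + c s * (- (3 / 2) * pow32 s / s).
  have [_ <-] := is_derive_mul (is_derive_pow32 s0) dc.
  apply: near_eq_derive; near=> t; rewrite /kern lift_low_id//.
  by apply: ltW; near: t; exact: lt_nbhsr.
have E : D =
    - (2 * (s * pow32 s) * 'D_1 (@step R) (s / r ^+ 2 - 1) / r ^+ 2).
  rewrite /D dk /kern lift_low_id ?ltW// -/(c s); field.
  by rewrite !gt_eqF.
have zero : s < r ^+ 2 \/ 2 * r ^+ 2 < s -> 'D_1 (@step R) (s / r ^+ 2 - 1) = 0.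
  case=> sr.
    have H : s / r ^+ 2 - 1 < 0 by rewrite subr_lt0 ltr_pdivrMr ?mul1r.
    apply: derive_near_cst (0 : R) _; near=> t; rewrite step_le0// ltW//.
    by near: t; exact: lt_nbhsl.
  have H : 1 < s / r ^+ 2 - 1 by rewrite ltrBrDr ltr_pdivlMr.
  apply: derive_near_cst (1 : R) _; near=> t; rewrite step_ge1// ltW//.
  by near: t; exact: lt_nbhsr.
rewrite E; split; last by move=> /zero ->; rewrite mulr0 mul0r oppr0.
have [sr|sr] := ltP s (r ^+ 2).
  rewrite zero; last by left.
  by rewrite mulr0 mul0r oppr0 normr0 divr_ge0 ?mulr_ge0 ?exprn_ge0// ltW.
have sp : s * pow32 s <= r^-1.
  rewrite /pow32 -{1}[s]lnK ?posrE// -expRD -[r^-1]lnK ?posrE ?invr_gt0//.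
  rewrite ler_expR lnV ?posrE//.
  have : ln (r ^+ 2) <= ln s by rewrite ler_ln ?posrE.
  by rewrite lnXn//; set x := ln s; set y := ln r; rewrite mulr2n => h; lra.
set T := 'D_1 (@step R) _; rewrite normrN.
have k0 : 0 <= 2 * (s * pow32 s) / r ^+ 2.
  by rewrite divr_ge0 ?mulr_ge0 ?expR_ge0// ltW.
rewrite (_ : _ / _ = 2 * (s * pow32 s) / r ^+ 2 * T); last by rewrite mulrAC.
rewrite normrM (ger0_norm k0).
rewrite (_ : 2 * C / r ^+ 3 = 2 * r^-1 / r ^+ 2 * C); last by field; rewrite gt_eqF.
apply: ler_pM; [exact: k0|exact: normr_ge0| |exact: stepC].
by rewrite ler_pM2r ?invr_gt0// ler_pM2l.
Unshelve. all: by end_near. Qed.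

End Kernel.

(** * Coordinates and Lebesgue measure on R^3 *)

(** The domain of [leb3], with the measurable structure that [leb3] is built
    on: it has the same measurable sets as the default one of [R * R * R], but
    is a different instance. *)
Notation T3 R :=
  (measurableTypeR R * measurableTypeR R * measurableTypeR R)%type.

Section Coordinates.
Context (R : realType).
Implicit Types (a b x y : 'rV[R]_3) (L : R).

Definition o0 : 'I_3 := @Ordinal 3 0 isT.
Definition o1 : 'I_3 := @Ordinal 3 1 isT.
Definition o2 : 'I_3 := @Ordinal 3 2 isT.

Lemma ord3P (P : 'I_3 -> Prop) : P o0 -> P o1 -> P o2 -> forall i, P i.
Proof.
move=> P0 P1 P2 [[|[|[|//]]] i3].
- by rewrite (_ : Ordinal _ = o0)//; exact: val_inj.
- by rewrite (_ : Ordinal _ = o1)//; exact: val_inj.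
- by rewrite (_ : Ordinal _ = o2)//; exact: val_inj.
Qed.

Lemma sum3 (V : nmodType) (F : 'I_3 -> V) : \sum_i F i = F o0 + F o1 + F o2.
Proof.
rewrite !big_ord_recl big_ord0 addr0 addrA.
by do 2?[congr (_ + _)]; congr F; exact: val_inj.
Qed.

Lemma vec3E0 (p : R * R * R) : vec3 p 0 o0 = p.1.1. Proof. by rewrite mxE. Qed.
Lemma vec3E1 (p : R * R * R) : vec3 p 0 o1 = p.1.2. Proof. by rewrite mxE. Qed.
Lemma vec3E2 (p : R * R * R) : vec3 p 0 o2 = p.2. Proof. by rewrite mxE. Qed.
Definition vec3E := (vec3E0, vec3E1, vec3E2).

Definition obox a b : set 'rV[R]_3 := [set x | forall i, a 0 i < x 0 i < b 0 i].

Definition cbox L : set 'rV[R]_3 := [set x | forall i, `|x 0 i| <= L].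

Lemma vec3_obox a b : @vec3 R @^-1` obox a b =
  (`]a 0 o0, b 0 o0[ `*` `]a 0 o1, b 0 o1[ `*` `]a 0 o2, b 0 o2[)%classic.
Proof.
apply/seteqP; split => -[[s t] w] /=.
  move=> h; have := h o0; have := h o1; have := h o2.
  by rewrite !vec3E /= !in_itv.
rewrite !in_itv /= => -[[h0 h1] h2].
by elim/ord3P; rewrite vec3E.
Qed.

Lemma vec3_cbox L : @vec3 R @^-1` cbox L =
  (`[- L, L] `*` `[- L, L] `*` `[- L, L])%classic.
Proof.
apply/seteqP; split => -[[s t] w] /=.
  move=> h; have := h o0; have := h o1; have := h o2.
  by rewrite !vec3E /= !in_itv /= !ler_norml.
rewrite !in_itv /= -!ler_norml => -[[h0 h1] h2].
by elim/ord3P; rewrite vec3E.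
Qed.

Lemma measurable_obox a b : measurable (@vec3 R @^-1` obox a b : set (T3 R)).
Proof. by rewrite vec3_obox; do 2?[apply: measurableX]. Qed.

Lemma measurable_cbox L : measurable (@vec3 R @^-1` cbox L : set (T3 R)).
Proof. by rewrite vec3_cbox; do 2?[apply: measurableX]. Qed.

Lemma leb3X (A B C : set R) : measurable A -> measurable B -> measurable C ->
  leb3 (A `*` B `*` C) =
  (lebesgue_measure A * lebesgue_measure B * lebesgue_measure C)%E.
Proof.
move=> mA mB mC; rewrite /leb3 product_measure1E//; last exact: measurableX.
by congr (_ * _)%E; exact: (product_measure1E (@lebesgue_measure R) (@lebesgue_measure R)).
Qed.

Lemma leb3_cbox L : 0 <= L -> leb3 (@vec3 R @^-1` cbox L) = ((2 * L) ^+ 3)%:E.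
Proof.
move=> L0; rewrite vec3_cbox leb3X// lebesgue_measure_itv /= lte_fin.
case: ifPn => [_|]; first by rewrite -EFinB -!EFinM; congr EFin; ring.
by rewrite -leNgt => h; rewrite !mul0e (_ : L = 0) ?mulr0 ?expr0n//; lra.
Qed.

Lemma cboxT : \bigcup_n (@vec3 R @^-1` cbox n%:R) = setT.
Proof.
rewrite -subTset => p _.
pose m := \sum_i `|vec3 p 0 i|.
exists (Num.truncn m).+1 => // i; apply: ltW.
apply: le_lt_trans (truncnS_gt m).
by rewrite /m (bigD1 i)//= lerDl sumr_ge0.
Qed.

Lemma obox_cbox a b : obox a b `<=` cbox (\sum_i (`|a 0 i| + `|b 0 i|)).
Proof.
move=> x h i; apply: (@le_trans _ _ (`|a 0 i| + `|b 0 i|)); last first.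
  by rewrite (bigD1 i)//= lerDl sumr_ge0// => j _; rewrite addr_ge0.
have /andP[h1 h2] := h i; rewrite ler_norml.
have := ler_norm (b 0 i); have := ler_norm (- a 0 i); rewrite normrN.
have := normr_ge0 (a 0 i); have := normr_ge0 (b 0 i).
by move=> *; apply/andP; split; lra.
Qed.

(** A countable base of the topology: almost everywhere statements and
    measurability pass from these cubes to all open sets. *)
Definition rcube (k : 'rV[rat]_3 * nat) : set 'rV[R]_3 :=
  obox (\row_i (ratr (k.1 0 i) - k.2.+1%:R^-1))
       (\row_i (ratr (k.1 0 i) + k.2.+1%:R^-1)).

Lemma open_rcubes (A : set 'rV[R]_3) : open A ->
  A = \bigcup_(k in [set k | rcube k `<=` A]) rcube k.
Proof.
move=> oA; apply/seteqP; split => [x Ax|x [k /= kA kx]]; last exact: kA.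
have /nbhs_ballP[e /= e0 eA] : nbhs x A by exact: open_nbhs_nbhs.
have [n ne] : exists n, n.+1%:R^-1 < e / 2.
  exists (Num.truncn (e / 2)^-1); rewrite invf_plt ?posrE ?divr_gt0//.
  exact: truncnS_gt.
have n0 : 0 < n.+1%:R^-1 :> R by rewrite invr_gt0.
set d : R := n.+1%:R^-1 in ne n0.
have q_ i : exists q : rat, `|x 0 i - ratr q| < d.
  have [q] := @rat_in_itvoo R (x 0 i) (x 0 i + d) (ltac:(by rewrite ltrDl)).
  rewrite in_itv /= => /andP[q1 q2]; exists q.
  by rewrite ltr_norml; apply/andP; split; lra.
have {q_}[q qx] := choice q_.
exists (\row_i q i, n) => /=.
  move=> y hy; apply: eA; rewrite mx_norm_ball /ball_ /=.
  rewrite [`|_|]mx_normrE; apply: bigmax_lt => //= -[j i] _ /=.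
  rewrite (ord1 j) !mxE.
  have := hy i; rewrite !mxE /= -/d => /andP[h1 h2]; have := qx i.
  rewrite !ltr_norml => /andP[h3 h4]; apply/andP; split; lra.
move=> i; rewrite !mxE /= -/d; have := qx i; rewrite ltr_norml => /andP[h3 h4].
by apply/andP; split; lra.
Qed.

Lemma measurable_open (A : set 'rV[R]_3) : open A ->
  measurable (@vec3 R @^-1` A : set (T3 R)).
Proof.
move=> oA; rewrite (open_rcubes oA) preimage_bigcup bigcup_mkcond.
apply: countable_bigcupT_measurable; first exact: countableP.
by move=> k; case: ifP => _; [exact: measurable_obox|exact: measurable0].
Qed.

Lemma measurable_cont (f : 'rV[R]_3 -> R) D : continuous f ->
  @measurable_fun _ _ (T3 R) R D (f \o @vec3 R).
Proof.
move=> cf; apply: measurable_funTS.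
apply: (measurability _ (RGenOpens.measurableE R)) => _ [_ [a [b ->]] <-].
rewrite setTI comp_preimage; apply: measurable_open.
apply: (open_comp (fun x _ => cf x)); exact: interval_open.
Qed.

End Coordinates.

Lemma leb2_sigma_finite (R : realType) : sigma_finite setT (@leb2 R).
Proof.
exists (fun n => `[- n%:R, n%:R]%classic `*` `[- n%:R, n%:R]%classic).
  apply/esym; rewrite -subTset => -[x y] _.
  have [n _ h] : (\bigcup_n (@vec3 R @^-1` cbox n%:R)) (x, y, 0) by rewrite cboxT.
  by exists n => //; move: h; rewrite vec3_cbox => -[].
move=> n; split; first exact: measurableX.
pose mu := @lebesgue_measure R.
pose I : set R := `[- n%:R, n%:R]%classic.
have mI : measurable I by exact: measurable_itv.
have -> : leb2 (I `*` I) = (mu I * mu I)%E by exact: (product_measure1E mu mu mI mI).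
rewrite /mu /I lebesgue_measure_itv /=.
by case: ifP => _; rewrite ?mul0e ?ltry// -EFinB -EFinM ltry.
Qed.

HB.instance Definition _ (R : realType) :=
  Measure_isSigmaFinite.Build _ _ _ (@leb2 R) (@leb2_sigma_finite R).

(** * Integrable and square integrable functions *)

Section SquareIntegrable.
Context (R : realType).
Implicit Types (D E : set 'rV[R]_3) (f g h : 'rV[R]_3 -> R).

Local Notation mu := (@leb3 R).
Local Notation "'pre' D" := (@vec3 R @^-1` D) (at level 10, D at level 9).

Let leb3_ae_filter : Filter (almost_everywhere mu).
Proof. exact: ae_filter_ringOfSetsType. Qed.

Lemma ae3_mono2 D (P Q S : 'rV[R]_3 -> Prop) : ae3 D P -> ae3 D Q ->
  (forall x, D x -> P x -> Q x -> S x) -> ae3 D S.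
Proof.
move=> hP hQ h; apply: (@filterS2 _ _ leb3_ae_filter _ _ _ _ hP hQ) => p Pp Qp Dp.
by apply: h => //; [exact: Pp|exact: Qp].
Qed.

Lemma ae3_mono D (P S : 'rV[R]_3 -> Prop) : ae3 D P ->
  (forall x, D x -> P x -> S x) -> ae3 D S.
Proof. by move=> hP h; apply: (ae3_mono2 hP hP) => x Dx Px _; exact: h. Qed.

Lemma ae3_sub D E (P : 'rV[R]_3 -> Prop) : E `<=` D -> ae3 D P -> ae3 E P.
Proof.
move=> ED hP; apply: (@filterS _ _ leb3_ae_filter _ _ _ hP) => p h Ep.
by apply: h; exact: ED.
Qed.

Lemma ae3_forall D (P : 'I_3 -> 'rV[R]_3 -> Prop) : (forall i, ae3 D (P i)) ->
  ae3 D (fun x => forall i, P i x).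
Proof.
move=> h; apply: (ae3_mono2 (ae3_mono2 (h o0) (h o1) (fun x _ p q => conj p q)) (h o2)).
by move=> x _ [p q] r; elim/ord3P.
Qed.

(** Measurability is taken in the structure on which [leb3] is built. *)
Definition mset D := measurable (pre D : set (T3 R)).

Definition mfun3 D f := @measurable_fun _ _ (T3 R) R (pre D) (f \o @vec3 R).

Definition summable D f := mu.-integrable (pre D) (fun p => (f (vec3 p))%:E).

Lemma summableD D f g : mset D -> summable D f -> summable D g ->
  summable D (fun x => f x + g x).
Proof.
move=> mD If Ig; rewrite /summable; under eq_fun do rewrite EFinD.
exact: (integrableD mD If Ig).
Qed.

Lemma summableB D f g : mset D -> summable D f -> summable D g ->
  summable D (fun x => f x - g x).
Proof.
move=> mD If Ig; rewrite /summable; under eq_fun do rewrite EFinB.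
exact: (integrableB mD If Ig).
Qed.

Lemma summableZ D c f : mset D -> summable D f -> summable D (fun x => c * f x).
Proof.
move=> mD If; rewrite /summable; under eq_fun do rewrite EFinM.
exact: (integrableZl mD c If).
Qed.

Lemma summable0 D : mset D -> summable D (fun=> 0).
Proof. by move=> mD; exact: integrable0. Qed.

Lemma summable_sum D (I : Type) (r : seq I) (F : I -> 'rV[R]_3 -> R) :
  mset D -> (forall i, summable D (F i)) -> summable D (fun x => \sum_(i <- r) F i x).
Proof.
move=> mD IF; elim: r => [|i r IH].
  suff -> : (fun x => \sum_(j <- [::]) F j x) = (fun=> (0 : R)) by exact: summable0.
  by apply/funext => x; rewrite big_nil.
suff -> : (fun x => \sum_(j <- i :: r) F j x) = (fun x => F i x + \sum_(j <- r) F j x) by exact: summableD.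
by apply/funext => x; rewrite big_cons.
Qed.

Lemma summable_meas D f : summable D f -> mfun3 D f.
Proof. by move=> /measurable_int/measurable_EFinP. Qed.

Lemma summable_sub D E f : mset D -> mset E -> E `<=` D -> summable D f -> summable E f.
Proof. by move=> mD mE ED; apply: integrableS => // p; exact: ED. Qed.

Lemma Int3D D f g : mset D -> summable D f -> summable D g ->
  Int3 D (fun x => f x + g x) = Int3 D f + Int3 D g.
Proof. by move=> mD If Ig; exact: (RintegralD mD If Ig). Qed.

Lemma Int3B D f g : mset D -> summable D f -> summable D g ->
  Int3 D (fun x => f x - g x) = Int3 D f - Int3 D g.
Proof. by move=> mD If Ig; exact: (RintegralB mD If Ig). Qed.

Lemma Int3Z D c f : mset D -> summable D f ->
  Int3 D (fun x => c * f x) = c * Int3 D f.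
Proof. by move=> mD If; exact: (RintegralZl c mD If). Qed.

Lemma eq_Int3 D f g : (forall x, D x -> f x = g x) -> Int3 D f = Int3 D g.
Proof. by move=> fg; apply: eq_Rintegral => p; rewrite inE; exact: fg. Qed.

Lemma Int30 D : Int3 D (fun=> 0) = 0.
Proof. by rewrite /Int3 /Rintegral integral0. Qed.

Lemma Int3_sum D (I : Type) (r : seq I) (F : I -> 'rV[R]_3 -> R) :
  mset D -> (forall i, summable D (F i)) ->
  Int3 D (fun x => \sum_(i <- r) F i x) = \sum_(i <- r) Int3 D (F i).
Proof.
move=> mD IF; elim: r => [|i r IH].
  by rewrite big_nil -[RHS](Int30 D); apply: eq_Int3 => x _; rewrite big_nil.
rewrite big_cons -IH -Int3D//; last exact: summable_sum.
by apply: eq_Int3 => x _; rewrite big_cons.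
Qed.

Lemma le_Int3 D f g : mset D -> summable D f -> summable D g ->
  (forall x, D x -> f x <= g x) -> Int3 D f <= Int3 D g.
Proof. by move=> mD If Ig fg; apply: (le_Rintegral mD If Ig) => p; exact: fg. Qed.

Lemma Int3_ge0 D f : (forall x, D x -> 0 <= f x) -> 0 <= Int3 D f.
Proof. by move=> f0; apply: Rintegral_ge0 => p; exact: f0. Qed.

Lemma Int3_mkcond D f : Int3 D f = Int3 setT (f \_ D).
Proof.
by rewrite /Int3 Rintegral_mkcond.
Qed.

Lemma Int3_vanish D E f : D `<=` E -> (forall x, E x -> ~ D x -> f x = 0) ->
  Int3 D f = Int3 E f.
Proof.
move=> DE f0; rewrite (Int3_mkcond D) (Int3_mkcond E); congr Int3.
apply/funext => x; rewrite /patch; case: ifPn => [|/negP]; rewrite inE => Dx.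
  by rewrite ifT// inE; exact: DE.
by case: ifPn => //; rewrite inE => Ex; rewrite f0.
Qed.

Lemma ae3_eq_Int3 D f g : mset D ->
  mfun3 D f -> mfun3 D g ->
  ae3 D (fun x => f x = g x) -> Int3 D f = Int3 D g.
Proof.
move=> mD mf mg fg; rewrite /Int3 /Rintegral; congr fine.
apply: ae_eq_integral => //; [exact/measurable_EFinP|exact/measurable_EFinP|].
by apply: (@filterS _ _ (leb3_ae_filter) _ _ _ fg) => p h Dp; congr EFin; exact: h.
Qed.

Lemma L2_meas D f : L2 D f -> mfun3 D f.
Proof. by case. Qed.

Lemma L2_summable_sq D f : mset D -> L2 D f -> summable D (fun x => f x ^+ 2).
Proof.
move=> mD [mf f2]; apply/integrableP; split.
  by apply/measurable_EFinP; exact: (measurable_funX 2 mf).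
by under eq_integral do rewrite gee0_abs ?lee_fin ?sqr_ge0//.
Qed.

Lemma summable_le D f g : mset D ->
  mfun3 D f -> (forall x, D x -> `|f x| <= g x) ->
  summable D g -> summable D f.
Proof.
move=> mD mf fg; apply: le_integrable => //; first exact/measurable_EFinP.
by move=> p Dp; rewrite lee_fin (le_trans (fg _ Dp))// ler_norm.
Qed.

Lemma L2_of_sq D f : mset D -> mfun3 D f ->
  summable D (fun x => f x ^+ 2) -> L2 D f.
Proof.
move=> mD mf /integrableP[_ f2]; split=> //; rewrite /L2norm2.
by move: f2; under eq_integral do rewrite gee0_abs ?lee_fin ?sqr_ge0//.
Qed.

Lemma L2_mul_summable D f g : mset D -> L2 D f -> L2 D g ->
  summable D (fun x => f x * g x).
Proof.
move=> mD Lf Lg; apply: (@summable_le _ _ (fun x => f x ^+ 2 + g x ^+ 2)) => //.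
- exact: (measurable_funM (L2_meas Lf) (L2_meas Lg)).
- move=> x _; rewrite normrM -(real_normK (num_real (f x))).
  rewrite -(real_normK (num_real (g x))).
  have := sqr_ge0 (`|f x| - `|g x|); have := normr_ge0 (f x); have := normr_ge0 (g x).
  nra.
- by apply: summableD => //; exact: L2_summable_sq.
Qed.

Lemma L2D D f g : mset D -> L2 D f -> L2 D g -> L2 D (fun x => f x + g x).
Proof.
move=> mD Lf Lg; have mfg := measurable_funD (L2_meas Lf) (L2_meas Lg).
apply: L2_of_sq => //.
apply: (@summable_le _ _ (fun x => 2 * (f x ^+ 2 + g x ^+ 2))) => //.
- exact: (measurable_funX 2 mfg).
- by move=> x _; rewrite ger0_norm ?sqr_ge0//; have := sqr_ge0 (f x - g x); nra.
- by apply: summableZ => //; apply: summableD => //; exact: L2_summable_sq.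
Qed.

Lemma L2Z D c f : mset D -> L2 D f -> L2 D (fun x => c * f x).
Proof.
move=> mD Lf.
have mcf : mfun3 D (fun x => c * f x).
  exact: (measurable_funM (measurable_cst c) (L2_meas Lf)).
apply: L2_of_sq => //.
rewrite (_ : (fun _ => _) = fun x => c ^+ 2 * f x ^+ 2).
  by apply: summableZ => //; exact: L2_summable_sq.
by apply/funext => x; rewrite exprMn.
Qed.

Lemma L2B D f g : mset D -> L2 D f -> L2 D g -> L2 D (fun x => f x - g x).
Proof.
move=> mD Lf Lg; rewrite (_ : (fun _ => _) = fun x => f x + (-1) * g x).
  by apply: L2D => //; exact: L2Z.
by apply/funext => x; rewrite mulN1r.
Qed.

Lemma L20 D : mset D -> L2 D (fun=> 0).
Proof.
move=> mD; apply: L2_of_sq => //; first exact: measurable_cst.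
suff -> : (fun _ : 'rV[R]_3 => (0 : R) ^+ 2) = (fun=> (0 : R)) by exact: summable0.
by apply/funext => x; rewrite expr0n.
Qed.

Lemma L2_sum D (I : Type) (r : seq I) (F : I -> 'rV[R]_3 -> R) :
  mset D -> (forall i, L2 D (F i)) -> L2 D (fun x => \sum_(i <- r) F i x).
Proof.
move=> mD IF; elim: r => [|i r IH].
  suff -> : (fun x => \sum_(j <- [::]) F j x) = (fun=> (0 : R)) by exact: L20.
  by apply/funext => x; rewrite big_nil.
suff -> : (fun x => \sum_(j <- i :: r) F j x) = (fun x => F i x + \sum_(j <- r) F j x) by exact: L2D.
by apply/funext => x; rewrite big_cons.
Qed.

Lemma L2_sub D E f : mset D -> mset E -> E `<=` D -> L2 D f -> L2 E f.
Proof.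
move=> mD mE ED Lf; apply: L2_of_sq => //.
  by apply: measurable_funS (L2_meas Lf) => // p; exact: ED.
by apply: (summable_sub mD) => //; exact: L2_summable_sq.
Qed.

Lemma L2norm2E D f : mset D -> L2 D f -> L2norm2 D f = (Int3 D (fun x => f x ^+ 2))%:E.
Proof.
move=> mD Lf; rewrite /Int3 /Rintegral fineK//.
by apply: integrable_fin_num => //; exact: L2_summable_sq.
Qed.

(** The integral of (s f + t g)^2 is a nonnegative quadratic form in (s, t). *)
Lemma Int3_cauchy_schwarz D f g : mset D -> L2 D f -> L2 D g ->
  Int3 D (fun x => f x * g x) ^+ 2 <=
  Int3 D (fun x => f x ^+ 2) * Int3 D (fun x => g x ^+ 2).
Proof.
move=> mD Lf Lg; have If := L2_summable_sq mD Lf; have Ig := L2_summable_sq mD Lg.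
have Ifg := L2_mul_summable mD Lf Lg.
set A := Int3 D (fun x => f x ^+ 2); set B := Int3 D _; set C := Int3 D (fun x => g x ^+ 2).
have A0 : 0 <= A by apply: Int3_ge0 => x _; exact: sqr_ge0.
have C0 : 0 <= C by apply: Int3_ge0 => x _; exact: sqr_ge0.
have Q s t : 0 <= s ^+ 2 * A + 2 * s * t * B + t ^+ 2 * C.
  have -> : s ^+ 2 * A + 2 * s * t * B + t ^+ 2 * C = Int3 D (fun x =>
      s ^+ 2 * f x ^+ 2 + 2 * s * t * (f x * g x) + t ^+ 2 * g x ^+ 2).
    rewrite Int3D//; [|by apply: summableD => //; exact: summableZ|exact: summableZ].
    by rewrite Int3D//; [rewrite !Int3Z|exact: summableZ|exact: summableZ].
  apply: Int3_ge0 => x _.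
  by rewrite (_ : _ + _ = (s * f x + t * g x) ^+ 2) ?sqr_ge0//; ring.
have [A_gt0|] := ltP 0 A.
  have := Q (- B) A; rewrite (_ : _ + _ = A * (A * C - B ^+ 2)); last by ring.
  by rewrite pmulr_rge0// subr_ge0.
move=> A_le0; have AE : A = 0 by apply/eqP; rewrite eq_le A_le0.
rewrite AE mul0r; have [->|B0] := eqVneq B 0; first by rewrite expr0n.
have := Q (- (C + 1) / (2 * B)) 1; rewrite AE (_ : _ + _ = - 1); last by field.
by rewrite ler0N1.
Qed.

Lemma closed_cbox L : closed (@cbox R L).
Proof.
rewrite (_ : cbox L = \bigcap_(i in [set: 'I_3]) [set x | `|x 0 i| <= L]); last first.
  by apply/seteqP; split => [x h i _|x h i]; exact: h.
apply: closed_bigI => i _.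
have ci : continuous (fun x : 'rV[R]_3 => `|x 0 i|).
  by apply: cont_norm; exact: coord_continuous.
exact: (preimage_closed (fun x _ => ci x) (@closed_le R L)).
Qed.

Lemma compact_cbox L : compact (@cbox R L).
Proof.
apply: bounded_closed_compact; last exact: closed_cbox.
exists `|L|; split; first exact: num_real.
move=> M LM x h; rewrite /Num.norm /= mx_normrE; apply: bigmax_le => //=.
  by rewrite (le_trans (normr_ge0 L))// ltW.
by move=> [j i] _ /=; rewrite (ord1 j) (le_trans (h i))// (le_trans (ler_norm L))// ltW.
Qed.

Lemma continuous_cbox_bounded L f : continuous f ->
  exists2 C, 0 <= C & forall x, cbox L x -> `|f x| <= C.
Proof.
move=> cf; have [L0|L0] := ltP L 0.
  by exists 0 => // x /(_ o0) h; have := le_lt_trans h L0; rewrite ltNge normr_ge0.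
have [||c _ cmax] := @EVT_max_rV R 3 (fun x => `|f x|) (cbox L) _ (@compact_cbox L).
- by exists 0 => i; rewrite mxE normr0.
- apply: continuous_subspaceT; exact: cont_norm.
by exists `|f c| => // x Lx; apply: cmax; rewrite inE.
Qed.

Lemma leb3_cbox_fin L : (mu (pre (cbox L)) < +oo)%E.
Proof.
have [L0|L0] := leP 0 L; first by rewrite leb3_cbox// ltry.
suff -> : pre (cbox L) = set0 by rewrite measure0 ltry.
rewrite -subset0 => p /(_ o0) h.
by have := le_lt_trans h L0; rewrite ltNge normr_ge0.
Qed.

(** Vanishing outside a cube is used instead of compactness of [supp], because
    it passes at once to products and derivatives. *)
Definition box_supported f := exists L, forall x, ~ cbox L x -> f x = 0.

Lemma summable_cc D f : mset D -> continuous f -> box_supported f -> summable D f.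
Proof.
move=> mD cf [L fL].
have [C C0 fC] := continuous_cbox_bounded L cf.
have mL : mset (cbox L) := measurable_cbox L.
apply: (@summable_sub setT) => //; first exact: measurableT.
rewrite /summable.
rewrite (_ : (fun p => _) = (fun p => (f (vec3 p))%:E) \_ (pre (cbox L))); last first.
  apply/funext => p; rewrite /patch; case: ifPn => // /negP; rewrite inE => h.
  by congr EFin; exact: fL.
apply/(integrable_mkcond _ mL); apply: measurable_bounded_integrable => //.
- exact: leb3_cbox_fin.
- exact: measurable_cont.
- exists C; split; first exact: num_real.
  by move=> M CM p h; rewrite /= (le_trans (fC _ h))// ltW.
Qed.

Lemma L2_cc D f : mset D -> continuous f -> box_supported f -> L2 D f.
Proof.
move=> mD cf bf; apply: L2_of_sq => //; first exact: measurable_cont.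
apply: summable_cc => //.
  exact: (cont_mul cf cf).
by case: bf => L fL; exists L => x /fL ->; rewrite expr0n.
Qed.

Lemma L2_summable_cbox L D f : mset D -> D `<=` cbox L -> L2 D f -> summable D f.
Proof.
move=> mD DL Lf.
have L1 : L2 D (fun=> 1).
  apply: L2_of_sq => //; first exact: measurable_cst.
  apply: measurable_bounded_integrable => //.
  - apply: (@le_lt_trans _ _ (mu (pre (cbox L)))); last exact: leb3_cbox_fin.
    by apply: le_measure; rewrite ?inE//; [exact: measurable_cbox|move=> p; exact: DL].
  - by exists 1; split=> // M M1 x _ /=; rewrite expr1n normr1 ltW.
have := L2_mul_summable mD Lf L1.
by under eq_fun do rewrite mulr1.
Qed.

End SquareIntegrable.

(** * Integration by parts *)

Section IntegrationByParts.
Context (R : realType).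

Lemma is_derive_line (V : normedModType R) (f : V -> R) (x v : V) (t d : R) :
  is_derive (x + t *: v) v f d -> is_derive t 1 (fun s => f (x + s *: v)) d.
Proof.
move=> [df dE].
have E : (fun h : R => h^-1 *: (f (x + (h *: 1 + t) *: v) - f (x + t *: v))) =
         (fun h : R => h^-1 *: (f (h *: v + (x + t *: v)) - f (x + t *: v))).
  apply/funext => h; congr (_ *: (f _ - _)).
  by rewrite [h *: 1]mulr1 scalerDl addrCA.
by apply: DeriveDef; [rewrite /derivable E|rewrite -dE /derive E].
Qed.

Lemma integral_derive0 (F F' : R -> R) (L : R) : 0 < L ->
  (forall t : R, is_derive t 1 F (F' t)) -> continuous F' ->
  (forall t, L < `|t| -> F t = 0) ->
  (\int[@lebesgue_measure R]_t (F' t)%:E = 0)%E.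
Proof.
move=> L0 dF cF' F0; pose M := L + 1.
have M0 : 0 < M by rewrite /M; lra.
have F'0 t : L < `|t| -> F' t = 0.
  move=> Lt; have [_ <-] := dF t.
  apply: (@derive_near_cst _ _ _ 0); near=> s; apply: F0; near: s.
  have cn : continuous (fun s : R => `|s|) by move=> s; exact: norm_continuous.
  have := open_comp (fun x _ => cn x) (@open_gt R L).
  by move=> oG; apply: open_nbhs_nbhs.
have -> : (\int[@lebesgue_measure R]_t (F' t)%:E =
    \int[@lebesgue_measure R]_(t in `[(- M)%R, M]) (F' t)%:E)%E.
  rewrite [RHS]integral_mkcond; apply: eq_integral => t _.
  rewrite /patch; case: ifPn => // /negP; rewrite inE /= in_itv /= -ler_norml => h.
  by rewrite F'0// ltNge; apply/negP => tL; apply: h; rewrite (le_trans tL)// /M; lra.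
rewrite (@continuous_FTC2 _ _ F); first by rewrite !F0 ?subee ?normrN ?gtr0_norm//; rewrite /M; lra.
- lra.
- exact: continuous_subspaceT.
- have cF : continuous F.
    move=> t; apply/differentiable_continuous/derivable1_diffP.
    by have [] := dF t.
  split => [t _||]; first by have [] := dF t.
    exact/cvg_at_right_filter/cF.
  exact/cvg_at_left_filter/cF.
- by move=> t _; rewrite derive1E; have [] := dF t.
Unshelve. all: by end_near. Qed.

Lemma cbox_compl_nbhs L (x : 'rV[R]_3) : ~ cbox L x -> \near x, ~ cbox L x.
Proof.
move=> /existsNP[i /negP]; rewrite -ltNge => Lx.
have cn : continuous (fun y : 'rV[R]_3 => `|y 0 i|).
  by apply: cont_norm; exact: coord_continuous.
have oG := open_comp (fun y _ => cn y) (@open_gt R L).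
have : nbhs x ((fun y : 'rV[R]_3 => `|y 0 i|) @^-1` [set z | L < z]).
  by apply: open_nbhs_nbhs; split.
by apply: filterS => y /= Ly /(_ i); rewrite leNgt Ly.
Qed.

Lemma box_supported_deriv (f g : 'rV[R]_3 -> R) v :
  (forall x, is_derive x v f (g x)) -> box_supported f -> box_supported g.
Proof.
move=> fg [L fL]; exists L => x Lx; have [_ <-] := fg x.
rewrite (@near_eq_derive _ _ _ f (cst (0 : R)) x v); first by rewrite derive_cst.
by apply: filterS (cbox_compl_nbhs Lx) => y /fL.
Qed.

Let e_ i : 'rV[R]_3 := delta_mx 0 i.

Lemma vec3_line0 (b c t : R) : vec3 (t, b, c) = vec3 (0, b, c) + t *: e_ o0.
Proof. by apply/rowP; elim/ord3P; rewrite !mxE /= ?mulr1 ?mulr0 ?addr0 ?add0r. Qed.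
Lemma vec3_line1 (a c t : R) : vec3 (a, t, c) = vec3 (a, 0, c) + t *: e_ o1.
Proof. by apply/rowP; elim/ord3P; rewrite !mxE /= ?mulr1 ?mulr0 ?addr0 ?add0r. Qed.
Lemma vec3_line2 (a b t : R) : vec3 (a, b, t) = vec3 (a, b, 0) + t *: e_ o2.
Proof. by apply/rowP; elim/ord3P; rewrite !mxE /= ?mulr1 ?mulr0 ?addr0 ?add0r. Qed.

Lemma cont_line (g : 'rV[R]_3 -> R) (x v : 'rV[R]_3) : continuous g ->
  continuous (fun t : R => g (x + t *: v)).
Proof.
move=> cg; apply: cont_comp => // t.
apply: cvgD; first exact: cvg_cst.
by apply: cvgZr_tmp; exact: cvg_id.
Qed.

(** By Fubini, integrate first along the lines in direction [i]; each of these
    integrals is 0 by the fundamental theorem of calculus. *)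
Lemma Int3_derive0 (i : 'I_3) (f g : 'rV[R]_3 -> R) :
  (forall x, is_derive x (e_ i) f (g x)) -> continuous g -> box_supported f ->
  Int3 setT g = 0.
Proof.
move=> dfg cg bf; have bg := box_supported_deriv dfg bf.
have Sg : summable setT g by apply: summable_cc => //; exact: measurableT.
have line (x : 'rV[R]_3) : x 0 i = 0 ->
    (\int[@lebesgue_measure R]_t (g (x + (t : R) *: e_ i)%R)%:E = 0)%E.
  move=> xi0; have [L fL] := bf.
  apply: (@integral_derive0 (fun t => f (x + t *: e_ i)) _ (`|L| + 1)).
  - by rewrite ltr_wpDl.
  - by move=> t; apply: is_derive_line; exact: dfg.
  - exact: cont_line.
  - move=> t Lt; apply: fL => /(_ i).
    rewrite !mxE xi0 !eqxx mulr1 add0r leNgt (le_lt_trans (ler_norm L))//.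
    by rewrite (lt_trans _ Lt)// ltrDl.
rewrite /Int3 /Rintegral preimage_setT.
suff -> : (\int[@leb3 R]_p (g (vec3 p))%:E = 0)%E by [].
have Fub : (@leb2 R \x @lebesgue_measure R)%E.-integrable setT
    (fun p : T3 R => (g (vec3 p))%:E) by exact: Sg.
have slices : i = o2 \/ i != o2 by case: eqVneq; [left|right].
case: slices => [i2|i2].
  rewrite -[LHS](integral12_prod_meas1 Fub); apply: integral0_eq => -[a b] _.
  rewrite /fubini_F -[RHS](line (vec3 (a, b, 0))); last by rewrite i2 mxE.
  by apply: eq_integral => t _; rewrite vec3_line2 i2.
rewrite -[LHS](integral21_prod_meas1 Fub).
rewrite (ae_eq_integral (cst 0%E)) ?integral0//.
  exact: (measurable_fubini_G Fub).
apply: filterS (ae_integrable2 Fub) => c Ic _ /=; rewrite /fubini_G.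
have Fub2 : (@lebesgue_measure R \x @lebesgue_measure R)%E.-integrable setT
    (fun p : measurableTypeR R * measurableTypeR R => (g (vec3 (p, c)))%:E) by exact: Ic.
have [i0|i0] := eqVneq i o0.
  rewrite -[LHS](integral21_prod_meas1 Fub2); apply: integral0_eq => b _.
  rewrite /fubini_G -[RHS](line (vec3 (0, b, c))); last by rewrite i0 mxE.
  by apply: eq_integral => t _; rewrite vec3_line0 i0.
have i1 : i = o1 by move: i0 i2; elim/ord3P: i {dfg line}.
rewrite -[LHS](integral12_prod_meas1 Fub2); apply: integral0_eq => a _.
rewrite /fubini_F -[RHS](line (vec3 (a, 0, c))); last by rewrite i1 mxE.
by apply: eq_integral => t _; rewrite vec3_line1 i1.
Qed.

(** The derivative of f g has integral 0. *)
Lemma Int3_by_parts (i : 'I_3) (f g f' g' : 'rV[R]_3 -> R) :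
  (forall x, is_derive x (e_ i) f (f' x)) -> (forall x, is_derive x (e_ i) g (g' x)) ->
  continuous f -> continuous g -> continuous f' -> continuous g' ->
  box_supported g ->
  Int3 setT (fun x => f x * g' x) = - Int3 setT (fun x => f' x * g x).
Proof.
move=> df dg cf cg cf' cg' bg.
have bM (h k : 'rV[R]_3 -> R) : box_supported k -> box_supported (fun x => h x * k x).
  by case=> L kL; exists L => x /kL ->; rewrite mulr0.
have bg' := box_supported_deriv dg bg.
have mT : mset [set: 'rV[R]_3] by exact: measurableT.
have S1 : summable setT (fun x => f x * g' x).
  by apply: summable_cc => //; [exact: cont_mul|exact: bM].
have S2 : summable setT (fun x => f' x * g x).
  by apply: summable_cc => //; [exact: cont_mul|exact: bM].
apply/eqP; rewrite -subr_eq0 opprK -Int3D//; apply/eqP.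
apply: (@Int3_derive0 i (fun x => f x * g x)).
- move=> x; rewrite [X in is_derive _ _ _ (_ + X)]mulrC.
  exact: is_derive_mul.
- by apply: cont_add; exact: cont_mul.
- exact: bM.
Qed.

End IntegrationByParts.

(** * The fundamental lemma of the calculus of variations *)

Section Dynkin.
Local Open Scope ereal_scope.
Context (R : realType) d d' (T : measurableType d) (U : measurableType d').
Context (mu : {measure set T -> \bar R}).

(** The sets A for which the integral of g over E and proj^-1(A) vanishes form a
    Dynkin system, so it is enough to know a generating family stable under
    intersection. *)
Lemma integral_preimage_eq0 (G : set (set U)) (proj : T -> U) (E : set T)
    (g : T -> \bar R) :
  @measurable _ U = <<s G >> -> setI_closed G -> measurable_fun setT proj ->
  measurable E -> mu.-integrable E g ->
  \int[mu]_(x in E) g x = 0 ->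
  (forall A, G A -> \int[mu]_(x in E `&` proj @^-1` A) g x = 0) ->
  forall A, measurable A -> \int[mu]_(x in E `&` proj @^-1` A) g x = 0.
Proof.
move=> GE GI mproj mE ig E0 G0 A mA.
have mpre S : measurable S -> measurable (E `&` proj @^-1` S).
  by move=> mS; apply: measurableI => //; rewrite -[X in measurable X]setTI; exact: mproj.
have igS S : measurable S -> mu.-integrable (E `&` proj @^-1` S) g.
  by move=> mS; apply: integrableS ig; [exact: mE|exact: mpre|exact: subIsetl].
apply: (dynkin_induction (P := fun S => \int[mu]_(x in E `&` proj @^-1` S) g x = 0) GE GI).
- by rewrite preimage_setT setIT.
- exact: G0.
- move=> S mS S0; have := E0.
  rewrite -[X in \int[mu]_(x in X) _](setIT E) -(setvU (proj @^-1` S)) setIUr.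
  rewrite integral_setU; [|exact: (mpre _ (measurableC mS))|exact: mpre| |].
  + by rewrite S0 adde0.
  + rewrite -setIUr setvU setIT; exact: measurable_int ig.
  + by apply/disj_setPS => x [[_ /= nS] [_ /= Sx]].
- move=> F mF tF F0; rewrite preimage_bigcup setI_bigcupr integral_bigcup.
  + by apply: eseries0 => n _ _; exact: F0.
  + apply/trivIsetP => i j _ _ ij; apply/seteqP; split => // x [[_ Fi] [_ Fj]].
    move/trivIsetP : tF => /(_ i j Logic.I Logic.I ij).
    by move/seteqP => [/(_ (proj x)) + _]; apply.
  + by move=> k; exact: mpre.
  + rewrite -setI_bigcupr -preimage_bigcup; apply: igS.
    exact: bigcupT_measurable.
- by rewrite -GE.
Qed.

End Dynkin.

Section TestFunctions.
Context (R : realType).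
Implicit Types (Omega C : set 'rV[R]_3) (a b x : 'rV[R]_3) (n : nat).

Lemma test_functionP Omega C L (f : 'rV[R]_3 -> R) :
  (forall k, Ck k f) -> closed C -> C `<=` Omega -> C `<=` cbox L ->
  (forall x, f x != 0 -> C x) -> test_function Omega f.
Proof.
move=> Cf cC CO CL fC k; have sC : supp f `<=` C.
  by rewrite [X in _ `<=` X](closure_id C).1//; apply: closureS => x; exact: fC.
split=> //.
  apply: (@subclosed_compact _ _ (cbox L)); first exact: closed_closure.
    exact: compact_cbox.
  by move=> x /sC /CL.
by move=> x /sC /CO.
Qed.

Lemma test_cont Omega (f : 'rV[R]_3 -> R) : test_function Omega f -> continuous f.
Proof. by move=> /(_ 0%N)[[]]. Qed.

Lemma compact_box_supported (f : 'rV[R]_3 -> R) : compact (supp f) -> box_supported f.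
Proof.
move=> /compact_bounded[L [_ sL]]; exists (L + 1) => x xL.
apply/eqP/negP => fx; apply: xL => i.
have L1 : L < L + 1 by rewrite ltrDl.
have : `|x| <= L + 1 by apply: (sL _ L1); apply: subset_closure; exact/negP.
apply: le_trans; rewrite /Num.norm /= mx_normrE.
exact: (le_bigmax _ (fun j : 'I_1 * 'I_3 => `|x j.1 j.2|) (0, i)).
Qed.

(** The margin 1/(n+1) keeps the support of the bump inside the open interval,
    and the bump is 1 from distance 2/(n+1) on. *)
Definition itv_bump n (s t z : R) : R :=
  step (n.+1%:R * (z - s) - 1) * step (n.+1%:R * (t - z) - 1).

Definition box_bump n a b x : R := \prod_i itv_bump n (a 0 i) (b 0 i) (x 0 i).

Lemma C1d_itv_bump k n s t : C1d k (itv_bump n s t).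
Proof.
apply: CdM; apply: (Cd_comp (C1d_step _ _)); apply: CdB; try exact: Cd_cst.
- apply: CdM; first exact: Cd_cst.
  by apply: CdB; [exact: C1d_id|exact: Cd_cst].
- apply: CdM; first exact: Cd_cst.
  by apply: CdB; [exact: Cd_cst|exact: C1d_id].
Qed.

Lemma Ck_coord k (i : 'I_3) : Ck k (fun x : 'rV[R]_3 => x 0 i).
Proof.
have cc : continuous (fun x : 'rV[R]_3 => x 0 i) by exact: coord_continuous.
rewrite CkE; case: k => [|k]; first by split.
apply: Cd_intro => // j; exists (fun=> (i == j)%:R); last exact: Cd_cst.
move=> x; have E : (fun h : R => h^-1 *: ((h *: delta_mx 0 j + x) 0 i - x 0 i)) =
    (fun h : R => h^-1 * (h * (i == j)%:R)).
  by apply/funext => h; rewrite !mxE eqxx /= addrK.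
have c : h^-1 * (h * (i == j)%:R) @[h --> (0 : R)^'] --> ((i == j)%:R : R).
  apply: cvg_near_cst; near=> h; rewrite mulKf//.
  by near: h; exact: nbhs_dnbhs_neq.
apply: DeriveDef; rewrite /derivable /derive E; last exact: cvg_lim.
by apply/cvg_ex; exists (i == j)%:R.
Unshelve. all: by end_near. Qed.

Lemma Ck_box_bump k n a b : Ck k (box_bump n a b).
Proof.
rewrite CkE; apply: Cd_prod => i; apply: (Cd_comp (C1d_itv_bump _ _ _ _)).
by rewrite -CkE; exact: Ck_coord.
Qed.

Lemma itv_bump_ge0 n s t z : 0 <= itv_bump n s t z.
Proof. by rewrite mulr_ge0 ?step_ge0. Qed.

Lemma itv_bump_le1 n s t z : itv_bump n s t z <= 1.
Proof. by rewrite -[leRHS]mulr1 ler_pM ?step_ge0 ?step_le1. Qed.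

Lemma box_bump_ge0 n a b x : 0 <= box_bump n a b x.
Proof. by apply: prodr_ge0 => i _; exact: itv_bump_ge0. Qed.

Lemma box_bump_le1 n a b x : box_bump n a b x <= 1.
Proof.
by apply: prodr_ile1 => i _; rewrite itv_bump_ge0 itv_bump_le1.
Qed.

Lemma itv_bump_neq0 n s t z : itv_bump n s t z != 0 ->
  s + n.+1%:R^-1 <= z <= t - n.+1%:R^-1.
Proof.
rewrite mulf_eq0 negb_or => /andP[h1 h2].
have n0 : 0 < n.+1%:R :> R by [].
apply/andP; split.
- rewrite leNgt; apply/negP => h; move/negP: h1; apply; rewrite step_le0//.
  by rewrite subr_le0 mulrC -ler_pdivlMr// mul1r lerBlDl ltW.
- rewrite leNgt; apply/negP => h; move/negP: h2; apply; rewrite step_le0//.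
  by rewrite subr_le0 mulrC -ler_pdivlMr// mul1r lerBlDl -lerBlDr ltW.
Qed.

Lemma box_bump_test Omega n a b : obox a b `<=` Omega ->
  test_function Omega (box_bump n a b).
Proof.
move=> abO; have := @itv_bump_neq0 n; set e : R := n.+1%:R^-1 => bump_neq0.
have e0 : 0 < e by rewrite invr_gt0.
pose C := [set x : 'rV[R]_3 | forall i, a 0 i + e <= x 0 i <= b 0 i - e].
have Cab : C `<=` obox a b.
  by move=> x Cx i; have /andP[h1 h2] := Cx i; apply/andP; split; lra.
apply: (@test_functionP _ C (\sum_i (`|a 0 i| + `|b 0 i|))).
- by move=> k; exact: Ck_box_bump.
- rewrite (_ : C = \bigcap_(i in [set: 'I_3]) ((fun x : 'rV[R]_3 => x 0 i) @^-1`
      `[a 0 i + e, b 0 i - e])); last first.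
    by apply/seteqP; split => [x h i _|x h i]; [rewrite /= in_itv; exact: h|have := h i Logic.I; rewrite /= in_itv].
  apply: closed_bigI => i _; apply: preimage_closed; last exact: interval_closed.
  by move=> x _; exact: coord_continuous.
- by move=> x /Cab /abO.
- by move=> x /Cab; exact: obox_cbox.
- move=> x; rewrite /box_bump => h i; apply: bump_neq0.
  by apply: contra h => /eqP h; rewrite (bigD1 i)//= h mul0r.
Qed.

Lemma box_bump_cvg a b x : obox a b x -> box_bump n a b x @[n --> \oo] --> (1 : R).
Proof.
move=> abx; apply: cvg_near_cst.
suff : \forall n \near \oo, forall i, itv_bump n (a 0 i) (b 0 i) (x 0 i) = 1.
  by apply: filterS => n h; rewrite /box_bump big1.
apply: filter_forall => i.
have /andP[h1 h2] := abx i.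
pose e := Num.min (x 0 i - a 0 i) (b 0 i - x 0 i).
have e0 : 0 < e by rewrite lt_min; apply/andP; split; lra.
near=> n; have ne : 2 <= n.+1%:R * e.
  rewrite -ler_pdivrMr//; apply: (@le_trans _ _ n%:R); last by rewrite ler_nat.
  by near: n; exact: nbhs_infty_ger.
have n0 : 0 <= n.+1%:R :> R by [].
have [e1 e2] : e <= x 0 i - a 0 i /\ e <= b 0 i - x 0 i by rewrite !ge_min !lexx ?orbT.
have k1 := ler_wpM2l n0 e1; have k2 := ler_wpM2l n0 e2.
by rewrite /itv_bump !step_ge1 ?mulr1//; lra.
Unshelve. all: by end_near. Qed.

End TestFunctions.

Section FundamentalLemma.
Context (R : realType).
Implicit Types (Omega : set 'rV[R]_3) (a b : 'rV[R]_3) (g : 'rV[R]_3 -> R).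
Local Notation mu := (@leb3 R).
Local Notation "'pre' D" := (@vec3 R @^-1` D) (at level 10, D at level 9).

Definition weakly_null Omega g :=
  forall phi, test_function Omega phi -> Int3 Omega (fun x => g x * phi x) = 0.

Lemma summable_integral D g : mset D -> summable D g ->
  (\int[mu]_(p in pre D) (g (vec3 p))%:E = (Int3 D g)%:E)%E.
Proof. by move=> mD Sg; rewrite /Int3 /Rintegral fineK//; exact: integrable_fin_num. Qed.

Lemma test_eq0 Omega phi x : test_function Omega phi -> ~ Omega x -> phi x = 0.
Proof.
move=> /(_ 0%N)[_ _ sO] Ox; apply/eqP/negP => /negP h; apply: Ox; apply: sO.
exact: subset_closure.
Qed.

Lemma test_subset D Omega phi : D `<=` Omega -> test_function D phi ->
  test_function Omega phi.
Proof. by move=> DO t k; have [h1 h2 h3] := t k; split=> // x /h3 /DO. Qed.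

(** The bumps of the box converge boundedly to its indicator function. *)
Lemma weakly_null_obox Omega a b g : open Omega -> L2 Omega g ->
  weakly_null Omega g -> obox a b `<=` Omega -> Int3 (obox a b) g = 0.
Proof.
move=> oO Lg g0 abO.
have mO : mset Omega by exact: measurable_open.
have mab : mset (obox a b) by exact: measurable_obox.
have Lab := L2_sub mO mab abO Lg.
have Sab := L2_summable_cbox mab (@obox_cbox R a b) Lab.
have bt n := @box_bump_test R (obox a b) n a b (fun _ => id).
have cb n := test_cont (bt n).
have bb n : box_supported (box_bump n a b).
  by apply: compact_box_supported; have [] := bt n 0%N.
have Sn n : summable (obox a b) (fun x => g x * box_bump n a b x).
  by apply: L2_mul_summable => //; exact: L2_cc.
have In n : Int3 (obox a b) (fun x => g x * box_bump n a b x) = 0.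
  rewrite -[RHS](g0 _ (test_subset abO (bt n))); apply: Int3_vanish => // x _ h.
  by rewrite (test_eq0 (bt n))// mulr0.
have [|||||_ _] := @dominated_convergence _ _ R mu (pre (obox a b)) mab
  (fun n p => (g (vec3 p) * box_bump n a b (vec3 p))%:E)
  (fun p => (g (vec3 p))%:E) (fun p => `|(g (vec3 p))%:E|%E).
- by move=> n; apply/measurable_EFinP; exact: (summable_meas (Sn n)).
- by apply/measurable_EFinP; exact: (summable_meas Sab).
- apply: aeW => p abp; apply: cvg_EFin; first exact: nearW.
  rewrite /comp /= -[X in _ --> X]mulr1; apply: cvgM; first exact: cvg_cst.
  exact: box_bump_cvg.
- exact: integrable_abse.
- apply: aeW => p n abp; rewrite /= lee_fin normrM ler_piMr//.
  by rewrite ger0_norm ?box_bump_ge0// box_bump_le1.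
rewrite (_ : (fun n => _) = cst 0%E); last first.
  by apply/funext => n; rewrite (summable_integral mab (Sn n)) In.
move=> cv; have E := cvg_unique (@ereal_hausdorff R) cv (cvg_cst 0%E).
by rewrite /Int3 /Rintegral E.
Qed.

Lemma pre_obox a b : pre (obox a b) =
  [set p : T3 R | [/\ `]a 0 o0, b 0 o0[%classic p.1.1, `]a 0 o1, b 0 o1[%classic p.1.2
    & `]a 0 o2, b 0 o2[%classic p.2]].
Proof. by rewrite vec3_obox; apply/seteqP; split => p; [move=> [[? ?] ?]|move=> [? ? ?]]. Qed.

(** Vanishing of the integrals over boxes extends to all measurable subsets by
    Dynkin systems: first the intervals of each coordinate are replaced by Borel
    sets, then the rectangles of each product by its measurable sets, since the
    product structure is generated by rectangles of Borel sets. *)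
Lemma weakly_null_measurable Omega a b g (S : set (T3 R)) : open Omega -> L2 Omega g ->
  weakly_null Omega g -> obox a b `<=` Omega -> measurable S ->
  (\int[mu]_(p in pre (obox a b) `&` S) (g (vec3 p))%:E = 0)%E.
Proof.
move=> oO Lg g0 abO mS; set h := fun p => _.
have mO : mset Omega by exact: measurable_open.
pose D : set (T3 R) := pre (obox a b).
have mD : measurable D by exact: measurable_obox.
have Sab : mu.-integrable D h.
  have Lab := L2_sub mO (measurable_obox _ _) abO Lg.
  exact: (L2_summable_cbox (measurable_obox _ _) (@obox_cbox R a b) Lab).
have iS X : measurable X -> X `<=` D -> mu.-integrable X h.
  by move=> mX XD; apply: integrableS Sab.
have itvI : setI_closed (@RGenOpens.G R).
  move=> _ _ [x [y ->]] [z [t ->]]; exists (Num.max x z), (Num.min y t).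
  apply/seteqP; split => w /=; rewrite !in_itv /= gt_max lt_min.
    by move=> [/andP[-> ->] /andP[-> ->]].
  by move=> /andP[/andP[-> ->] /andP[-> ->]].
have base I0 I1 I2 : @RGenOpens.G R I0 -> @RGenOpens.G R I1 -> @RGenOpens.G R I2 ->
    (\int[mu]_(p in D `&` [set p | I2 p.2] `&` [set p | I1 p.1.2] `&` [set p | I0 p.1.1]) h p = 0)%E.
  move=> [s0 [t0 E0]] [s1 [t1 E1]] [s2 [t2 E2]].
  pose a' := vec3 (Num.max (a 0 o0) s0, Num.max (a 0 o1) s1, Num.max (a 0 o2) s2).
  pose b' := vec3 (Num.min (b 0 o0) t0, Num.min (b 0 o1) t1, Num.min (b 0 o2) t2).
  have -> : D `&` [set p | I2 p.2] `&` [set p | I1 p.1.2] `&` [set p | I0 p.1.1] = pre (obox a' b').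
    rewrite /D !pre_obox /a' /b' !vec3E E0 E1 E2; apply/seteqP; split => p /=;
      rewrite !in_itv /= !gt_max !lt_min.
      by move=> [[[[/andP[-> ->] /andP[-> ->] /andP[-> ->]] /andP[-> ->]] /andP[-> ->]] /andP[-> ->]].
    by move=> [/andP[/andP[-> ->] /andP[-> ->]] /andP[/andP[-> ->] /andP[-> ->]] /andP[/andP[-> ->] /andP[-> ->]]].
  have ab' : obox a' b' `<=` Omega.
    move=> x xab; apply: abO => i; have := xab i; elim/ord3P: i; rewrite /a' /b' !vec3E /=;
      by rewrite gt_max lt_min => /andP[/andP[-> _] /andP[-> _]].
  have mab' : mset (obox a' b') := measurable_obox _ _.
  have Sab' := L2_summable_cbox mab' (@obox_cbox R a' b') (L2_sub mO mab' ab' Lg).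
  by rewrite (summable_integral mab' Sab') (weakly_null_obox oO Lg g0 ab').
have genR : @measurable _ (measurableTypeR R) = <<s @RGenOpens.G R >>.
  exact: RGenOpens.measurableE.
have GD I : @RGenOpens.G R I -> @measurable _ (measurableTypeR R) I.
  by move=> GI; rewrite genR; exact: sub_sigma_algebra.
have mp0 : measurable_fun setT (fun p : T3 R => p.1.1) by exact: measurableT_comp.
have mp1 : measurable_fun setT (fun p : T3 R => p.1.2) by exact: measurableT_comp.
have mp2 : measurable_fun setT (fun p : T3 R => p.2) by exact: measurable_snd.
have mpf : measurable_fun setT (fun p : T3 R => p.1) by exact: measurable_fst.
have mC (proj : T3 R -> measurableTypeR R) I : measurable_fun setT proj -> measurable I ->
    measurable [set p | I (proj p)].
  by move=> mproj mI; rewrite -[X in measurable X]setTI; exact: mproj.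
pose Ia : set R := `]a 0 o0, b 0 o0[%classic.
pose Ib : set R := `]a 0 o1, b 0 o1[%classic.
pose Ic : set R := `]a 0 o2, b 0 o2[%classic.
have [GIa GIb GIc] : [/\ @RGenOpens.G R Ia, @RGenOpens.G R Ib & @RGenOpens.G R Ic].
  by split; eexists; eexists.
have DIa : D `<=` [set p | Ia p.1.1] by rewrite /D pre_obox => p [].
have DIb : D `<=` [set p | Ib p.1.2] by rewrite /D pre_obox => p [].
have DIc : D `<=` [set p | Ic p.2] by rewrite /D pre_obox => p [].
(* From here on one interval at a time becomes a Borel set; the order of the
   factors in the intersections puts the coordinate under treatment last. *)
have st0 I1 I2 A0 : @RGenOpens.G R I1 -> @RGenOpens.G R I2 -> measurable A0 ->
    (\int[mu]_(p in D `&` [set p | I2 p.2] `&` [set p | I1 p.1.2] `&` [set p | A0 p.1.1]) h p = 0)%E.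
  move=> G1 G2 mA; have mE : measurable (D `&` [set p | I2 p.2] `&` [set p | I1 p.1.2]).
    by do 2?apply: measurableI => //; [exact: mC (GD _ G2)|exact: mC (GD _ G1)].
  apply: (integral_preimage_eq0 genR itvI mp0 mE) => //.
  - by apply: iS => // p [[]].
  - have := base _ _ _ GIa G1 G2; congr (integral _ _ _ = _).
    by apply: setIidl => p [[/DIa]].
  - by move=> A GA; exact: base.
have st1 I2 A0 A1 : @RGenOpens.G R I2 -> measurable A0 -> measurable A1 ->
    (\int[mu]_(p in D `&` [set p | I2 p.2] `&` [set p | A0 p.1.1] `&` [set p | A1 p.1.2]) h p = 0)%E.
  move=> G2 mA0 mA1; have mE : measurable (D `&` [set p | I2 p.2] `&` [set p | A0 p.1.1]).
    by do 2?apply: measurableI => //; [exact: mC (GD _ G2)|exact: mC].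
  apply: (integral_preimage_eq0 genR itvI mp1 mE) => //.
  - by apply: iS => // p [[]].
  - have := st0 _ _ _ GIb G2 mA0; congr (integral _ _ _ = _).
    by rewrite setIAC; apply: setIidl => p [[/DIb pb _] _]; exact: pb.
  - move=> A GA; have := st0 _ _ _ GA G2 mA0; congr (integral _ _ _ = _).
    by rewrite setIAC.
have st2 A0 A1 A2 : measurable A0 -> measurable A1 -> measurable A2 ->
    (\int[mu]_(p in D `&` [set p | A0 p.1.1] `&` [set p | A1 p.1.2] `&` [set p | A2 p.2]) h p = 0)%E.
  move=> mA0 mA1 mA2; have mE : measurable (D `&` [set p | A0 p.1.1] `&` [set p | A1 p.1.2]).
    by do 2?apply: measurableI => //; exact: mC.
  apply: (integral_preimage_eq0 genR itvI mp2 mE) => //.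
  - by apply: iS => // p [[]].
  - have := st1 _ _ _ GIc mA0 mA1; congr (integral _ _ _ = _).
    by rewrite [X in X `&` _]setIAC setIAC; apply: setIidl => p [[/DIc pc _] _]; exact: pc.
  - move=> A GA; have := st1 _ _ _ GA mA0 mA1; congr (integral _ _ _ = _).
    by rewrite [X in X `&` _]setIAC setIAC.
have rectI (T U : Type) (mT : set (set T)) (mU : set (set U)) : setI_closed mT -> setI_closed mU ->
    setI_closed [set A `*` B | A in mT & B in mU].
  move=> hT hU _ _ [A1 h1 [B1 h2 <-]] [A2 h3 [B2 h4 <-]].
  by exists (A1 `&` A2); [exact: hT|exists (B1 `&` B2); [exact: hU|rewrite setXI]].
have measI d (T : measurableType d) : setI_closed (@measurable _ T).
  by move=> A B; exact: measurableI.
have full A2 : measurable A2 -> (\int[mu]_(p in D `&` [set p | A2 p.2]) h p = 0)%E.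
  move=> mA2; have := st2 _ _ _ (GD _ GIa) (GD _ GIb) mA2; congr (integral _ _ _ = _).
  by congr (_ `&` _); rewrite -setIA; apply: setIidl => p Dp; split; [exact: DIa|exact: DIb].
have st3 (A2 : set (measurableTypeR R)) (B : set (measurableTypeR R * measurableTypeR R)%type) :
    measurable A2 -> measurable B ->
    (\int[mu]_(p in D `&` [set p | A2 p.2] `&` [set p | B p.1]) h p = 0)%E.
  move=> mA2 mB; have mE : measurable (D `&` [set p | A2 p.2]).
    by apply: measurableI => //; exact: mC.
  apply: (integral_preimage_eq0 (@measurable_prod_measurableType _ _ _ _) _ mpf mE) => //.
  - by apply: rectI; exact: measI.
  - by apply: iS => // p [].
  - exact: full.
  - move=> _ [A0 mA0 [A1 mA1 <-]]; rewrite setIAC.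
    have := st2 _ _ _ mA0 mA1 mA2; congr (integral _ _ _ = _).
    by congr (_ `&` _); rewrite -setIA; congr (_ `&` _).
have mid : measurable_fun [set: T3 R] id by exact: measurable_id.
apply: (integral_preimage_eq0 (@measurable_prod_measurableType _ _ _ _) _ mid mD) => //.
- by apply: rectI; exact: measI.
- have := full _ (GD _ GIc); congr (integral _ _ _ = _); apply: setIidl; exact: DIc.
- move=> _ [B mB [A2 mA2 <-]]; have := st3 _ _ mA2 mB; congr (integral _ _ _ = _).
  by rewrite -setIA; congr (_ `&` _); rewrite setIC.
Qed.

(** The fundamental lemma of the calculus of variations. On each rational cube
    inside Omega all integrals of g over measurable subsets vanish, hence g = 0
    almost everywhere there, and countably many such cubes cover Omega. *)
Lemma weakly_null_ae Omega g : open Omega -> L2 Omega g -> weakly_null Omega g ->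
  ae3 Omega (fun x => g x = 0).
Proof.
move=> oO Lg g0; have mO : mset Omega by exact: measurable_open.
have box (k : 'rV[rat]_3 * nat) : @rcube R k `<=` Omega -> ae3 (@rcube R k) (fun x => g x = 0).
  move=> kO; have mk : mset (@rcube R k) := measurable_obox _ _.
  have Sk := L2_summable_cbox mk (@obox_cbox R _ _) (L2_sub mO mk kO Lg).
  have : ae_eq mu (pre (@rcube R k)) (fun p => (g (vec3 p))%:E) (cst 0%E).
    apply: (integral_ae_eq mk Sk); first exact: measurable_cst.
    move=> E Ek mE; rewrite integral0 -[X in integral _ X _](setIidr Ek).
    exact: (weakly_null_measurable oO Lg g0 kO mE).
  apply: (@filterS _ _ (@ae_filter_ringOfSetsType _ _ _ _)) => p h kp.
  by have [] := h kp.
have : forall n, {ae mu, forall p, match @unpickle ('rV[rat]_3 * nat)%type n with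
    | Some k => @rcube R k `<=` Omega -> @rcube R k (vec3 p) -> g (vec3 p) = 0
    | None => True end}.
  move=> n; case: unpickle => [k|]; last exact: aeW.
  have [kO|nkO] := pselect (@rcube R k `<=` Omega); last by apply: aeW => p.
  apply: (@filterS _ _ (@ae_filter_ringOfSetsType _ _ _ _) _ _ _ (box k kO)) => p h _.
  exact: h.
move=> /ae_foralln; apply: (@filterS _ _ (@ae_filter_ringOfSetsType _ _ _ _)) => p h Op.
have : (\bigcup_(k in [set k | @rcube R k `<=` Omega]) @rcube R k) (vec3 p).
  by rewrite -(open_rcubes oO).
by move=> [k kO kp]; have := h (pickle k); rewrite pickleK; apply.
Qed.

End FundamentalLemma.

(** * Weak derivatives *)

Section WeakDerivatives.
Context (R : realType).
Implicit Types (Omega : set 'rV[R]_3) (f g h phi : 'rV[R]_3 -> R) (i : 'I_3).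

Lemma mset_open Omega : open Omega -> mset Omega.
Proof. exact: measurable_open. Qed.

Lemma pdE f i g : (forall x, is_derive x (delta_mx 0 i) f (g x)) -> pd i f = g.
Proof. by move=> fg; apply/funext => x; have [_] := fg x. Qed.

Lemma Ck_is_derive f i k : Ck k.+1 f ->
  forall x, is_derive x (delta_mx 0 i) f (pd i f x).
Proof. by rewrite CkE => Cf x; exact: (Cd_is_derive i Cf). Qed.

Lemma Ck_pd f i k : Ck k.+1 f -> Ck k (pd i f).
Proof. by move=> [_ /(_ i)[]]. Qed.

Lemma Ck_cont f k : Ck k f -> continuous f.
Proof. by case: k => [|k] []. Qed.

Lemma test_Ck Omega phi k : test_function Omega phi -> Ck k phi.
Proof. by move=> /(_ k)[]. Qed.

Lemma test_box Omega phi : test_function Omega phi -> box_supported phi.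
Proof. by move=> /(_ 0%N)[_ cs _]; exact: compact_box_supported. Qed.

Lemma test_L2 Omega D phi : mset D -> test_function Omega phi -> L2 D phi.
Proof. by move=> mD tp; apply: L2_cc => //; [exact: test_cont tp|exact: test_box tp]. Qed.

Lemma pd_box f i : Ck 1 f -> box_supported f -> box_supported (pd i f).
Proof. by move=> /(@Ck_is_derive _ i) d; exact: box_supported_deriv. Qed.

Lemma pd_L2 D f i : mset D -> Ck 1 f -> box_supported f -> L2 D (pd i f).
Proof.
move=> mD Cf bf; apply: L2_cc => //; last exact: pd_box.
exact: Ck_cont (Ck_pd i Cf).
Qed.

Lemma test_pd_L2 Omega D phi i : mset D -> test_function Omega phi -> L2 D (pd i phi).
Proof. by move=> mD tp; apply: pd_L2 => //; [exact: test_Ck tp|exact: test_box tp]. Qed.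

Lemma test_setT phi : (forall k, Ck k phi) -> box_supported phi ->
  test_function setT phi.
Proof.
move=> Cp [L pL]; apply: (@test_functionP _ _ (cbox L) L) => //.
  exact: closed_cbox.
by move=> x px; apply: contrapT => /pL p0; move: px; rewrite p0 eqxx.
Qed.

Lemma wderivP Omega i f : (exists g, is_wderiv Omega i f g) ->
  is_wderiv Omega i f (wderiv Omega i f).
Proof. exact: xgetPex. Qed.

Lemma is_wderiv_unique Omega i f g h : open Omega ->
  is_wderiv Omega i f g -> is_wderiv Omega i f h -> ae3 Omega (fun x => g x = h x).
Proof.
move=> oO [Lg fg] [Lh fh]; have mO := mset_open oO.
apply: (@ae3_mono _ _ (fun x => g x - h x = 0)); last first.
  by move=> x _ /eqP; rewrite subr_eq0 => /eqP.
apply: weakly_null_ae => //; first exact: L2B.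
move=> phi tp; have Lp := test_L2 mO tp.
rewrite (_ : (fun _ => _) = (fun x => g x * phi x - h x * phi x)); last first.
  by apply/funext => x; rewrite mulrBl.
rewrite Int3B//; [|exact: L2_mul_summable|exact: L2_mul_summable].
by have /oppr_inj -> := etrans (esym (fg _ tp)) (fh _ tp); rewrite subrr.
Qed.

Lemma wderiv_ae Omega i f g : open Omega -> is_wderiv Omega i f g ->
  ae3 Omega (fun x => wderiv Omega i f x = g x).
Proof.
by move=> oO fg; apply: (is_wderiv_unique oO _ fg); apply: wderivP; exists g.
Qed.

Lemma is_wderiv_pd f i : Ck 1 f -> box_supported f ->
  is_wderiv setT i f (pd i f).
Proof.
move=> Cf bf; have mT := mset_open (@openT 'rV[R]_3).
split; first exact: pd_L2.
move=> phi tp; have Cp := test_Ck 1 tp.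
apply: (@Int3_by_parts R i).
- exact: (Ck_is_derive i Cf).
- exact: (Ck_is_derive i Cp).
- exact: Ck_cont Cf.
- exact: Ck_cont Cp.
- exact: Ck_cont (Ck_pd i Cf).
- exact: Ck_cont (Ck_pd i Cp).
- exact: test_box tp.
Qed.

Lemma Hk1_setT f : Ck 1 f -> box_supported f -> Hk 1 setT f.
Proof.
move=> Cf bf; have mT := mset_open (@openT 'rV[R]_3); split.
  by apply: L2_cc => //; exact: Ck_cont Cf.
move=> i; have fi := is_wderiv_pd i Cf bf; split; first by exists (pd i f).
by split=> //; have [] := wderivP (ex_intro _ _ fi).
Qed.

(** The function 0 is a weak derivative of f, and weak derivatives are unique
    up to null sets. *)
Lemma wderiv_ae0 Omega i f : open Omega -> L2 Omega f ->
  ae3 Omega (fun x => f x = 0) -> ae3 Omega (fun x => wderiv Omega i f x = 0).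
Proof.
move=> oO Lf f0; have mO := mset_open oO.
apply: wderiv_ae => //; split; first exact: L20.
move=> phi tp; have Lp := test_pd_L2 i mO tp.
rewrite (_ : (fun x => 0 * phi x) = fun=> 0); last by apply/funext => x; rewrite mul0r.
rewrite Int30 oppr0 -(Int30 Omega); apply: ae3_eq_Int3 => //.
- exact: summable_meas (L2_mul_summable mO Lf Lp).
- exact: summable_meas (summable0 mO).
- by apply: (ae3_mono f0) => x _ ->; rewrite mul0r.
Qed.

Lemma Hk_L2 Omega k f : Hk k Omega f -> L2 Omega f.
Proof. by case: k => [|k] []. Qed.

(** The weak derivatives of phi that occur in the equation agree only almost
    everywhere with the classical ones. *)
Lemma gravity_weak_form Omega rho0 (u : R -> 'rV[R]_3 -> 'rV[R]_3) (S : R -> 'rV[R]_3 -> R)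
    t phi : open Omega -> 0 <= t -> gravity_solution Omega rho0 u S ->
  (forall i, L2 Omega (fun x => u t x 0 i)) -> Ck 1 phi -> box_supported phi ->
  \sum_i Int3 setT (fun x => wderiv setT i (S t) x * pd i phi x) =
  - (rho0 * \sum_i Int3 Omega (fun x => u t x 0 i * pd i phi x)).
Proof.
move=> oO t0 /(_ t t0)[[LS HS] grav] Lu Cp bp.
have mT := mset_open (@openT 'rV[R]_3); have mO := mset_open oO.
have LSi i : L2 setT (wderiv setT i (S t)) by have [_ []] := HS i.
have Lpi i D : mset D -> L2 D (pd i phi) by move=> mD; exact: pd_L2.
have Hp := Hk1_setT Cp bp.
have wp i : ae3 setT (fun x => wderiv setT i phi x = pd i phi x).
  by apply: (wderiv_ae openT); exact: is_wderiv_pd.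
have Lwp i : L2 setT (wderiv setT i phi) by have [_ /(_ i)[_ []]] := Hp.
have wpO i : ae3 Omega (fun x => wderiv setT i phi x = pd i phi x).
  by apply: ae3_sub (wp i).
have LwpO i : L2 Omega (wderiv setT i phi) by apply: (L2_sub mT mO) (Lwp i).
have := grav _ Hp.
rewrite Int3_sum//; last by move=> i; exact: L2_mul_summable.
rewrite (_ : (fun x => \sum_i rho0 * u t x 0 i * wderiv setT i phi x) =
  (fun x => \sum_i rho0 * (u t x 0 i * wderiv setT i phi x))); last first.
  by apply/funext => x; apply: eq_bigr => i _; rewrite mulrA.
rewrite Int3_sum//; last by move=> i; apply: summableZ => //; exact: L2_mul_summable.
under [X in _ = - X -> _]eq_bigr => i _.
  rewrite Int3Z//; last exact: L2_mul_summable.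
  rewrite (@ae3_eq_Int3 _ _ _ (fun x => u t x 0 i * pd i phi x))//.
  - over.
  - exact: summable_meas (L2_mul_summable mO (Lu i) (LwpO i)).
  - exact: summable_meas (L2_mul_summable mO (Lu i) (Lpi i _ mO)).
  - by apply: (ae3_mono (wpO i)) => x _ ->.
rewrite -mulr_sumr => <-; apply: eq_bigr => i _.
apply: ae3_eq_Int3 => //.
- exact: summable_meas (L2_mul_summable mT (LSi i) (Lpi i _ mT)).
- exact: summable_meas (L2_mul_summable mT (LSi i) (Lwp i)).
- by apply: (ae3_mono (wp i)) => x _ ->.
Qed.

End WeakDerivatives.

(** * Radial vector fields and the flux identity *)

Section RadialFields.
Context (R : realType).
Implicit Types (x y : 'rV[R]_3) (G : R -> R) (i j e : 'I_3) (k : nat).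

Local Notation e_ i := (delta_mx 0 i : 'rV[R]_3).

(** Radial functions are written as functions of the squared distance, which is
    smooth at the centre. *)
Definition dsq y x : R := \sum_i (x 0 i - y 0 i) ^+ 2.

(** For G(s) = s^(-3/2) this is the component [i] of the Newtonian field
    z / |z|^3, z = x - y. *)
Definition field G y i x : R := (x 0 i - y 0 i) * G (dsq y x).

Lemma is_derive_coord i j x : is_derive x (e_ j) (fun x : 'rV[R]_3 => x 0 i) (i == j)%:R.
Proof.
have d := @Ck_is_derive R (fun x : 'rV[R]_3 => x 0 i) j 0 (@Ck_coord R 1 i) x.
apply: (is_derive_eq d); rewrite /pd /derive.
have -> : (fun h : R => h^-1 *: ((h *: e_ j + x) 0 i - x 0 i)) =
    (fun h : R => h^-1 * (h * (i == j)%:R)).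
  by apply/funext => h; rewrite !mxE eqxx /= addrK.
apply: cvg_lim => //; apply: cvg_near_cst; near=> h; rewrite mulKf//.
by near: h; exact: nbhs_dnbhs_neq.
Unshelve. all: by end_near. Qed.

Lemma is_derive_coordB y i j x :
  is_derive x (e_ j) (fun x : 'rV[R]_3 => x 0 i - y 0 i) (i == j)%:R.
Proof.
have d := is_derive_sub (is_derive_coord i j x) (is_derive_const (y 0 i) x (e_ j)).
by apply: (is_derive_eq d); rewrite subr0.
Qed.

Lemma is_derive_dsq y j x : is_derive x (e_ j) (dsq y) (2 * (x 0 j - y 0 j)).
Proof.
rewrite /dsq; under eq_fun do rewrite sum3 !expr2.
have d i := is_derive_mul (is_derive_coordB y i j x) (is_derive_coordB y i j x).
apply: (is_derive_eq (is_derive_add (is_derive_add (d o0) (d o1)) (d o2))).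
by elim/ord3P: j {d} => /=; ring.
Qed.

Lemma is_derive_radial G y j x : C1d 1 G ->
  is_derive x (e_ j) (fun x => G (dsq y x)) ('D_1 G (dsq y x) * (2 * (x 0 j - y 0 j))).
Proof.
move=> CG; apply: is_derive_chain; first exact: is_derive_dsq.
exact: (C1d_is_derive CG).
Qed.

Lemma is_derive_field G y i j x : C1d 1 G ->
  is_derive x (e_ j) (field G y i)
    ((x 0 i - y 0 i) * ('D_1 G (dsq y x) * (2 * (x 0 j - y 0 j))) +
     (i == j)%:R * G (dsq y x)).
Proof.
move=> CG; apply: (is_derive_eq (is_derive_mul (is_derive_coordB y i j x)
  (is_derive_radial y j x CG))).
by congr (_ + _); rewrite mulrC.
Qed.

Lemma Ck_coordB k y i : Ck k (fun x => x 0 i - y 0 i).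
Proof.
by rewrite CkE; apply: CdB; [rewrite -CkE; exact: Ck_coord|exact: Cd_cst].
Qed.

Lemma Ck_dsq k y : Ck k (dsq y).
Proof.
rewrite CkE; apply: Cd_sum => i; rewrite -CkE.
under eq_fun do rewrite expr2.
by rewrite CkE; apply: CdM; rewrite -CkE; exact: Ck_coordB.
Qed.

Lemma Ck_radial k G y : C1d k G -> Ck k (fun x => G (dsq y x)).
Proof. by move=> CG; rewrite CkE; apply: (Cd_comp CG); rewrite -CkE; exact: Ck_dsq. Qed.

Lemma Ck_field k G y i : C1d k G -> Ck k (field G y i).
Proof.
by move=> CG; rewrite CkE; apply: CdM; rewrite -CkE; [exact: Ck_coordB|exact: Ck_radial].
Qed.

Lemma dsq_ge_coord y x i : (x 0 i - y 0 i) ^+ 2 <= dsq y x.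
Proof. by rewrite /dsq (bigD1 i)//= lerDl sumr_ge0// => j _; exact: sqr_ge0. Qed.

Lemma dsq_ge0 y x : 0 <= dsq y x.
Proof. by apply: sumr_ge0 => i _; exact: sqr_ge0. Qed.

Lemma dsq_box y r x : 0 <= r -> dsq y x < r ^+ 2 ->
  cbox (r + \sum_i `|y 0 i|) x.
Proof.
move=> r0 xr i; have h := le_lt_trans (dsq_ge_coord y x i) xr.
have hn : `|x 0 i - y 0 i| <= r.
  rewrite -(ler_pXn2r (n := 2)) ?nnegrE// real_normK ?num_real//; exact: ltW.
rewrite -[x 0 i](subrK (y 0 i)) (le_trans (ler_normD _ _))// lerD//.
by rewrite (bigD1 i)//= lerDl sumr_ge0.
Qed.

Lemma radial_box G y r : 0 <= r -> (forall s, r ^+ 2 <= s -> G s = 0) ->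
  box_supported (fun x => G (dsq y x)).
Proof.
move=> r0 Gr; exists (r + \sum_i `|y 0 i|) => x xL; apply: Gr.
by rewrite leNgt; apply/negP => h; apply: xL; exact: dsq_box.
Qed.

Lemma field_box G y r i : 0 <= r -> (forall s, r ^+ 2 <= s -> G s = 0) ->
  box_supported (field G y i).
Proof.
by move=> r0 /(radial_box y r0)[L GL]; exists L => x /GL Gx; rewrite /field Gx mulr0.
Qed.

(** The vector field z G(|z|^2) is a gradient, hence it is curl free. *)
Lemma pd_field_sym G y i j : C1d 1 G -> pd j (field G y i) = pd i (field G y j).
Proof.
move=> CG; rewrite (pdE (fun x => is_derive_field y i j x CG)).
rewrite (pdE (fun x => is_derive_field y j i x CG)).
by apply/funext => x; rewrite eq_sym; ring.
Qed.

Lemma pd_field_diag G y i x : C1d 1 G ->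
  pd i (field G y i) x =
  (x 0 i - y 0 i) * ('D_1 G (dsq y x) * (2 * (x 0 i - y 0 i))) + G (dsq y x).
Proof.
move=> CG; rewrite (pdE (fun x => is_derive_field y i i x CG)) eqxx.
by congr (_ + _); exact: mul1r.
Qed.

Lemma pd_pd_field G y e i : C1d 2 G ->
  pd i (pd e (field G y i)) = pd e (pd i (field G y i)).
Proof.
move=> CG; have CG1 : C1d 1 G := C1d_pred CG.
have CG' : C1d 1 (fun s => 'D_1 G s) := C1d_derive CG.
rewrite (pdE (fun x => is_derive_field y i e x CG1)).
rewrite (pdE (fun x => is_derive_field y i i x CG1)).
have d a b c x : is_derive x (e_ c) (fun x => (x 0 a - y 0 a) *
    ('D_1 G (dsq y x) * (2 * (x 0 b - y 0 b))) + (a == b)%:R * G (dsq y x)) _ :=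
  is_derive_add (is_derive_mul (is_derive_coordB y a c x)
    (is_derive_mul (is_derive_radial y c x CG')
      (is_derive_mulcl 2 (is_derive_coordB y b c x))))
    (is_derive_mulcl (a == b)%:R (is_derive_radial y c x CG1)).
rewrite (pdE (d i e i)) (pdE (d i i e)); apply/funext => x.
rewrite eqxx (eq_sym e i); ring.
Qed.

(** Since d_i (z_e G) = d_e (z_i G), moving the derivative [i] off S, exchanging
    it with [e] and moving [e] back onto S replaces every component of grad S by
    the component [e], paired with the divergence of z G(|z|^2). *)
Lemma flux_identity G y e r (S : 'rV[R]_3 -> R) (g : 'I_3 -> 'rV[R]_3 -> R) :
  (forall k, C1d k G) -> 0 <= r -> (forall s, r ^+ 2 <= s -> G s = 0) ->
  (forall i, is_wderiv setT i S (g i)) ->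
  \sum_i Int3 setT (fun x => g i x * pd i (field G y e) x) =
  Int3 setT (fun x => g e x * (3 * G (dsq y x) + 2 * dsq y x * 'D_1 G (dsq y x))).
Proof.
move=> CG r0 Gr Sg; have mT := mset_open (@openT 'rV[R]_3).
have Cf k i : Ck k (field G y i) by exact: Ck_field.
have bf i : box_supported (field G y i) by exact: field_box Gr.
have tf i : test_function setT (field G y i) by exact: test_setT.
have tpf i j : test_function setT (pd j (field G y i)).
  by apply: test_setT => [k|]; [exact: Ck_pd|exact: pd_box].
have Lg i : L2 setT (g i) by have [] := Sg i.
have -> : (fun x => g e x * (3 * G (dsq y x) + 2 * dsq y x * 'D_1 G (dsq y x))) =
    (fun x => \sum_i g e x * pd i (field G y i) x).
  apply/funext => x; rewrite -mulr_sumr sum3; congr (_ * _).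
  rewrite !pd_field_diag//.
  have := sum3 (fun i => (x 0 i - y 0 i) ^+ 2); rewrite -/(dsq y x).
  move: (G (dsq y x)) ('D_1 G (dsq y x)) => GG DD ->.
  move: (x 0 o0 - y 0 o0) (x 0 o1 - y 0 o1) (x 0 o2 - y 0 o2) => z0 z1 z2; ring.
have Sgp i : summable setT (fun x => g e x * pd i (field G y i) x).
  exact: (L2_mul_summable mT (Lg e) (test_L2 mT (tpf i i))).
rewrite (Int3_sum _ mT Sgp).
apply: eq_bigr => i _.
rewrite (pd_field_sym y e i (CG 1%N)).
have [_ /(_ _ (tpf i e)) h1] := Sg i; have [_ /(_ _ (tpf i i)) h2] := Sg e.
apply: oppr_inj; rewrite -[LHS]h1 -[RHS]h2.
by rewrite (pd_pd_field y e i (CG 2%N)).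
Qed.

End RadialFields.

(** * From gravity fields to displacements *)

Section DipoleOrthogonality.
Context (R : realType).
Implicit Types (x y : 'rV[R]_3) (i e : 'I_3) (D E Omega : set 'rV[R]_3).

Lemma Int3_le_box D (f : 'rV[R]_3 -> R) L K : mset D -> D `<=` cbox L -> 0 <= L ->
  0 <= K -> summable D f -> (forall x, D x -> f x <= K) -> Int3 D f <= K * (2 * L) ^+ 3.
Proof.
move=> mD DL L0 K0 Sf fK; have Dfin : (leb3 (@vec3 R @^-1` D) <= ((2 * L) ^+ 3)%:E)%E.
  rewrite -leb3_cbox//; apply: le_measure; rewrite ?inE//; first exact: measurable_cbox.
  by move=> p; exact: DL.
have Dlty := le_lt_trans Dfin (ltry _).
have Sc : summable D (fun=> K).
  apply: measurable_bounded_integrable => //.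
  by exists K; split; [exact: num_real|move=> M KM x _ /=; rewrite ger0_norm// ltW].
apply: (le_trans (le_Int3 mD Sf Sc fK)).
rewrite /Int3 Rintegral_cst// ler_wpM2l// -[leRHS]/(fine ((2 * L) ^+ 3)%:E).
by apply: fine_le => //; rewrite ge0_fin_numE ?measure_ge0.
Qed.

Lemma Int3_subset_le D E (f : 'rV[R]_3 -> R) : mset D -> mset E -> D `<=` E ->
  (forall x, 0 <= f x) -> summable E f -> Int3 D f <= Int3 E f.
Proof.
move=> mD mE DE f0 Sf.
rewrite (Int3_mkcond D) (Int3_mkcond E).
have mT := mset_open (@openT 'rV[R]_3).
have Sr X : mset X -> X `<=` E -> summable setT (f \_ X).
  move=> mX XE; have := summable_sub mE mX XE Sf.
  move=> /(integrable_mkcond _ mX) h; rewrite /summable preimage_setT.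
  rewrite (_ : (fun p => _) = (fun p => (f (vec3 p))%:E) \_ (@vec3 R @^-1` X)) //.
  by apply/funext => p; rewrite /patch /in_mem /= /in_set; case: ifP.
apply: le_Int3; [by []|exact: Sr|exact: Sr|].
move=> x _; rewrite /patch; case: ifPn => [|_]; last by case: ifP.
by rewrite inE => /DE Ex; rewrite ifT ?inE.
Qed.

Lemma kern_indep a r r' (s : R) : 0 < a -> 0 < r -> r <= r' -> a < s -> s < r ^+ 2 ->
  kern a r' s = kern a r s /\ 'D_1 (kern a r') s = 'D_1 (kern a r) s.
Proof.
move=> a0 r0 rr' as1 sr; have r'0 : 0 < r' by exact: lt_le_trans rr'.
have r2 : r ^+ 2 <= r' ^+ 2 by rewrite lerXn2r// ?nnegrE ltW.
have E t : a < t -> t < r ^+ 2 -> kern a r' t = kern a r t.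
  move=> at1 tr; rewrite !kern_mid//; first by rewrite (ltW at1) (ltW tr).
  by rewrite (ltW at1) (le_trans (ltW tr)).
split; first exact: E.
apply: near_eq_derive; near=> t; apply: E; near: t; [exact: lt_nbhsr|exact: lt_nbhsl].
Unshelve. all: by end_near. Qed.

Lemma pd_field_indep a r r' y i e x : 0 < a -> 0 < r -> r <= r' ->
  a < dsq y x -> dsq y x < r ^+ 2 ->
  pd i (field (kern a r') y e) x = pd i (field (kern a r) y e) x.
Proof.
move=> a0 r0 rr' ax xr; have [E1 E2] := kern_indep a0 r0 rr' ax xr.
rewrite !(pdE (fun x => is_derive_field y e i x (C1d_kern 1 _ a0))).
by rewrite E1 E2.
Qed.

(** Neither side changes when [r] is replaced by a larger q. By the flux identity
    the difference of the two sides is, up to the factor rho0, the integral of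
    w D_q, where w is the difference of the components [e] of the two gravity
    fields and D_q the divergence of z kern. Now w = 0 where |z|^2 <= a, and the
    L2 norm of D_q on the rest is O(q^(-3/2)), so letting q grow shows that the
    difference is 0. *)
Lemma dipole_orthogonal Omega rho0 (u1 u2 : R -> 'rV[R]_3 -> 'rV[R]_3)
    (S1 S2 : R -> 'rV[R]_3 -> R) t y e a r :
  open Omega -> 0 < rho0 -> 0 <= t -> 0 < a -> 0 < r ->
  (forall x, Omega x -> a < dsq y x < r ^+ 2) ->
  (forall i, L2 Omega (fun x => u1 t x 0 i)) ->
  (forall i, L2 Omega (fun x => u2 t x 0 i)) ->
  gravity_solution Omega rho0 u1 S1 -> gravity_solution Omega rho0 u2 S2 ->
  ae3 [set x | dsq y x <= a] (fun x =>
    wderiv setT e (S1 t) x = wderiv setT e (S2 t) x) ->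
  \sum_i Int3 Omega (fun x => u1 t x 0 i * pd i (field (kern a r) y e) x) =
  \sum_i Int3 Omega (fun x => u2 t x 0 i * pd i (field (kern a r) y e) x).
Proof.
move=> oO rho00 t0 a0 r0 Oar Lu1 Lu2 g1 g2 S12.
have mT := mset_open (@openT 'rV[R]_3); have mO := mset_open oO.
pose J (u : R -> 'rV[R]_3 -> 'rV[R]_3) q :=
  \sum_i Int3 Omega (fun x => u t x 0 i * pd i (field (kern a q) y e) x).
have Jindep u q : r <= q -> J u q = J u r.
  move=> rq; apply: eq_bigr => i _; apply: eq_Int3 => x Ox; congr (_ * _).
  by have /andP[h1 h2] := Oar x Ox; exact: pd_field_indep.
have Ck1 q := fun k => C1d_kern k q a0.
have far q s : 0 < q -> (2 * q) ^+ 2 <= s -> kern a q s = 0.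
  move=> q0 qs; apply: kern_far => //; apply: le_trans qs.
  by rewrite exprMn ler_wpM2r ?sqr_ge0// expr2; lra.
pose Dv q x := 3 * kern a q (dsq y x) + 2 * dsq y x * 'D_1 (kern a q) (dsq y x).
have wd (S : R -> 'rV[R]_3 -> R) u : gravity_solution Omega rho0 u S ->
    forall i, is_wderiv setT i (S t) (wderiv setT i (S t)).
  by move=> g i; have [[_ /(_ i)[h _]] _] := g t t0; exact: wderivP.
have Jflux (u : R -> 'rV[R]_3 -> 'rV[R]_3) (S : R -> 'rV[R]_3 -> R) q : 0 < q -> (forall i, L2 Omega (fun x => u t x 0 i)) ->
    gravity_solution Omega rho0 u S ->
    Int3 setT (fun x => wderiv setT e (S t) x * Dv q x) = - (rho0 * J u q).
  move=> q0 Lu g; have q20 : 0 <= 2 * q by rewrite mulr_ge0// ltW.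
  rewrite -(flux_identity y e (Ck1 q) q20 (fun s => far q s q0) (wd _ _ g)).
  apply: gravity_weak_form => //; first by apply: Ck_field; exact: Ck1.
  exact: (field_box (r := 2 * q) y e q20 (fun s => far q s q0)).
pose w x := wderiv setT e (S1 t) x - wderiv setT e (S2 t) x.
have Lw1 : L2 setT (wderiv setT e (S1 t)) by have [] := wd _ _ g1 e.
have Lw2 : L2 setT (wderiv setT e (S2 t)) by have [] := wd _ _ g2 e.
have Lw : L2 setT w by exact: L2B.
have cDv q : continuous (Dv q).
  have cs : continuous (dsq y) := Ck_cont (Ck_dsq 0 y).
  apply: cont_add; apply: cont_mul.
  - by move=> x; exact: cst_continuous.
  - exact: (Ck_cont (Ck_radial y (Ck1 q 0%N))).
  - by apply: cont_mul => // x; exact: cst_continuous.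
  - exact: (Ck_cont (Ck_radial y (C1d_derive (Ck1 q 1%N)))).
have DvE q x : 0 < q -> Dv q x = \sum_i pd i (field (kern a q) y i) x.
  move=> q0; rewrite sum3 !(pd_field_diag _ _ _ (Ck1 q 1%N)) /Dv.
  have := sum3 (fun i => (x 0 i - y 0 i) ^+ 2); rewrite -/(dsq y x).
  move: (kern a q (dsq y x)) ('D_1 (kern a q) (dsq y x)) => GG DD ->.
  move: (x 0 o0 - y 0 o0) (x 0 o1 - y 0 o1) (x 0 o2 - y 0 o2) => z0 z1 z2; ring.
have LDv q : 0 < q -> L2 setT (Dv q).
  move=> q0; have -> : Dv q = (fun x => \sum_i pd i (field (kern a q) y i) x).
    by apply/funext => x; exact: DvE.
  apply: L2_sum => // i; apply: pd_L2 => //; first by apply: Ck_field; exact: Ck1.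
  apply: (field_box (r := 2 * q) y i _ (fun s => far q s q0)).
  by rewrite mulr_ge0// ltW.
set X := rho0 * (J u2 r - J u1 r).
have XE q : 0 < q -> r <= q -> Int3 setT (fun x => w x * Dv q x) = X.
  move=> q0 rq; rewrite (_ : (fun x => w x * Dv q x) = (fun x =>
    wderiv setT e (S1 t) x * Dv q x - wderiv setT e (S2 t) x * Dv q x)); last first.
    by apply/funext => x; rewrite mulrBl.
  rewrite (Int3B mT (L2_mul_summable mT Lw1 (LDv q q0)) (L2_mul_summable mT Lw2 (LDv q q0))).
  rewrite (Jflux _ _ _ q0 Lu1 g1) (Jflux _ _ _ q0 Lu2 g2) (Jindep u1 q rq) (Jindep u2 q rq).
  rewrite /X; move: (J u1 r) (J u2 r) => A1 A2; ring.
have [C C0 kernC] := kern_div R.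
pose E := [set x | a < dsq y x].
have oE : open E.
  apply: (open_comp (f := dsq y) (D := [set s | a < s])); last exact: open_gt.
  by move=> x _; exact: (Ck_cont (Ck_dsq 0 y)).
have mE := mset_open oE.
pose W := Int3 setT (fun x => w x ^+ 2); pose Y := \sum_i `|y 0 i|.
have W0 : 0 <= W by apply: Int3_ge0 => x _; exact: sqr_ge0.
have Y0 : 0 <= Y by apply: sumr_ge0.
(* The factor 216 = 6^3 is the volume bound: D_q is supported in a cube of
   side at most 6 q. *)
have bound q : 0 < q -> r <= q -> Y <= q -> a < q ^+ 2 ->
    X ^+ 2 <= W * (C ^+ 2 * 216 / q ^+ 3).
  move=> q0 rq Yq aq.
  have -> : X = Int3 E (fun x => w x * Dv q x).
    rewrite -(XE q q0 rq) (Int3_mkcond E).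
    have SwD := L2_mul_summable mT Lw (LDv q q0).
    apply: ae3_eq_Int3 => //; first exact: summable_meas SwD.
      rewrite /mfun3 preimage_setT.
      have -> : ((fun x => w x * Dv q x) \_ E) \o @vec3 R =
          ((fun x => w x * Dv q x) \o @vec3 R) \_ (@vec3 R @^-1` E).
        by apply/funext => p; rewrite /patch /=.
      apply/(measurable_restrictT _ mE); apply: measurable_funTS.
      exact: (summable_meas SwD).
    have ae1 : ae3 setT (fun x => dsq y x <= a -> w x = 0).
      apply: (@filterS _ _ (@ae_filter_ringOfSetsType _ _ _ _) _ _ _ S12) => p h _ pa.
      by rewrite /w h// subrr.
    apply: (ae3_mono ae1) => x _ h; rewrite /patch; case: ifPn => // /negP.
    by rewrite inE /E /= => /negP; rewrite -leNgt => /h ->; rewrite mul0r.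
  apply: (le_trans (Int3_cauchy_schwarz mE (L2_sub mT mE (@subsetT _ E) Lw)
    (L2_sub mT mE (@subsetT _ E) (LDv q q0)))).
  have Int2 : Int3 E (fun x => Dv q x ^+ 2) <= C ^+ 2 * 216 / q ^+ 3.
    pose L := 2 * q + Y.
    have L0 : 0 <= L by rewrite addr_ge0// mulr_ge0// ltW.
    have mL : mset (E `&` cbox L) by apply: measurableI => //; exact: measurable_cbox.
    rewrite -(@Int3_vanish _ (E `&` cbox L)); last 2 first.
    - exact: subIsetl.
    - move=> x Ex nL; suff -> : Dv q x = 0 by rewrite expr0n.
      have [_ h0] := kernC a q (dsq y x) a0 q0 aq Ex; apply: h0.
      right; apply: (@lt_le_trans _ _ ((2 * q) ^+ 2)).
        by rewrite exprMn ltr_pM2r ?exprn_gt0// expr2; lra.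
      rewrite leNgt; apply/negP => h; apply: nL; split=> //.
      by apply: dsq_box => //; rewrite mulr_ge0// ltW.
    have SD2 : summable (E `&` cbox L) (fun x => Dv q x ^+ 2).
      apply: L2_summable_sq => //; exact: (L2_sub mT mL (@subsetT _ _) (LDv q q0)).
    apply: (@le_trans _ _ ((C / q ^+ 3) ^+ 2 * (2 * L) ^+ 3)).
      apply: (Int3_le_box mL (@subIsetr _ _ _) L0 (sqr_ge0 _) SD2).
      move=> x [Ex _]; have [h _] := kernC a q (dsq y x) a0 q0 aq Ex.
      rewrite -[leLHS]real_normK ?num_real// lerXn2r ?nnegrE//.
      exact: le_trans h.
    have L3 : 2 * L <= 6 * q by rewrite /L; lra.
    apply: (@le_trans _ _ ((C / q ^+ 3) ^+ 2 * (6 * q) ^+ 3)).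
      rewrite ler_wpM2l ?sqr_ge0// lerXn2r ?nnegrE ?mulr_ge0// ltW//.
    rewrite le_eqVlt; apply/orP; left; apply/eqP; field; by rewrite gt_eqF.
  apply: ler_pM => //.
  - by apply: Int3_ge0 => x _; exact: sqr_ge0.
  - by apply: Int3_ge0 => x _; exact: sqr_ge0.
  - apply: Int3_subset_le => //; first by move=> x; exact: sqr_ge0.
    exact: L2_summable_sq.
suff X0 : X = 0.
  move/eqP: X0; rewrite mulf_eq0 gt_eqF//= subr_eq0 => /eqP h.
  exact: esym h.
apply/eqP; rewrite -sqrf_eq0; apply/eqP/le_anti; rewrite sqr_ge0 andbT.
rewrite leNgt; apply/negP => X2.
pose A := W * (C ^+ 2 * 216).
have A0 : 0 <= A by rewrite !mulr_ge0// sqr_ge0.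
(* q is taken so large that the bound falls below X ^+ 2. *)
pose q := 1 + r + Y + a + A / X ^+ 2.
have AX : 0 <= A / X ^+ 2 by rewrite divr_ge0// ltW.
have q1 : 1 < q by rewrite /q; lra.
have q0 : 0 < q by lra.
have qq : q <= q ^+ 2 by rewrite expr2 ler_peMl// ltW.
have := bound q q0 (ltac:(rewrite /q; lra)) (ltac:(rewrite /q; lra))
  (ltac:(apply: lt_le_trans qq; rewrite /q; lra)).
rewrite leNgt => /negP; apply; rewrite mulrA -/A ltr_pdivrMr ?exprn_gt0//.
rewrite mulrC -ltr_pdivrMr//; apply: (@lt_le_trans _ _ q); first by rewrite /q; lra.
by rewrite (le_trans qq)// exprS ler_peMl ?sqr_ge0// ltW.
Qed.

End DipoleOrthogonality.

(** * Time derivatives of pairings *)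

Section TimeDerivative.
Context (R : realType).
Implicit Types (Omega : set 'rV[R]_3) (t s : R).

Definition time_filter t := within [set s : R | 0 <= s] (dnbhs t).

(** The derivative relative to nonnegative times, as in [time_deriv]. *)
Definition deriv_at (F : R -> R) t (l : R) :=
  (s - t)^-1 * (F s - F t) @[s --> time_filter t] --> l.

#[local] Instance time_filter_filter t : Filter (time_filter t).
Proof. exact: within_filter. Qed.

Lemma deriv_atB F G t l m : deriv_at F t l -> deriv_at G t m ->
  deriv_at (fun s => F s - G s) t (l - m).
Proof.
move=> hF hG; rewrite /deriv_at.
rewrite (_ : (fun s => _) = (fun s => (s - t)^-1 * (F s - F t) - (s - t)^-1 * (G s - G t))).
  exact: cvgB.
by apply/funext => s; rewrite -mulrBr; congr (_ * _); ring.
Qed.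

Lemma deriv_atD F G t l m : deriv_at F t l -> deriv_at G t m ->
  deriv_at (fun s => F s + G s) t (l + m).
Proof.
move=> hF hG; rewrite /deriv_at.
rewrite (_ : (fun s => _) = (fun s => (s - t)^-1 * (F s - F t) + (s - t)^-1 * (G s - G t))).
  exact: cvgD.
by apply/funext => s; rewrite -mulrDr; congr (_ * _); ring.
Qed.

Lemma deriv_at_eq0 F t t1 l : 0 <= t -> t < t1 -> (forall s, 0 <= s < t1 -> F s = 0) ->
  deriv_at F t l -> l = 0.
Proof.
move=> t0 tt1 F0 dF; apply/eqP; rewrite -normr_eq0 eq_le normr_ge0 andbT.
apply/ler_addgt0Pl => e e0; rewrite addr0.
have /cvgrPdist_le/(_ _ e0) := dF.
rewrite /time_filter near_withinE => /nbhs_ballP[d /= d0 hd].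
pose s := t + Num.min (d / 2) ((t1 - t) / 2).
have m0 : 0 < Num.min (d / 2) ((t1 - t) / 2) by rewrite lt_min !divr_gt0 ?subr_gt0.
have [m1 m2] : Num.min (d / 2) ((t1 - t) / 2) <= d / 2 /\
    Num.min (d / 2) ((t1 - t) / 2) <= (t1 - t) / 2 by rewrite !ge_min !lexx orbT.
have st1 : 0 <= s < t1 by apply/andP; split; rewrite /s; lra.
have := hd s; rewrite /ball /= (F0 _ st1) (F0 t) ?t0// subrr mulr0 subr0; apply.
- by rewrite /s opprD addNKr normrN gtr0_norm//; lra.
- by rewrite /s gt_eqF// ltrDl.
- by case/andP: st1.
Qed.

(** By Cauchy-Schwarz, pairing with psi is continuous for the L2 convergence of
    the difference quotients. *)
Lemma deriv_at_pairing Omega (v vt : R -> 'rV[R]_3 -> R) (psi : 'rV[R]_3 -> R) t :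
  mset Omega -> (forall s, 0 <= s -> L2 Omega (v s)) -> L2 Omega (vt t) ->
  L2 Omega psi -> time_deriv Omega v vt -> 0 <= t ->
  deriv_at (fun s => Int3 Omega (fun x => v s x * psi x)) t
    (Int3 Omega (fun x => vt t x * psi x)).
Proof.
move=> mO Lv Lvt Lp dv t0; have := dv t t0; rewrite -/(time_filter t) => cv.
pose P := Int3 Omega (fun x => psi x ^+ 2).
have P0 : 0 <= P by apply: Int3_ge0 => x _; exact: sqr_ge0.
apply/cvgrPdist_le => e e0.
have d0 : 0 < e ^+ 2 / (P + 1) by rewrite divr_gt0 ?exprn_gt0// ltr_wpDl.
pose dq s x := (s - t)^-1 * (v s x - v t x) - vt t x.
have near_small : \forall s \near time_filter t,
    (L2norm2 Omega (dq s) < (e ^+ 2 / (P + 1))%:E)%E.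
  by apply: (cv [set z | (z < (e ^+ 2 / (P + 1))%:E)%E]); apply: open_nbhs_nbhs; split; [exact: open_ereal_lt_ereal|rewrite /= lte_fin].
have near_pos : \forall s \near time_filter t, 0 <= s.
  by rewrite /time_filter near_withinE; apply: filterE.
apply: filterS2 near_small near_pos => s small s0.
have Ldq : L2 Omega (fun x => (s - t)^-1 * (v s x - v t x) - vt t x).
  apply: L2B => //; apply: L2Z => //; apply: L2B => //; exact: Lv.
move: small; rewrite (L2norm2E mO Ldq) lte_fin => small.
have -> : Int3 Omega (fun x => vt t x * psi x) - (s - t)^-1 *
    (Int3 Omega (fun x => v s x * psi x) - Int3 Omega (fun x => v t x * psi x)) =
    - Int3 Omega (fun x => ((s - t)^-1 * (v s x - v t x) - vt t x) * psi x).
  have Ss := L2_mul_summable mO (Lv s s0) Lp.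
  have St := L2_mul_summable mO (Lv t t0) Lp.
  have Sv := L2_mul_summable mO Lvt Lp.
  have -> : (fun x => ((s - t)^-1 * (v s x - v t x) - vt t x) * psi x) =
     (fun x => (s - t)^-1 * (v s x * psi x - v t x * psi x) - vt t x * psi x).
    by apply/funext => x; rewrite mulrBl -mulrA (mulrBl (psi x)).
  rewrite (Int3B mO (summableZ _ mO (summableB mO Ss St)) Sv).
  by rewrite (Int3Z _ mO (summableB mO Ss St)) (Int3B mO Ss St) opprB.
rewrite normrN -(ler_pXn2r (n := 2)) ?nnegrE ?normr_ge0 ?(ltW e0)//.
rewrite real_normK ?num_real//.
apply: (le_trans (Int3_cauchy_schwarz mO Ldq Lp)); rewrite -/P.
apply: (@le_trans _ _ (e ^+ 2 / (P + 1) * P)); first by rewrite ler_wpM2r// ltW.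
by rewrite mulrAC ler_pdivrMr ?ltr_wpDl// ler_wpM2l ?sqr_ge0// lerDl.
Qed.

End TimeDerivative.

(** * Differentiation under the integral and translations *)

Section MeanValue.
Context (R : realType).
Implicit Types (x y v P : 'rV[R]_3) (i : 'I_3) (s t L : R).
Local Notation e_ i := (delta_mx 0 i : 'rV[R]_3).

(** Differentiation under the integral sign and the mean value theorem. The
    parameter runs over an open interval around the segment, so that the derivatives
    at both ends are two-sided. *)
Lemma Int3_homotopy (F F' : R -> 'rV[R]_3 -> R) L K :
  (forall s x, - 1 < s < 2 -> is_derive s 1 (F ^~ x) (F' s x)) ->
  (forall s, continuous (F s)) -> (forall s x, - 1 < s < 2 -> ~ cbox L x -> F s x = 0) ->
  (forall s x, - 1 < s < 2 -> cbox L x -> `|F' s x| <= K) ->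
  (forall s, 0 < s < 1 -> Int3 setT (F' s) = 0) ->
  Int3 setT (F 1) = Int3 setT (F 0).
Proof.
move=> dF cF F0 F'K F'0; have mL : mset (cbox L) by exact: measurable_cbox.
have mT := mset_open (@openT 'rV[R]_3).
have F'L s x : - 1 < s < 2 -> ~ cbox L x -> F' s x = 0.
  move=> sI xL; have [_ <-] := dF s x sI.
  apply: (@derive_near_cst _ _ _ 0).
  have nI : nbhs s [set t : R | - 1 < t < 2].
    have oI := @interval_open R (BRight (- 1)) (BLeft 2) isT isT.
    have := open_nbhs_nbhs (conj oI (_ : [set` `]- 1, 2[%R] s)).
    rewrite /= in_itv /= => /(_ sI); apply: filterS => t /=.
    by rewrite in_itv.
  by apply: filterS nI => t tI; exact: F0.
have II s : - 1 < s < 2 -> Int3 (cbox L) (F s) = Int3 setT (F s).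
  by move=> sI; apply: Int3_vanish => // x _; exact: F0.
have II' s : - 1 < s < 2 -> Int3 (cbox L) (F' s) = Int3 setT (F' s).
  by move=> sI; apply: Int3_vanish => // x _; exact: F'L.
pose Phi s := \int[@leb3 R]_(p in @vec3 R @^-1` cbox L) F s (vec3 p).
have SF s : - 1 < s < 2 -> summable (cbox L) (F s).
  by move=> sI; apply: summable_cc => //; exists L => x; exact: F0.
have dE s p : - 1 < s < 2 -> partial1of2 (fun s (p : T3 R) => F s (vec3 p)) s p = F' s (vec3 p).
  by move=> sI; rewrite partial1of2E; have [_ <-] := dF s (vec3 p) sI.
have dPhi s : - 1 < s < 2 -> is_derive s 1 Phi (Int3 (cbox L) (F' s)).
  move=> sI; have sII : `]- 1, 2[%classic s by rewrite /= in_itv.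
  have HI : forall t, `]- 1, 2[%classic t -> - 1 < t < 2 by move=> t /=; rewrite in_itv.
  have H1 : forall t, `]- 1, 2[%classic t ->
    (@leb3 R).-integrable (@vec3 R @^-1` cbox L) (EFin \o (fun p => F t (vec3 p))).
    by move=> t /HI /SF.
  have H2 : forall t (p : T3 R), `]- 1, 2[%classic t -> (@vec3 R @^-1` cbox L) p ->
      derivable ((fun s (p : T3 R) => F s (vec3 p)) ^~ p) t 1.
    by move=> t p /HI tI _; have [] := dF t (vec3 p) tI.
  have H3 : (@leb3 R).-integrable (@vec3 R @^-1` cbox L) (EFin \o (fun=> `|K|)).
    apply: measurable_bounded_integrable => //; first exact: leb3_cbox_fin.
    by exists `|K|; split; [exact: num_real|move=> M KM p _ /=; rewrite normr_id ltW].
  have H4 : forall t (p : T3 R), `]- 1, 2[%classic t -> (@vec3 R @^-1` cbox L) p ->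
      `|partial1of2 (fun s (p : T3 R) => F s (vec3 p)) t p| <= `|K|.
    by move=> t p /HI tI Lp; rewrite dE// (le_trans (F'K _ _ tI Lp))// ler_norm.
  have K0 : forall p : T3 R, 0 <= `|K| by [].
  have D1 := derivable_under_integral mL sII H1 H2 K0 H3 H4.
  have D2 := differentiation_under_integral mL sII H1 H2 K0 H3 H4.
  apply: DeriveDef => //; rewrite -derive1E D2.
  by apply: eq_Rintegral => p _; rewrite dE.
have [||c c01] := @MVT R Phi (fun s => Int3 (cbox L) (F' s)) 0 1 ltr01.
- by move=> s; rewrite in_itv /= => /andP[s0 s1]; apply: dPhi; apply/andP; split; lra.
- apply: derivable_within_continuous => s; rewrite in_itv /= => /andP[s0 s1].
  by have [] := dPhi s (ltac:(apply/andP; split; lra)).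
have /andP[c0 c1] : 0 < c < 1 by move: c01; rewrite in_itv.
rewrite II' ?F'0 ?mul0r; [|by rewrite c0|by apply/andP; split; lra].
rewrite -!II; [|by apply/andP; split; lra|by apply/andP; split; lra].
by move/eqP; rewrite subr_eq0 => /eqP.
Qed.

Lemma is_derive_translate (V : normedModType R) (f : V -> R) (P x v : V) (d : R) :
  is_derive (x - P) v f d -> is_derive x v (fun z => f (z - P)) d.
Proof.
move=> [df dE].
have E : (fun h : R => h^-1 *: (f (h *: v + x - P) - f (x - P))) =
         (fun h : R => h^-1 *: (f (h *: v + (x - P)) - f (x - P))).
  by apply/funext => h; rewrite addrA.
by apply: DeriveDef; [rewrite /derivable E|rewrite -dE /derive E].
Qed.

Lemma cont_translate (f : 'rV[R]_3 -> R) P : continuous f ->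
  continuous (fun x => f (x - P)).
Proof.
move=> cf; apply: cont_comp => // x.
by apply: (@cvgB R 'rV[R]_3 'rV[R]_3 (nbhs x) _ id (cst P)); [exact: cvg_id|exact: cvg_cst].
Qed.

Lemma box_translate (f : 'rV[R]_3 -> R) P : box_supported f ->
  box_supported (fun x => f (x - P)).
Proof.
move=> [L fL]; exists (L + \sum_i `|P 0 i|) => x xL; apply: fL => h; apply: xL => i.
have := h i; rewrite !mxE => hi.
rewrite -[x 0 i](subrK (P 0 i)) (le_trans (ler_normD _ _))// lerD//.
by rewrite (bigD1 i)//= lerDl sumr_ge0.
Qed.

(** The translates by s c, for s from 0 to 1, form a homotopy whose derivative is
    a partial derivative and so has integral 0. *)
Lemma Int3_translate1 (f g : 'rV[R]_3 -> R) i (c : R) :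
  (forall x, is_derive x (e_ i) f (g x)) -> continuous f -> continuous g ->
  box_supported f -> Int3 setT (fun x => f (x - c *: e_ i)) = Int3 setT f.
Proof.
move=> fg cf cg bf; have [L fL] := bf.
have bg := box_supported_deriv fg bf.
pose L' := `|L| + 2 * `|c|.
have inL s x : - 1 < s < 2 -> ~ cbox L' x -> ~ cbox L (x - (s * c) *: e_ i).
  move=> /andP[s1 s2] xL h; apply: xL => j; have := h j; rewrite !mxE eqxx /= => hj.
  rewrite -[x 0 j](subrK (s * c * (j == i)%:R)) (le_trans (ler_normD _ _))//.
  rewrite lerD ?(le_trans hj (ler_norm _))// !normrM.
  have s2' : `|s| <= 2 by rewrite ler_norml; apply/andP; split; lra.
  apply: (@le_trans _ _ (2 * `|c| * 1)); last by rewrite mulr1.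
  apply: ler_pM; rewrite ?mulr_ge0//; first by rewrite ler_wpM2r.
  by case: (j == i); rewrite ?normr1 ?normr0.
have gb : exists K', forall x, `|g x| <= K'.
  have [Lg gL] := bg; have [K' K'0 gK'] := continuous_cbox_bounded Lg cg.
  exists K' => x; have [/gK'//|/gL ->] := pselect (cbox Lg x).
  by rewrite normr0.
have [K' gK'] := gb.
have := @Int3_homotopy (fun s x => f (x - (s * c) *: e_ i))
  (fun s x => - c * g (x - (s * c) *: e_ i)) L' (`|c| * K').
rewrite mul1r (_ : (fun x => f (x - (0 * c) *: e_ i)) = f); last first.
  by apply/funext => x; rewrite mul0r scale0r subr0.
apply.
- move=> s x _.
  have d1 : is_derive (- c * s) 1 (fun t : R => f (x + t *: e_ i)) (g (x + (- c * s) *: e_ i)).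
    by apply: is_derive_line; exact: fg.
  have d2 : is_derive s 1 (fun t : R => - c * t) (- c).
    by apply: (is_derive_eq (is_derive_mulcl (- c) (is_derive_id s 1))); rewrite mulr1.
  have E t : x - (t * c) *: e_ i = x + (- c * t) *: e_ i.
    by rewrite mulNr scaleNr mulrC.
  have := is_derive_chain d2 d1; rewrite mulrC E.
  by rewrite (_ : (fun t => f (x - (t * c) *: e_ i)) = (fun t => f (x + (- c * t) *: e_ i)))//; apply/funext => t; rewrite E.
- by move=> s; exact: cont_translate.
- by move=> s x sI /(inL s x sI) /fL.
- by move=> s x sI _; rewrite normrM normrN ler_wpM2l.
- move=> s _; have mT := mset_open (@openT 'rV[R]_3).
  have Sg : summable setT (fun x => g (x - (s * c) *: e_ i)).
    by apply: summable_cc => //; [exact: cont_translate|exact: box_translate].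
  rewrite (Int3Z _ mT Sg).
  suff -> : Int3 setT (fun x => g (x - (s * c) *: e_ i)) = 0 by rewrite mulr0.
  apply: (@Int3_derive0 _ i (fun x => f (x - (s * c) *: e_ i))).
  - by move=> x; apply: is_derive_translate; exact: fg.
  - exact: cont_translate.
  - exact: box_translate.
Qed.

Lemma Int3_translate (f : 'rV[R]_3 -> R) P : Ck 1 f -> box_supported f ->
  Int3 setT (fun x => f (x - P)) = Int3 setT f.
Proof.
move=> Cf bf; have PE : P = P 0 o0 *: e_ o0 + P 0 o1 *: e_ o1 + P 0 o2 *: e_ o2.
  by apply/rowP; elim/ord3P; rewrite !mxE /= ?mulr1 ?mulr0 ?addr0 ?add0r.
have step (g : 'rV[R]_3 -> R) (Q : 'rV[R]_3) i c : (forall x, g x = f (x - Q)) ->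
    Int3 setT (fun x => g (x - c *: e_ i)) = Int3 setT g.
  move=> gE; have -> : g = (fun x => f (x - Q)) by apply/funext.
  apply: (@Int3_translate1 _ (fun x => pd i f (x - Q))).
  - by move=> x; apply: is_derive_translate; exact: (Ck_is_derive i Cf).
  - by apply: cont_translate; exact: (Ck_cont Cf).
  - by apply: cont_translate; exact: (Ck_cont (Ck_pd i Cf)).
  - exact: box_translate.
pose p0 := P 0 o0 *: e_ o0; pose p1 := P 0 o1 *: e_ o1; pose p2 := P 0 o2 *: e_ o2.
rewrite -(step f 0 o0 (P 0 o0)) => [|x]; last by rewrite subr0.
rewrite -(step (fun x => f (x - p0)) p0 o1 (P 0 o1))//.
rewrite -(step (fun x => f (x - p1 - p0)) (p1 + p0) o2 (P 0 o2)) => [|x]; last first.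
  by rewrite opprD addrA.
congr Int3; apply/funext => x; congr f.
by rewrite {1}PE -/p0 -/p1 -/p2 (addrC _ p2) (addrC p0) !opprD !addrA.
Qed.

End MeanValue.

(** * The mean value property for radial weights *)

Section RadialMean.
Context (R : realType).
Implicit Types (x y v P : 'rV[R]_3) (i : 'I_3) (s t L : R).
Local Notation e_ i := (delta_mx 0 i : 'rV[R]_3).

Lemma enorm_sub x P : enorm (x - P) = Num.sqrt (dsq P x).
Proof. by rewrite /enorm /dsq; congr Num.sqrt; apply: eq_bigr => i _; rewrite !mxE. Qed.

Lemma enorm_axis t : 0 <= t -> enorm (t *: e_ o0) = t.
Proof.
move=> t0; rewrite /enorm sum3 !mxE /= !mulr1 !mulr0 expr0n /= !addr0.
by rewrite sqrtr_sqr ger0_norm.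
Qed.

Lemma is_derive_of_line (V : normedModType R) (f : V -> R) (x v : V) (d : R) :
  is_derive (0 : R) 1 (fun t => f (x + t *: v)) d -> is_derive x v f d.
Proof.
move=> [df dE].
have E : (fun h : R => h^-1 *: (f (x + (h *: 1 + 0 : R) *: v) - f (x + (0 : R) *: v))) =
         (fun h : R => h^-1 *: (f (h *: v + x) - f x)).
  apply/funext => h; rewrite scale0r !addr0 [h *: 1]mulr1.
  by rewrite (addrC x).
by apply: DeriveDef; [rewrite /derivable -E|rewrite -dE /derive E].
Qed.

Lemma is_derive_affine (V : normedModType R) (f : V -> R) (P x v : V) (s d : R) :
  is_derive (P + s *: (x - P)) v f d ->
  is_derive x v (fun z => f (P + s *: (z - P))) (s * d).
Proof.
move=> fd; apply: is_derive_of_line.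
set z := P + s *: (x - P).
have -> : (fun t => f (P + s *: (x + t *: v - P))) = (fun t => f (z + (s * t) *: v)).
  apply/funext => t; congr f.
  by rewrite /z (_ : x + t *: v - P = (x - P) + t *: v) ?scalerDr ?scalerA ?addrA// addrAC.
have d1 : is_derive (s * 0) 1 (fun t : R => f (z + t *: v)) d.
  by apply: is_derive_line; rewrite mulr0 scale0r addr0.
have d2 : is_derive (0 : R) 1 (fun t : R => s * t) s.
  by apply: (is_derive_eq (is_derive_mulcl s (is_derive_id (0 : R) (1 : R)))); rewrite mulr1.
by have := is_derive_chain d2 d1; rewrite mulrC.
Qed.

Lemma cont_affine (f : 'rV[R]_3 -> R) P s : continuous f ->
  continuous (fun x => f (P + s *: (x - P))).
Proof.
move=> cf; apply: (cont_comp cf) => x.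
apply: (@cvgD R 'rV[R]_3 'rV[R]_3 (nbhs x) _ (cst P) _ P); first exact: cvg_cst.
apply: cvgZl_tmp.
by apply: (@cvgB R 'rV[R]_3 'rV[R]_3 (nbhs x) _ id (cst P)); [exact: cvg_id|exact: cvg_cst].
Qed.

Lemma affine_cbox P x s L : 0 <= L -> `|s| <= 2 -> cbox L x ->
  cbox (\sum_i `|P 0 i| + 2 * (L + \sum_i `|P 0 i|)) (P + s *: (x - P)).
Proof.
move=> L0 s2 Lx i; rewrite !mxE.
have Pi : `|P 0 i| <= \sum_i `|P 0 i| by rewrite (bigD1 i)//= lerDl sumr_ge0.
rewrite (le_trans (ler_normD _ _))// lerD// normrM ler_pM//.
by rewrite (le_trans (ler_normB _ _))// lerD.
Qed.

(** The function x |-> kappa(|x|^2) has gradient x q(|x|). *)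
Lemma radial_potential (q : R -> R) (d : R) :
  continuous (fun x : 'rV[R]_3 => q (enorm x)) -> 0 <= d ->
  (forall s, d < s -> q s = 0) ->
  exists2 kappa : R -> R,
    forall s, 0 <= s -> is_derive s 1 kappa (q (Num.sqrt s) / 2) &
    forall s, d ^+ 2 <= s -> kappa s = 0.
Proof.
move=> cq d0 q0; pose c s := q (Num.sqrt s) / 2.
have cc : continuous c.
  apply: cont_mul; last by move=> s; exact: cst_continuous.
  have -> : (fun s => q (Num.sqrt s)) = (fun s => q (enorm (0 + Num.sqrt s *: e_ o0))).
    by apply/funext => s; rewrite add0r enorm_axis ?sqrtr_ge0.
  have cl := cont_line (x := 0) (v := e_ o0) cq.
  exact: (cont_comp cl (@sqrt_continuous R)).
(* The integral starts at -1 so that the derivative exists at s = 0 as well; on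
   negative numbers [Num.sqrt] is 0 and the integrand is constant. *)
pose k0 s := \int[@lebesgue_measure R]_(t in `[-1, s]) c t.
have dk0 s : - 1 < s -> is_derive s 1 k0 (c s).
  move=> s1.
  have ic : (@lebesgue_measure R).-integrable `[-1, s + 1] (EFin \o c).
    apply: continuous_compact_integrable; first exact: segment_compact.
    exact: continuous_subspaceT.
  have s2 : s < s + 1 by rewrite ltrDl.
  have [h1 h2] := @continuous_FTC1_closed R c (-1) s (s + 1) s2 ic s1 (cc s).
  by apply: DeriveDef => //; rewrite -derive1E h2.
have d2 : 0 <= d ^+ 2 by exact: sqr_ge0.
exists (fun s => k0 s - k0 (d ^+ 2)) => [s s0|s sd].
  have d1 := dk0 s (ltac:(lra)).
  by apply: (is_derive_eq (is_derive_sub d1 (is_derive_const _ s 1))); rewrite subr0.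
have [->|ne] := eqVneq s (d ^+ 2); first by rewrite subrr.
have ds : d ^+ 2 < s by rewrite lt_neqAle eq_sym ne.
have [||z zI ->] := @MVT R k0 c (d ^+ 2) s ds.
- by move=> z; rewrite in_itv /= => /andP[z1 _]; apply: dk0; lra.
- apply: derivable_within_continuous => z; rewrite in_itv /= => /andP[z1 _].
  by have [] := dk0 z (ltac:(lra)).
move: zI; rewrite in_itv /= => /andP[z1 _].
rewrite /c q0 ?mul0r// -(ger0_norm d0) -sqrtr_sqr ltr_sqrt//.
exact: le_lt_trans z1.
Qed.

(** Let Phi(s) be the integral of q(|x - P|) H(P + s (x - P)), so that Phi(1) and
    Phi(0) are the two sides. Writing q(|z|) z as the gradient of the radial
    potential K, Phi'(s) is the integral of grad K . (grad H)(P + s z), hence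
    that of - s K (Laplacian of H)(P + s z) after integration by parts. It is 0,
    because K vanishes outside the ball where H is harmonic. *)
Lemma mean_value (q : R -> R) P (d : R) (H : 'rV[R]_3 -> R) (gH hH : 'I_3 -> 'rV[R]_3 -> R) :
  Ck 1 (fun x : 'rV[R]_3 => q (enorm x)) -> box_supported (fun x => q (enorm x)) ->
  0 <= d -> (forall s, d < s -> q s = 0) ->
  (forall x v, is_derive x v H (\sum_i v 0 i * gH i x)) ->
  continuous H -> (forall i, continuous (gH i)) -> (forall i, continuous (hH i)) ->
  (forall i x, is_derive x (e_ i) (gH i) (hH i x)) ->
  (forall x, dsq P x <= d ^+ 2 -> \sum_i hH i x = 0) ->
  Int3 setT (fun x => q (enorm (x - P)) * H x) =
  H P * Int3 setT (fun x => q (enorm x)).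
Proof.
move=> Cq bq d0 q0 dH cH cgH chH dgH lap.
have mT := mset_open (@openT 'rV[R]_3).
have cq := Ck_cont Cq; have cqP := @cont_translate R _ P cq.
have bqP := box_translate P bq.
have [L0 qL0] := bqP; pose L := `|L0|; have Lge0 : 0 <= L by exact: normr_ge0.
have qL x : ~ cbox L x -> q (enorm (x - P)) = 0.
  by move=> xL; apply: qL0 => h; apply: xL => i; rewrite (le_trans (h i))// ler_norm.
pose Y := \sum_i `|P 0 i|; have Y0 : 0 <= Y by apply: sumr_ge0.
pose L2 := Y + 2 * (L + Y).
have [A A0 qA] := continuous_cbox_bounded L cqP.
have B_ i : exists B, 0 <= B /\ forall x, cbox L2 x -> `|gH i x| <= B.
  by have [B B0 gB] := continuous_cbox_bounded L2 (cgH i); exists B.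
have {B_}[B Bp] := choice B_.
have [kap dkap kap0] := radial_potential cq d0 q0.
pose K x := kap (dsq P x).
have dK i x : is_derive x (e_ i) K ((x 0 i - P 0 i) * q (enorm (x - P))).
  have d1 := is_derive_chain (is_derive_dsq P i x) (dkap _ (dsq_ge0 P x)).
  by apply: (is_derive_eq d1); rewrite enorm_sub; field.
have bK : box_supported K.
  by apply: (radial_box P d0) => s ds; exact: kap0.
have cK : continuous K.
  move=> x; apply: (@continuous_comp _ _ _ (dsq P) kap).
    exact: (Ck_cont (Ck_dsq 0 P)).
  apply/differentiable_continuous/derivable1_diffP.
  by have [] := dkap _ (dsq_ge0 P x).
have cKi i : continuous (fun x => (x 0 i - P 0 i) * q (enorm (x - P))).
  by apply: cont_mul => //; exact: (Ck_cont (Ck_coordB 0 P i)).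
have s2 s : - 1 < s < 2 -> `|s| <= 2.
  by move=> /andP[h1 h2]; rewrite ler_norml; apply/andP; split; lra.
have := @Int3_homotopy R (fun s x => q (enorm (x - P)) * H (P + s *: (x - P)))
  (fun s x => q (enorm (x - P)) * \sum_i (x - P) 0 i * gH i (P + s *: (x - P))) L
  (A * \sum_i ((L + Y) * B i)).
rewrite (_ : (fun x => q (enorm (x - P)) * H (P + 1 *: (x - P))) =
  (fun x => q (enorm (x - P)) * H x)); last first.
  by apply/funext => x; rewrite scale1r [P + _]addrC subrK.
rewrite (_ : (fun x => q (enorm (x - P)) * H (P + 0 *: (x - P))) =
  (fun x => H P * q (enorm (x - P)))); last first.
  by apply/funext => x; rewrite scale0r addr0 mulrC.
rewrite (Int3Z _ mT (summable_cc mT cqP bqP)) (Int3_translate P Cq bq); apply.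
- move=> s x _; apply: is_derive_mulcl.
  exact: (is_derive_line (dH (P + s *: (x - P)) (x - P))).
- by move=> s; apply: cont_mul => //; exact: cont_affine.
- by move=> s x _ xL; rewrite qL// mul0r.
- move=> s x sI Lx; rewrite normrM ler_pM//; first exact: qA.
  rewrite (le_trans (ler_norm_sum _ _ _))//; apply: ler_sum => i _.
  have [B0 gB] := Bp i; rewrite normrM ler_pM//.
    rewrite !mxE (le_trans (ler_normB _ _))// lerD//.
    by rewrite /Y (bigD1 i)//= lerDl sumr_ge0.
  by apply: gB; apply: affine_cbox => //; exact: s2.
- move=> s /andP[s0 s1].
  have cgs i : continuous (fun x => gH i (P + s *: (x - P))) by exact: cont_affine.
  have chs i : continuous (fun x => s * hH i (P + s *: (x - P))).
    by apply: cont_mul; [move=> ?; exact: cst_continuous|exact: cont_affine].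
  have -> : (fun x => q (enorm (x - P)) * \sum_i (x - P) 0 i * gH i (P + s *: (x - P))) =
      (fun x => \sum_i gH i (P + s *: (x - P)) * ((x 0 i - P 0 i) * q (enorm (x - P)))).
    apply/funext => x; rewrite mulr_sumr; apply: eq_bigr => i _.
    by rewrite !mxE; ring.
  have bM (f k : 'rV[R]_3 -> R) : box_supported k -> box_supported (fun x => f x * k x).
    by case=> M kM; exists M => x /kM ->; rewrite mulr0.
  have bKi i : box_supported (fun x => (x 0 i - P 0 i) * q (enorm (x - P))) by exact: bM.
  rewrite (Int3_sum _ mT); last first.
    by move=> i; apply: summable_cc => //; [exact: cont_mul|exact: bM].
  have byp i : Int3 setT (fun x => gH i (P + s *: (x - P)) *
        ((x 0 i - P 0 i) * q (enorm (x - P)))) =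
      - Int3 setT (fun x => s * hH i (P + s *: (x - P)) * K x).
    apply: (@Int3_by_parts R i _ _ (fun x => s * hH i (P + s *: (x - P)))) => //.
    by move=> x; apply: is_derive_affine; exact: dgH.
  under eq_bigr do rewrite byp.
  rewrite sumrN -(Int3_sum _ mT); last first.
    by move=> i; apply: summable_cc => //; [exact: cont_mul|exact: bM].
  apply/eqP; rewrite oppr_eq0; apply/eqP.
  rewrite -[RHS](Int30 setT); apply: eq_Int3 => x _.
  rewrite -mulr_suml -mulr_sumr.
  have [xd|xd] := leP (dsq P x) (d ^+ 2); last by rewrite /K kap0 ?mulr0// ltW.
  rewrite lap ?mulr0 ?mul0r//; apply: le_trans xd.
  rewrite /dsq; apply: ler_sum => i _; rewrite !mxE [P 0 i + _]addrC addrK exprMn.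
  by rewrite ler_piMl ?sqr_ge0// expr_le1 ?ltW.
Qed.

End RadialMean.

(** * Second derivatives of a radial field, contracted with a moment *)

Section Quadrupole.
Context (R : realType).
Implicit Types (x v P : 'rV[R]_3) (i j k : 'I_3) (s : R).
Local Notation e_ i := (delta_mx 0 i : 'rV[R]_3).

Context (M : 'M[R]_3) (y : 'rV[R]_3) (e : 'I_3) (T : nat -> R -> R).
Context (Msym : M^T = M) (Mtr : \tr M = 0).
Context (dT : forall n s, is_derive s 1 (T n) (T n.+1 s)).

Definition relc i x : R := x 0 i - y 0 i.
Definition lin_form k x : R :=
  M k o0 * relc o0 x + M k o1 * relc o1 x + M k o2 * relc o2 x.
Definition quad_form x : R :=
  relc o0 x * lin_form o0 x + relc o1 x * lin_form o1 x + relc o2 x * lin_form o2 x.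

(** The second derivatives of z_e T_0(|z|^2) contracted with M, for M symmetric
    of trace 0 (see [quadrupoleE]), in terms of the derivatives T_n of T_0. *)
Definition quadrupole x : R :=
  4 * (T 1 (dsq y x) * lin_form e x) +
  4 * (T 2 (dsq y x) * (relc e x * quad_form x)).

Definition quadrupole_grad i x : R :=
  8 * (T 2 (dsq y x) * (relc i x * lin_form e x)) + 4 * M e i * T 1 (dsq y x) +
  8 * (T 3 (dsq y x) * (relc i x * (relc e x * quad_form x))) +
  4 * (e == i)%:R * (T 2 (dsq y x) * quad_form x) +
  8 * (T 2 (dsq y x) * (relc e x * lin_form i x)).

(** Only the diagonal of the Hessian matrix enters the Laplacian. *)
Definition quadrupole_hess i x : R :=
  8 * (T 3 (dsq y x) * (2 * relc i x) * (relc i x * lin_form e x) +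
       T 2 (dsq y x) * (lin_form e x + relc i x * M e i)) +
  4 * M e i * (T 2 (dsq y x) * (2 * relc i x)) +
  8 * (T 4 (dsq y x) * (2 * relc i x) * (relc i x * (relc e x * quad_form x)) +
       T 3 (dsq y x) * (relc e x * quad_form x + relc i x *
         ((e == i)%:R * quad_form x + relc e x * (2 * lin_form i x)))) +
  4 * (e == i)%:R * (T 3 (dsq y x) * (2 * relc i x) * quad_form x +
       T 2 (dsq y x) * (2 * lin_form i x)) +
  8 * (T 3 (dsq y x) * (2 * relc i x) * (relc e x * lin_form i x) +
       T 2 (dsq y x) * ((e == i)%:R * lin_form i x + relc e x * M i i)).

Let Ms i j : M i j = M j i.
Proof. by rewrite -[in LHS]Msym mxE. Qed.

Let M22 : M o2 o2 = - M o0 o0 - M o1 o1.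
Proof.
by move: Mtr; rewrite /mxtrace sum3 => h; lra.
Qed.

Lemma is_derive_relc i x v : is_derive x v (relc i) (v 0 i).
Proof.
apply: is_derive_of_line.
have -> : (fun t => relc i (x + t *: v)) = (fun t => t * v 0 i + relc i x).
  by apply/funext => t; rewrite /relc !mxE; ring.
have d := is_derive_add (is_derive_mul (is_derive_id (0 : R) (1 : R))
  (is_derive_const (v 0 i) (0 : R) (1 : R))) (is_derive_const (relc i x) (0 : R) (1 : R)).
by apply: (is_derive_eq d); rewrite mulr0 mulr1 addr0 add0r.
Qed.

Lemma is_derive_dsq_dir x v :
  is_derive x v (dsq y) (2 * (relc o0 x * v 0 o0 + relc o1 x * v 0 o1 + relc o2 x * v 0 o2)).
Proof.
have -> : dsq y = (fun x => relc o0 x * relc o0 x + relc o1 x * relc o1 x + relc o2 x * relc o2 x).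
  by apply/funext => z; rewrite /dsq sum3 !expr2.
have d i := is_derive_mul (is_derive_relc i x v) (is_derive_relc i x v).
by apply: (is_derive_eq (is_derive_add (is_derive_add (d o0) (d o1)) (d o2))); ring.
Qed.

Lemma is_derive_T n x v : is_derive x v (fun x => T n (dsq y x)) (T n.+1 (dsq y x) *
  (2 * (relc o0 x * v 0 o0 + relc o1 x * v 0 o1 + relc o2 x * v 0 o2))).
Proof. by apply: is_derive_chain; exact: is_derive_dsq_dir. Qed.

Lemma is_derive_lin k x v :
  is_derive x v (lin_form k) (M k o0 * v 0 o0 + M k o1 * v 0 o1 + M k o2 * v 0 o2).
Proof.
exact: (is_derive_add (is_derive_add (is_derive_mulcl (M k o0) (is_derive_relc o0 x v))
  (is_derive_mulcl (M k o1) (is_derive_relc o1 x v)))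
  (is_derive_mulcl (M k o2) (is_derive_relc o2 x v))).
Qed.

Lemma is_derive_quad x v : is_derive x v quad_form
  (2 * (lin_form o0 x * v 0 o0 + lin_form o1 x * v 0 o1 + lin_form o2 x * v 0 o2)).
Proof.
have d i := is_derive_mul (is_derive_relc i x v) (is_derive_lin i x v).
apply: (is_derive_eq (is_derive_add (is_derive_add (d o0) (d o1)) (d o2))).
rewrite /lin_form (Ms o1 o0) (Ms o2 o0) (Ms o2 o1); ring.
Qed.

Lemma quadrupoleP x v :
  is_derive x v quadrupole (\sum_i v 0 i * quadrupole_grad i x).
Proof.
have d := is_derive_add
  (is_derive_mulcl 4 (is_derive_mul (is_derive_T 1 x v) (is_derive_lin e x v)))
  (is_derive_mulcl 4 (is_derive_mul (is_derive_T 2 x v)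
    (is_derive_mul (is_derive_relc e x v) (is_derive_quad x v)))).
apply: (is_derive_eq d); rewrite sum3 /quadrupole_grad {d}.
move: (T 1 (dsq y x)) (T 2 (dsq y x)) (T 3 (dsq y x)) (quad_form x) (lin_form o0 x)
  (lin_form o1 x) (lin_form o2 x) => T1 T2 T3 N l0 l1 l2.
by elim/ord3P: e => /=; ring.
Qed.

Lemma quadrupole_gradP i x :
  is_derive x (e_ i) (quadrupole_grad i) (quadrupole_hess i x).
Proof.
have d0 := is_derive_mulcl 8 (is_derive_mul (is_derive_T 2 x (e_ i))
  (is_derive_mul (is_derive_relc i x (e_ i)) (is_derive_lin e x (e_ i)))).
have d1 := is_derive_mulcl (4 * M e i) (is_derive_T 1 x (e_ i)).
have d2 := is_derive_mulcl 8 (is_derive_mul (is_derive_T 3 x (e_ i))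
  (is_derive_mul (is_derive_relc i x (e_ i))
    (is_derive_mul (is_derive_relc e x (e_ i)) (is_derive_quad x (e_ i))))).
have d3 := is_derive_mulcl (4 * (e == i)%:R) (is_derive_mul (is_derive_T 2 x (e_ i))
  (is_derive_quad x (e_ i))).
have d4 := is_derive_mulcl 8 (is_derive_mul (is_derive_T 2 x (e_ i))
  (is_derive_mul (is_derive_relc e x (e_ i)) (is_derive_lin i x (e_ i)))).
apply: (is_derive_eq (is_derive_add (is_derive_add (is_derive_add (is_derive_add d0 d1) d2) d3) d4)).
rewrite /quadrupole_hess {d0 d1 d2 d3 d4} !mxE.
move: (T 1 (dsq y x)) (T 2 (dsq y x)) (T 3 (dsq y x)) (T 4 (dsq y x)) (quad_form x) => T1 T2 T3 T4 N.
elim/ord3P: i => /=; ring.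
Qed.

(** The hypotheses are those satisfied by the derivatives of s^(-3/2), for which
    z_e T_0(|z|^2) is harmonic, and so are its derivatives. *)
Lemma quadrupole_hess_sum x : 0 < dsq y x ->
  dsq y x * T 3 (dsq y x) = - (7 / 2) * T 2 (dsq y x) ->
  dsq y x * T 4 (dsq y x) = - (9 / 2) * T 3 (dsq y x) ->
  \sum_i quadrupole_hess i x = 0.
Proof.
(* Up to the common factor kk, T_4 = 63, T_3 = - 14 s and T_2 = 4 s^2, which
   makes the sum a polynomial identity. *)
move=> s0 h3 h4; pose kk := T 4 (dsq y x) / 63.
have E4 : T 4 (dsq y x) = 63 * kk by rewrite /kk; field.
have E3 : T 3 (dsq y x) = - (14 * dsq y x * kk).
  have -> : T 3 (dsq y x) = - (2 / 9) * (dsq y x * T 4 (dsq y x)).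
    by rewrite h4; field.
  by rewrite /kk; field.
have E2 : T 2 (dsq y x) = 4 * dsq y x * dsq y x * kk.
  have -> : T 2 (dsq y x) = - (2 / 7) * (dsq y x * T 3 (dsq y x)).
    by rewrite h3; field.
  by rewrite E3; field.
rewrite sum3 /quadrupole_hess E4 E3 E2.
have -> : dsq y x = relc o0 x * relc o0 x + relc o1 x * relc o1 x + relc o2 x * relc o2 x.
  by rewrite /dsq sum3 !expr2.
rewrite /quad_form /lin_form (Ms o1 o0) (Ms o2 o0) (Ms o2 o1) M22.
move: kk {E4 E3 E2 h3 h4} => kk.
by elim/ord3P: e => /=; rewrite ?(Ms o1 o0) ?(Ms o2 o0) ?(Ms o2 o1) ?M22; ring.
Qed.

Lemma pd_pd_fieldE i j x :
  pd j (pd i (field (T 0) y e)) x =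
  relc e x * (T 1 (dsq y x) * (2 * (i == j)%:R) +
              2 * relc i x * (T 2 (dsq y x) * (2 * relc j x))) +
  T 1 (dsq y x) * (2 * relc i x) * (e == j)%:R +
  (e == i)%:R * (T 1 (dsq y x) * (2 * relc j x)).
Proof.
have deq k n z : 'D_(e_ k) (fun x => T n (dsq y x)) z = T n.+1 (dsq y z) * (2 * relc k z).
  have [_ ->] := is_derive_T n z (e_ k); congr (_ * (2 * _)).
  by rewrite !mxE; elim/ord3P: k => /=; ring.
have dT' n k z : is_derive z (e_ k) (fun x => T n (dsq y x)) (T n.+1 (dsq y z) * (2 * relc k z)).
  by have [d0 _] := is_derive_T n z (e_ k); apply: DeriveDef.
have dr l k z : is_derive z (e_ k) (relc l) (l == k)%:R.
  by apply: (is_derive_eq (is_derive_relc l z (e_ k))); rewrite mxE eqxx.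
have -> : pd i (field (T 0) y e) = (fun x => relc e x * (T 1 (dsq y x) * (2 * relc i x)) +
    (e == i)%:R * T 0 (dsq y x)).
  apply: pdE => z; apply: (is_derive_eq (is_derive_mul (dr e i z) (dT' 0 i z))).
  by congr (_ + _); rewrite mulrC.
have d := is_derive_add
  (is_derive_mul (dr e j x) (is_derive_mul (dT' 1 j x) (is_derive_mulcl 2 (dr i j x))))
  (is_derive_mulcl (e == i)%:R (dT' 0 j x)).
have [_] := d; rewrite /pd => ->; ring.
Qed.

Lemma quadrupoleE x :
  \sum_i \sum_j M i j * pd j (pd i (field (T 0) y e)) x = quadrupole x.
Proof.
under eq_bigr => i _ do under eq_bigr => j _ do rewrite pd_pd_fieldE.
rewrite !sum3 /quadrupole /quad_form /lin_form (Ms o1 o0) (Ms o2 o0) (Ms o2 o1) M22.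
move: (T 1 (dsq y x)) (T 2 (dsq y x)) => T1 T2.
by elim/ord3P: e => /=; rewrite ?(Ms o1 o0) ?(Ms o2 o0) ?(Ms o2 o1) ?M22; ring.
Qed.

End Quadrupole.

(** * The pairing of a source with a dipole field *)

Section SourcePairing.
Context (R : realType).
Implicit Types (x v P y : 'rV[R]_3) (i j e : 'I_3) (s a r d : R) (n k : nat).
Local Notation e_ i := (delta_mx 0 i : 'rV[R]_3).

Definition kern_tower a r n : R -> R :=
  iter n (fun h s => 'D_1 h s) (kern a r).

Lemma C1d_kern_tower a r n k : 0 < a -> C1d k (kern_tower a r n).
Proof.
by move=> a0; elim: n k => [|n IH] k; [exact: C1d_kern|exact: (C1d_derive (IH k.+1))].
Qed.

Lemma is_derive_kern_tower a r n s : 0 < a ->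
  is_derive s 1 (kern_tower a r n) (kern_tower a r n.+1 s).
Proof. by move=> a0; exact: (C1d_is_derive (C1d_kern_tower r n 1 a0)). Qed.

(** Differentiate the relation s f0' = c f0. *)
Lemma homogeneous_derive (f0 f1 f2 : R -> R) (a b c : R) :
  (forall s, is_derive s 1 f0 (f1 s)) -> (forall s, is_derive s 1 f1 (f2 s)) ->
  (forall s, a < s -> s < b -> s * f1 s = c * f0 s) ->
  forall s, a < s -> s < b -> s * f2 s = (c - 1) * f1 s.
Proof.
move=> d0 d1 h s as1 sb.
have [_ e1] := is_derive_mul (is_derive_id s 1) (d1 s).
have [_ e2] := is_derive_mulcl c (d0 s).
have E : 'D_1 (fun t : R => t * f1 t) s = 'D_1 (fun t : R => c * f0 t) s.
  apply: near_eq_derive; near=> t; apply: h; near: t; [exact: lt_nbhsr|exact: lt_nbhsl].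
have : s * f2 s + f1 s * 1 = c * f1 s by rewrite -e1 -e2.
by rewrite mulr1 mulrBl mul1r => <-; rewrite addrK.
Unshelve. all: by end_near. Qed.

Lemma kern_tower_homogeneous a r n s : 0 < a -> 0 < r -> a < s -> s < r ^+ 2 ->
  s * kern_tower a r n.+1 s = (- (3 / 2) - n%:R) * kern_tower a r n s.
Proof.
move=> a0 r0; elim: n s => [|n IH] s as1 sr.
  have s0 : 0 < s := lt_trans a0 as1.
  rewrite subr0 /= (_ : 'D_1 (kern a r) s = - (3 / 2) * pow32 s / s).
    rewrite kern_mid// ?(ltW as1) ?(ltW sr)//; field; by rewrite gt_eqF.
  have [_ <-] := is_derive_pow32 s0.
  apply: near_eq_derive; near=> t; rewrite kern_mid//.
  have at1 : a < t by near: t; exact: lt_nbhsr.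
  have tr : t < r ^+ 2 by near: t; exact: lt_nbhsl.
  by rewrite !ltW.
rewrite (homogeneous_derive (fun t => is_derive_kern_tower r n t a0)
  (fun t => is_derive_kern_tower r n.+1 t a0) (fun t h1 h2 => IH t h1 h2) as1 sr).
by rewrite -natr1; ring.
Unshelve. all: by end_near. Qed.

(** Integrating by parts moves the gradient contained in the source onto the
    dipole field; the mean value property then evaluates the result at P, where
    the contracted second derivatives are harmonic. *)
Lemma source_pairing (q : R -> R) (M : 'M[R]_3) P y e a r d :
  Ck 1 (fun x : 'rV[R]_3 => q (enorm x)) -> box_supported (fun x => q (enorm x)) ->
  Int3 setT (fun x => q (enorm x)) = 1 ->
  0 <= d -> (forall s, d < s -> q s = 0) -> M^T = M -> \tr M = 0 ->
  0 < a -> 0 < r -> (forall x, dsq P x <= d ^+ 2 -> a < dsq y x < r ^+ 2) ->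
  \sum_i Int3 setT (fun x => source q M P x 0 i * pd i (field (kern a r) y e) x) =
  quadrupole M y e (kern_tower a r) P.
Proof.
move=> Cq bq q1 d0 q0 Msym Mtr a0 r0 hnear.
have mT := mset_open (@openT 'rV[R]_3).
pose T := kern_tower a r.
have dT n s : is_derive s 1 (T n) (T n.+1 s) by exact: is_derive_kern_tower.
have CT n k : C1d k (T n) by exact: C1d_kern_tower.
pose QP x := q (enorm (x - P)).
have cQP : continuous QP := @cont_translate R _ P (Ck_cont Cq).
have dQP j x : is_derive x (e_ j) QP (pd j (fun x => q (enorm x)) (x - P)).
  exact: (is_derive_translate (Ck_is_derive j Cq (x - P))).
have pdQP j : pd j QP = (fun x => pd j (fun x => q (enorm x)) (x - P)).
  by apply: pdE => x; exact: dQP.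
have cpQP j : continuous (pd j QP).
  by rewrite pdQP; apply: (@cont_translate R _ P); exact: (Ck_cont (Ck_pd j Cq)).
have bQP : box_supported QP := box_translate P bq.
have bM (f g : 'rV[R]_3 -> R) : box_supported g -> box_supported (fun x => f x * g x).
  by case=> L gL; exists L => x /gL ->; rewrite mulr0.
have Cphi k : Ck k (field (T 0) y e) by apply: Ck_field; exact: (CT 0).
have c1 i : continuous (pd i (field (T 0) y e)) := Ck_cont (Ck_pd i (Cphi 1)).
have c2 i j : continuous (pd j (pd i (field (T 0) y e))) :=
  Ck_cont (Ck_pd j (Ck_pd i (Cphi 2))).
have byp (i j : 'I_3) : Int3 setT (fun x => pd i (field (T 0) y e) x * pd j QP x) =
    - Int3 setT (fun x => pd j (pd i (field (T 0) y e)) x * QP x).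
  apply: (@Int3_by_parts R j) => //.
  exact: (Ck_is_derive j (Ck_pd i (Cphi 2))).
have bpQP j : box_supported (pd j QP).
  by rewrite pdQP; apply: (box_supported_deriv (dQP j) bQP).
have S1 i j : summable setT (fun x => pd i (field (T 0) y e) x * pd j QP x).
  by apply: summable_cc => //; [exact: cont_mul|exact: bM].
have S2 i j : summable setT (fun x => pd j (pd i (field (T 0) y e)) x * QP x).
  by apply: summable_cc => //; [exact: cont_mul|exact: bM].
have term i : Int3 setT (fun x => source q M P x 0 i * pd i (field (T 0) y e) x) =
    Int3 setT (fun x => \sum_j M i j * (pd j (pd i (field (T 0) y e)) x * QP x)).
  have -> : (fun x => source q M P x 0 i * pd i (field (T 0) y e) x) =
      (fun x => \sum_j - M i j * (pd i (field (T 0) y e) x * pd j QP x)).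
    apply/funext => x; rewrite mxE mulNr mulr_suml -sumrN; apply: eq_bigr => j _.
    by rewrite -/QP; ring.
  rewrite (Int3_sum _ mT (fun j => summableZ _ mT (S1 i j))).
  rewrite (Int3_sum _ mT (fun j => summableZ _ mT (S2 i j))).
  apply: eq_bigr => j _; rewrite (Int3Z _ mT (S1 i j)) (Int3Z _ mT (S2 i j)) byp.
  by rewrite mulrNN.
rewrite (eq_bigr _ (fun i _ => term i)) -(Int3_sum _ mT); last first.
  by move=> i; apply: summable_sum => // j; exact: summableZ.
have -> : (fun x => \sum_i \sum_j M i j * (pd j (pd i (field (T 0) y e)) x * QP x)) =
    (fun x => QP x * quadrupole M y e T x).
  apply/funext => x; rewrite -(@quadrupoleE R M y e T Msym Mtr dT) mulr_sumr.
  apply: eq_bigr => i _; rewrite mulr_sumr; apply: eq_bigr => j _; ring.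
have cz i : continuous (relc y i) := Ck_cont (Ck_coordB 0 y i).
have cT n : continuous (fun x => T n (dsq y x)) := Ck_cont (Ck_radial y (CT n 0%N)).
have cc (c : R) : continuous (fun _ : 'rV[R]_3 => c) by move=> x; exact: cst_continuous.
have cL (i : 'I_3) : continuous (lin_form M y i).
  exact: (cont_add (cont_add (cont_mul (cc (M i o0)) (cz o0)) (cont_mul (cc (M i o1)) (cz o1)))
    (cont_mul (cc (M i o2)) (cz o2))).
have cN : continuous (quad_form M y).
  exact: (cont_add (cont_add (cont_mul (cz o0) (cL o0)) (cont_mul (cz o1) (cL o1)))
    (cont_mul (cz o2) (cL o2))).
rewrite -[RHS]mulr1 -q1; apply: (@mean_value R q P d (quadrupole M y e T)
  (quadrupole_grad M y e T) (quadrupole_hess M y e T)) => //.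
- by move=> x v; apply: quadrupoleP => //; exact: dT.
- exact:
  (cont_add (cont_mul (cc (4)) (cont_mul (cT 1) (cL e))) (cont_mul (cc (4)) (cont_mul
    (cT 2) (cont_mul (cz e) cN)))).
- move=> i; exact:
  (cont_add (cont_add (cont_add (cont_add (cont_mul (cc (8)) (cont_mul (cT 2)
    (cont_mul (cz i) (cL e)))) (cont_mul (cc (4 * M e i)) (cT 1))) (cont_mul (cc (8))
    (cont_mul (cT 3) (cont_mul (cz i) (cont_mul (cz e) cN))))) (cont_mul (cc (4 * (e
    == i)%:R)) (cont_mul (cT 2) cN))) (cont_mul (cc (8)) (cont_mul (cT 2) (cont_mul
    (cz e) (cL i))))).
- move=> i; exact:
  (cont_add (cont_add (cont_add (cont_add (cont_mul (cc (8)) (cont_add (cont_mul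
    (cont_mul (cT 3) (cont_mul (cc (2)) (cz i))) (cont_mul (cz i) (cL e))) (cont_mul
    (cT 2) (cont_add (cL e) (cont_mul (cz i) (cc (M e i))))))) (cont_mul (cc (4 * M e
    i)) (cont_mul (cT 2) (cont_mul (cc (2)) (cz i))))) (cont_mul (cc (8)) (cont_add
    (cont_mul (cont_mul (cT 4) (cont_mul (cc (2)) (cz i))) (cont_mul (cz i) (cont_mul
    (cz e) cN))) (cont_mul (cT 3) (cont_add (cont_mul (cz e) cN) (cont_mul (cz i)
    (cont_add (cont_mul (cc ((e == i)%:R)) cN) (cont_mul (cz e) (cont_mul (cc (2)) (cL
    i)))))))))) (cont_mul (cc (4 * (e == i)%:R)) (cont_add (cont_mul (cont_mul (cT 3)
    (cont_mul (cc (2)) (cz i))) cN) (cont_mul (cT 2) (cont_mul (cc (2)) (cL i))))))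
    (cont_mul (cc (8)) (cont_add (cont_mul (cont_mul (cT 3) (cont_mul (cc (2)) (cz
    i))) (cont_mul (cz e) (cL i))) (cont_mul (cT 2) (cont_add (cont_mul (cc ((e ==
    i)%:R)) (cL i)) (cont_mul (cz e) (cc (M i i)))))))).
- by move=> i x; apply: quadrupole_gradP => //; exact: dT.
- move=> x xd; have /andP[h1 h2] := hnear x xd.
  apply: (quadrupole_hess_sum _ Msym Mtr); first exact: lt_trans h1.
  + rewrite (kern_tower_homogeneous 2 a0 r0 h1 h2); congr (_ * _); lra.
  + rewrite (kern_tower_homogeneous 3 a0 r0 h1 h2); congr (_ * _); lra.
Qed.

Lemma quadrupole_kern (M : 'M[R]_3) P y e a r : 0 < a -> 0 < r ->
  a < dsq y P < r ^+ 2 ->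
  quadrupole M y e (kern_tower a r) P =
  3 * pow32 (dsq y P) * (5 * relc y e P * quad_form M y P / dsq y P ^+ 2 -
                         2 * lin_form M y e P / dsq y P).
Proof.
move=> a0 r0 /andP[h1 h2]; rewrite /quadrupole.
have s0 : 0 < dsq y P := lt_trans a0 h1.
have e0 : kern_tower a r 0 (dsq y P) = pow32 (dsq y P).
  by rewrite /= kern_mid// ?(ltW h1) ?(ltW h2).
have := kern_tower_homogeneous 0 a0 r0 h1 h2.
have := kern_tower_homogeneous 1 a0 r0 h1 h2; rewrite e0.
move: (kern_tower a r 1 (dsq y P)) (kern_tower a r 2 (dsq y P)) (pow32 _) => t1 t2 p H2 H1.
have -> : t2 = (- (3 / 2) - 1%:R) * t1 / dsq y P by rewrite -H2; field; rewrite gt_eqF.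
have -> : t1 = (- (3 / 2) - 0%:R) * p / dsq y P by rewrite -H1; field; rewrite gt_eqF.
by field; rewrite gt_eqF.
Qed.

End SourcePairing.

(** * Potentials along a line *)

Section LineUniqueness.
Context (R : realType).
Implicit Types (x v y w P : 'rV[R]_3) (M : 'M[R]_3) (p : {poly R}) (s d : R).

(** The points d / (k + 2) are infinitely many roots. *)
Lemma poly_eq0_on_interval p (d : R) : 0 < d ->
  (forall t, 0 < t < d -> p.[t] = 0) -> p = 0.
Proof.
move=> d0 p0; pose rs := [seq d / k.+2%:R | k <- iota 0 (size p)].
apply: (@roots_geq_poly_eq0 _ p rs).
- apply/allP => _ /mapP[k _ ->]; rewrite rootE p0// divr_gt0//=.
  by rewrite ltr_pdivrMr// ltr_pMr// ltr1n.
- rewrite map_inj_uniq ?iota_uniq// => i j /(mulfI (lt0r_neq0 d0))/invr_inj/eqP.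
  by rewrite eqr_nat => /eqP[].
- by rewrite size_map size_iota.
Qed.

Lemma poly_eq_on_interval (p q : {poly R}) (d : R) : 0 < d ->
  (forall t, 0 < t < d -> p.[t] = q.[t]) -> p = q.
Proof.
move=> d0 pq; apply/eqP; rewrite -subr_eq0; apply/eqP.
by apply: (@poly_eq0_on_interval _ d) => // t h; rewrite hornerD hornerN pq// subrr.
Qed.

Definition qform M (z0 z1 z2 : {poly R}) : {poly R} :=
  z0 * ((M o0 o0)%:P * z0 + (M o0 o1)%:P * z1 + (M o0 o2)%:P * z2) +
  z1 * ((M o1 o0)%:P * z0 + (M o1 o1)%:P * z1 + (M o1 o2)%:P * z2) +
  z2 * ((M o2 o0)%:P * z0 + (M o2 o1)%:P * z1 + (M o2 o2)%:P * z2).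

(** Coordinate [i] of P - (y + t v), as a polynomial in t. *)
Definition line_coord P y v i : {poly R} := (P 0 i - y 0 i)%:P - (v 0 i)%:P * 'X.

Definition quad_line M P y v : {poly R} :=
  qform M (line_coord P y v o0) (line_coord P y v o1) (line_coord P y v o2).

Definition dist_line P y v : {poly R} := quad_line 1%:M P y v.

Lemma line_coordE P y v i t : (line_coord P y v i).[t] = relc (y + t *: v) i P.
Proof. by rewrite /line_coord !hornerE /relc !mxE; ring. Qed.

Lemma qformE M z0 z1 z2 t : (qform M z0 z1 z2).[t] =
  z0.[t] * (M o0 o0 * z0.[t] + M o0 o1 * z1.[t] + M o0 o2 * z2.[t]) +
  z1.[t] * (M o1 o0 * z0.[t] + M o1 o1 * z1.[t] + M o1 o2 * z2.[t]) +
  z2.[t] * (M o2 o0 * z0.[t] + M o2 o1 * z1.[t] + M o2 o2 * z2.[t]).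
Proof. by rewrite /qform !(hornerD, hornerM, hornerC). Qed.

Lemma quad_lineE M P y v t : (quad_line M P y v).[t] = quad_form M (y + t *: v) P.
Proof. by rewrite qformE !line_coordE. Qed.

Lemma quad_form1 y P : quad_form 1%:M y P = dsq y P.
Proof. by rewrite /quad_form /lin_form /dsq sum3 !mxE /= /relc; ring. Qed.

Lemma dist_lineE P y v t : (dist_line P y v).[t] = dsq (y + t *: v) P.
Proof. by rewrite quad_lineE quad_form1. Qed.

Lemma size_addp (p p' : {poly R}) n :
  (size p <= n)%N -> (size p' <= n)%N -> (size (p + p')%R <= n)%N.
Proof. by move=> hp hq; rewrite (leq_trans (size_polyD _ _))// geq_max hp. Qed.

Lemma size_mulp (p p' : {poly R}) m n :
  (size p <= m.+1)%N -> (size p' <= n.+1)%N -> (size (p * p')%R <= (m + n).+1)%N.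
Proof.
move=> hp hq; rewrite (leq_trans (size_polyMleq _ _))//.
rewrite -subn1 leq_subLR add1n (leq_trans (leq_add hp hq))//.
by rewrite addSn addnS.
Qed.

Lemma size_expp (p : {poly R}) m n :
  (size p <= m.+1)%N -> (size (p ^+ n)%R <= (n * m).+1)%N.
Proof.
move=> hp; elim: n => [|n IH]; first by rewrite expr0 size_polyC oner_neq0.
by rewrite exprS mulSn size_mulp.
Qed.

Lemma size_quad_line M P y v : (size (quad_line M P y v) <= 3)%N.
Proof.
have sz i : (size (line_coord P y v i) <= 2)%N.
  rewrite (leq_trans (size_polyD _ _))// geq_max size_polyN.
  rewrite (leq_trans (size_polyC_leq1 _))//=.
  by rewrite mul_polyC (leq_trans (size_scale_leq _ _))// size_polyX.
have szC (c : R) i : (size (c%:P * line_coord P y v i)%R <= 2)%N.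
  by rewrite mul_polyC (leq_trans (size_scale_leq _ _)).
by do 2?apply: size_addp; apply: (@size_mulp _ _ 1 1) => //; do 2?apply: size_addp.
Qed.

Lemma size_dist_line P y v : v != 0 -> size (dist_line P y v) = 3%N.
Proof.
move=> v0; apply/eqP; rewrite eqn_leq size_quad_line /=.
have c2 : (dist_line P y v)`_2 = v 0 o0 ^+ 2 + v 0 o1 ^+ 2 + v 0 o2 ^+ 2.
  have sq c c' : ((c%:P - c'%:P * 'X) * (c%:P - c'%:P * 'X) : {poly R})`_2 = c' ^+ 2.
    have -> : (c%:P - c'%:P * 'X) * (c%:P - c'%:P * 'X) =
        (c ^+ 2)%:P - (2 * c * c')%:P * 'X + (c' ^+ 2)%:P * 'X^2 :> {poly R}.
      by rewrite !(polyCM, rmorphXn) /=; ring.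
    by rewrite !coefD coefN !coefCM coefXn coefX coefC /= mulr0 subr0 add0r mulr1.
  rewrite /dist_line /quad_line /qform !mxE /= !mulr1n !mulr0n.
  rewrite !mul0r !mul1r !addr0 !add0r !coefD.
  by rewrite /line_coord !sq.
rewrite ltnNge; apply/negP => h.
have : (dist_line P y v)`_2 = 0 by rewrite nth_default.
rewrite c2 => /eqP; rewrite paddr_eq0 ?addr_ge0 ?sqr_ge0// paddr_eq0 ?sqr_ge0//.
rewrite !sqrf_eq0 => /andP[/andP[/eqP h0 /eqP h1] /eqP h2].
by move/eqP: v0; apply; apply/rowP; elim/ord3P; rewrite mxE.
Qed.

(** [pow32 s / s] is s^(-5/2). *)
Lemma pow52_sqr s : 0 < s -> (pow32 s / s) ^+ 2 * s ^+ 5 = 1.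
Proof.
move=> s0; have e : pow32 s ^+ 2 * s ^+ 3 = 1.
  rewrite /pow32 -{2}[s]lnK ?posrE// -!expRM_natl -expRD -[RHS]expR0.
  by congr expR; rewrite mulrA -mulrDl; apply/eqP; rewrite mulf_eq0; apply/orP; left; apply/eqP; field.
have -> : (pow32 s / s) ^+ 2 * s ^+ 5 = pow32 s ^+ 2 * s ^+ 3 by field; rewrite gt_eqF.
exact: e.
Qed.

Lemma pow52_gt0 s : 0 < s -> 0 < pow32 s / s.
Proof. by move=> s0; rewrite divr_gt0// expR_gt0. Qed.

(** Let X = A1 s1^(-5/2) and Y = A2 s2^(-5/2). From X - Y = k follows
    (X^2 - k^2 - Y^2)^2 = 4 k^2 Y^2, and multiplying by (s1 s2)^10 leaves
    polynomials only. If k <> 0, the left side has degree 40 and the right side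
    degree at most 34. *)
Lemma potentials_agree (A1 A2 s1 s2 : {poly R}) (k d : R) : 0 < d ->
  (size A1 <= 3)%N -> (size A2 <= 3)%N -> size s1 = 3%N -> size s2 = 3%N ->
  (forall t, 0 < t < d -> 0 < s1.[t]) -> (forall t, 0 < t < d -> 0 < s2.[t]) ->
  (forall t, 0 < t < d -> A1.[t] * (pow32 s1.[t] / s1.[t]) -
                          A2.[t] * (pow32 s2.[t] / s2.[t]) = k) ->
  k = 0 /\ A1 ^+ 2 * s2 ^+ 5 = A2 ^+ 2 * s1 ^+ 5.
Proof.
move=> d0 zA1 zA2 z1 z2 s1p s2p hk.
have key : (A1 ^+ 2 * s2 ^+ 5 - k%:P ^+ 2 * (s1 ^+ 5 * s2 ^+ 5) - A2 ^+ 2 * s1 ^+ 5) ^+ 2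
    = (4 * k ^+ 2)%:P * (A2 ^+ 2 * (s1 ^+ 10 * s2 ^+ 5)).
  apply: (poly_eq_on_interval d0) => t ht.
  have := hk t ht; have := pow52_sqr (s1p t ht); have := pow52_sqr (s2p t ht).
  rewrite !(hornerD, hornerN, hornerM, hornerC, horner_exp).
  move: (pow32 s1.[t] / _) (pow32 s2.[t] / _) => g1 g2 e2 e1 e3.
  have e4 : A1.[t] * g1 = k + A2.[t] * g2 by rewrite -e3 subrK.
  have -> : A1.[t] ^+ 2 * s2.[t] ^+ 5 = (A1.[t] * g1) ^+ 2 * (s1.[t] ^+ 5 * s2.[t] ^+ 5).
    by rewrite -[LHS]mulr1 -e1; ring.
  have -> : A2.[t] ^+ 2 * s1.[t] ^+ 5 = (A2.[t] * g2) ^+ 2 * (s1.[t] ^+ 5 * s2.[t] ^+ 5).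
    by rewrite -[LHS]mulr1 -e2; ring.
  have -> : 4 * k ^+ 2 * (A2.[t] ^+ 2 * (s1.[t] ^+ 10 * s2.[t] ^+ 5)) =
     4 * k ^+ 2 * (A2.[t] * g2) ^+ 2 * (s1.[t] ^+ 5 * s2.[t] ^+ 5) ^+ 2.
    by rewrite -[LHS]mulr1 -e2; ring.
  by rewrite e4; ring.
have s1n0 : s1 != 0 by rewrite -size_poly_eq0 z1.
have s2n0 : s2 != 0 by rewrite -size_poly_eq0 z2.
have k0 : k = 0.
  apply/eqP; apply/negPn/negP => kn0.
  have zX (p : {poly R}) n : p != 0 -> size p = 3%N -> size (p ^+ n) = (n * 2).+1.
    move=> p0 zp; have := size_exp p n; rewrite zp => e.
    have h : (0 < size (p ^+ n)%R)%N by rewrite lt0n size_poly_eq0 expf_neq0.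
    by rewrite -(prednK h) e mulnC.
  have zk : size (k%:P ^+ 2 * (s1 ^+ 5 * s2 ^+ 5)) = 21%N.
    by rewrite -rmorphXn /= mul_polyC size_scale ?expf_neq0// size_mul ?expf_neq0// !zX.
  have zA (p s : {poly R}) : (size p <= 3)%N -> size s = 3%N -> (size (p ^+ 2 * s ^+ 5)%R <= 15)%N.
    move=> hp hs; apply: (@size_mulp _ _ 4 10); first exact: (@size_expp _ 2 2).
    by apply: (@size_expp _ 2 5); rewrite hs.
  have zL : size (A1 ^+ 2 * s2 ^+ 5 - k%:P ^+ 2 * (s1 ^+ 5 * s2 ^+ 5) - A2 ^+ 2 * s1 ^+ 5) = 21%N.
    have zl : size (A1 ^+ 2 * s2 ^+ 5 - k%:P ^+ 2 * (s1 ^+ 5 * s2 ^+ 5)) = 21%N.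
      by rewrite addrC size_polyDl ?size_polyN zk// ltnS (leq_trans (zA _ _ zA1 z2)).
    by rewrite size_polyDl zl// size_polyN ltnS (leq_trans (zA _ _ zA2 z1)).
  have : (size ((4 * k ^+ 2)%:P * (A2 ^+ 2 * (s1 ^+ 10 * s2 ^+ 5)))%R <= 35)%N.
    rewrite mul_polyC (leq_trans (size_scale_leq _ _))//.
    apply: (@size_mulp _ _ 4 30); first exact: (@size_expp _ 2 2).
    by apply: (@size_mulp _ _ 20 10); [apply: (@size_expp _ 2 10); rewrite z1|apply: (@size_expp _ 2 5); rewrite z2].
  by rewrite -key expr2 size_mul -?size_poly_eq0 zL.
split=> //; move: key; rewrite k0 polyC0 !expr0n /= !mulr0 polyC0 !mul0r subr0.
by move=> /eqP; rewrite expf_eq0 /= subr_eq0 => /eqP.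
Qed.

End LineUniqueness.

(** * A moment is determined by its field *)

Section MomentUniqueness.
Context (R : realType).
Implicit Types (x v y w P : 'rV[R]_3) (M : 'M[R]_3) (s t d : R).
Local Notation e_ i := (delta_mx 0 i : 'rV[R]_3).

Definition moment_field M P y e : R :=
  pow32 (dsq y P) * (5 * relc y e P * quad_form M y P / dsq y P ^+ 2 -
                     2 * lin_form M y e P / dsq y P).

(** z^T M z / |z|^5 with z = P - y. *)
Definition moment_potential M P y : R :=
  quad_form M y P * (pow32 (dsq y P) / dsq y P).

Lemma is_derive_pow52 s : 0 < s ->
  is_derive s 1 (fun s => pow32 s / s) (- (5 / 2) * pow32 s / s ^+ 2).
Proof.
move=> s0; have d1 := is_derive_pow32 s0.
have d2 : is_derive s (1 : R) (fun s : R => s^-1) (- s ^- 2).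
  have := @is_deriveV _ id s 1 1 (lt0r_neq0 s0) (is_derive_id s 1).
  by rewrite /GRing.scale /= mulr1.
apply: (is_derive_eq (is_derive_mul d1 d2)).
by field; rewrite gt_eqF.
Qed.

Lemma is_derive_moment_potential M P y v t : M^T = M -> 0 < dsq (y + t *: v) P ->
  is_derive t (1 : R) (fun t => moment_potential M P (y + t *: v))
    (v 0 o0 * moment_field M P (y + t *: v) o0 + v 0 o1 * moment_field M P (y + t *: v) o1 +
     v 0 o2 * moment_field M P (y + t *: v) o2).
Proof.
move=> Ms s0.
have Mij i j : M i j = M j i by rewrite -[in LHS]Ms mxE.
pose c i := P 0 i - y 0 i.
have relE i u : relc (y + u *: v) i P = c i - u * v 0 i.
  by rewrite /relc /c !mxE opprD addrA.
pose z i u := c i - u * v 0 i.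
have dz i : is_derive t (1 : R) (z i) (- v 0 i).
  have d1 := is_derive_sub (is_derive_const (c i) t 1)
    (is_derive_mul (is_derive_id t (1 : R)) (is_derive_const (v 0 i) t 1)).
  by apply: (is_derive_eq d1); ring.
pose l k u := M k o0 * z o0 u + M k o1 * z o1 u + M k o2 * z o2 u.
have dl k : is_derive t (1 : R) (l k) (- (M k o0 * v 0 o0 + M k o1 * v 0 o1 + M k o2 * v 0 o2)).
  have d1 := is_derive_add (is_derive_add (is_derive_mulcl (M k o0) (dz o0))
    (is_derive_mulcl (M k o1) (dz o1))) (is_derive_mulcl (M k o2) (dz o2)).
  by apply: (is_derive_eq d1); ring.
pose N u := z o0 u * l o0 u + z o1 u * l o1 u + z o2 u * l o2 u.
have dN := is_derive_add (is_derive_add (is_derive_mul (dz o0) (dl o0))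
  (is_derive_mul (dz o1) (dl o1))) (is_derive_mul (dz o2) (dl o2)).
pose D u := z o0 u * z o0 u + z o1 u * z o1 u + z o2 u * z o2 u.
have dD := is_derive_add (is_derive_add (is_derive_mul (dz o0) (dz o0))
  (is_derive_mul (dz o1) (dz o1))) (is_derive_mul (dz o2) (dz o2)).
have DE u : dsq (y + u *: v) P = D u.
  by rewrite -quad_form1 /quad_form /lin_form !mxE /= !relE /D /z; ring.
have NE u : quad_form M (y + u *: v) P = N u.
  by rewrite /quad_form /lin_form !relE.
rewrite (_ : (fun u => moment_potential M P (y + u *: v)) =
  (fun u => N u * (pow32 (D u) / D u))); last first.
  by apply/funext => u; rewrite /moment_potential NE DE.
rewrite DE in s0.
have dg := is_derive_pow52 s0.
have d1 := is_derive_mul dN (is_derive_chain dD dg).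
apply: (is_derive_eq d1).
rewrite /moment_field DE NE /lin_form !relE -/(D t) -/(N t).
rewrite -!/(z _ t).
have sn0 : D t != 0 by rewrite gt_eqF.
move: (pow32 (D t)) (N t) (D t) sn0 => p n s sn0.
rewrite /l (Mij o1 o0) (Mij o2 o0) (Mij o2 o1).
move: (z o0 t) (z o1 t) (z o2 t) (v 0 o0) (v 0 o1) (v 0 o2) => z0 z1 z2 v0 v1 v2.
by field.
Qed.

Lemma enormZ (t : R) v : enorm (t *: v) = `|t| * enorm v.
Proof.
rewrite /enorm -sqrtr_sqr -sqrtrM ?sqr_ge0//; congr Num.sqrt.
by rewrite mulr_sumr; apply: eq_bigr => i _; rewrite mxE exprMn.
Qed.

Lemma dsq_eq0 y x : dsq y x = 0 -> y = x.
Proof.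
rewrite /dsq sum3 => /eqP; rewrite paddr_eq0 ?addr_ge0 ?sqr_ge0// paddr_eq0 ?sqr_ge0//.
rewrite !sqrf_eq0 !subr_eq0 => /andP[/andP[/eqP h0 /eqP h1] /eqP h2].
by apply/rowP; elim/ord3P; rewrite ?h0 ?h1 ?h2.
Qed.

Lemma horner_sq5 (p p' : {poly R}) t :
  (p ^+ 2 * p' ^+ 5).[t] = p.[t] ^+ 2 * p'.[t] ^+ 5.
Proof. by rewrite hornerM !horner_exp. Qed.

(** Polarization on the vectors e_i and e_i + e_j. *)
Lemma quad_form_eq0 M : M^T = M -> (forall w, quad_form M 0 w = 0) -> M = 0.
Proof.
move=> Ms q0; have Mij i j : M i j = M j i by rewrite -[in LHS]Ms mxE.
have qw (a b c : R) : a * (M o0 o0 * a + M o0 o1 * b + M o0 o2 * c) +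
    b * (M o1 o0 * a + M o1 o1 * b + M o1 o2 * c) +
    c * (M o2 o0 * a + M o2 o1 * b + M o2 o2 * c) = 0.
  have := q0 (vec3 (a, b, c)).
  by rewrite /quad_form /lin_form /relc !mxE /= !subr0.
have := qw 1 0 0; have := qw 0 1 0; have := qw 0 0 1.
have := qw 1 1 0; have := qw 1 0 1; have := qw 0 1 1.
rewrite (Mij o1 o0) (Mij o2 o0) (Mij o2 o1) => h1 h2 h3 h4 h5 h6.
apply/matrixP => i j; rewrite mxE; move: i j.
by elim/ord3P; elim/ord3P; rewrite ?(Mij o1 o0) ?(Mij o2 o0) ?(Mij o2 o1); lra.
Qed.

Context (M1 M2 : 'M[R]_3) (P1 P2 y0 : 'rV[R]_3) (rho : R).
Context (M1s : M1^T = M1) (M2s : M2^T = M2) (rho0 : 0 < rho).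
Context (same_field : forall y, eball y0 rho y ->
  [/\ 0 < dsq y P1, 0 < dsq y P2 &
      forall e, moment_field M1 P1 y e = moment_field M2 P2 y e]).

(** How far one may move along v inside the ball; the summand 1 covers v = 0. *)
Let reach v : R := rho / (1 + enorm v).

Let reach_gt0 v : 0 < reach v.
Proof. by rewrite divr_gt0// ltr_pwDl// sqrtr_ge0. Qed.

Let reachP v t : 0 <= t -> t < reach v -> eball y0 rho (y0 + t *: v).
Proof.
move=> t0 tv; rewrite /eball /= addrAC subrr add0r enormZ ger0_norm//.
have n0 : 0 <= enorm v by exact: sqrtr_ge0.
move: tv; rewrite /reach ltr_pdivlMr ?ltr_pwDl// => h.
by apply: le_lt_trans h; rewrite mulrDr mulr1 lerDr.
Qed.

(** Both potentials have the same derivative along the segment. *)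
Lemma moment_potential_gap v t : 0 < t -> t < reach v ->
  moment_potential M1 P1 (y0 + t *: v) - moment_potential M2 P2 (y0 + t *: v) =
  moment_potential M1 P1 y0 - moment_potential M2 P2 y0.
Proof.
move=> t0 tv.
pose F u := moment_potential M1 P1 (y0 + u *: v) - moment_potential M2 P2 (y0 + u *: v).
have dF u : 0 <= u -> u <= t -> is_derive u (1 : R) F 0.
  move=> u0 ut; have [s1 s2 h] := same_field (reachP u0 (le_lt_trans ut tv)).
  have := is_derive_sub (is_derive_moment_potential M1s s1) (is_derive_moment_potential M2s s2).
  by rewrite !h subrr.
have cF : {within `[0, t], continuous F}.
  apply: derivable_within_continuous => u; rewrite in_itv /= => /andP[u0 ut].
  by have [] := dF u u0 ut.
have dF' u : u \in `]0, t[%R -> is_derive u (1 : R) F ((fun=> 0) u).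
  by rewrite in_itv /= => /andP[u0 ut]; apply: dF; apply: ltW.
have [c _] := MVT_segment (ltW t0) dF' cF.
by rewrite mul0r => /eqP; rewrite subr_eq0 => /eqP; rewrite /F scale0r addr0.
Qed.

Lemma moment_potentials_agree v : v != 0 ->
  (forall t, 0 < t < reach v ->
     moment_potential M1 P1 (y0 + t *: v) = moment_potential M2 P2 (y0 + t *: v)) /\
  quad_line M1 P1 y0 v ^+ 2 * dist_line P2 y0 v ^+ 5 =
  quad_line M2 P2 y0 v ^+ 2 * dist_line P1 y0 v ^+ 5.
Proof.
move=> v0.
have gap t : 0 < t < reach v -> (quad_line M1 P1 y0 v).[t] *
    (pow32 (dist_line P1 y0 v).[t] / (dist_line P1 y0 v).[t]) - (quad_line M2 P2 y0 v).[t] *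
    (pow32 (dist_line P2 y0 v).[t] / (dist_line P2 y0 v).[t]) =
    moment_potential M1 P1 y0 - moment_potential M2 P2 y0.
  by move=> /andP[t0 tv]; rewrite !dist_lineE !quad_lineE; exact: moment_potential_gap.
have pos1 t : 0 < t < reach v -> 0 < (dist_line P1 y0 v).[t].
  by move=> /andP[t0 tv]; rewrite dist_lineE; have [] := same_field (reachP (ltW t0) tv).
have pos2 t : 0 < t < reach v -> 0 < (dist_line P2 y0 v).[t].
  by move=> /andP[t0 tv]; rewrite dist_lineE; have [] := same_field (reachP (ltW t0) tv).
have [k0 e] := potentials_agree (reach_gt0 v) (size_quad_line _ _ _ _) (size_quad_line _ _ _ _)
  (size_dist_line P1 y0 v0) (size_dist_line P2 y0 v0) pos1 pos2 gap.
split=> // t /andP[t0 tv]; apply/eqP; rewrite -subr_eq0; apply/eqP.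
by rewrite moment_potential_gap.
Qed.

Let on_line (p : 'rV[R]_3 -> Prop) :
  (forall v t, v != 0 -> p (y0 + t *: v)) -> forall x, p x.
Proof.
move=> h x; have [->|xy] := eqVneq x y0.
  have e0 : e_ o0 != 0 :> 'rV[R]_3.
    by apply/eqP => /rowP/(_ o0); rewrite !mxE /= => /eqP; rewrite oner_eq0.
  by have := h _ 0 e0; rewrite scale0r addr0.
have := h (x - y0) 1; rewrite subr_eq0 scale1r addrC subrK; exact.
Qed.

(** The squared identity of [moment_potentials_agree] holds at every point,
    because each lies on a line through y0. At P1 + t w the forms built from P1
    are t^2 times constants, so the identity reads t^4 a^2 Z^5 = t^10 b^5 B^2
    with a = w^T M1 w and Z the squared distance to P2. Dividing by t^4 and
    letting t = 0 gives a = 0 for all w, unless P1 = P2. *)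
Lemma moment_center_unique : M1 != 0 -> P1 = P2.
Proof.
move=> M10; apply/eqP; apply/negPn/negP => P12; move/negP: M10; apply; apply/eqP.
have sq : forall x, quad_form M1 x P1 ^+ 2 * dsq x P2 ^+ 5 =
                    quad_form M2 x P2 ^+ 2 * dsq x P1 ^+ 5.
  apply: on_line => v t v0; have [_ /(congr1 (horner^~ t))] := moment_potentials_agree v0.
  by rewrite !horner_sq5 !dist_lineE !quad_lineE.
apply: quad_form_eq0 => // w.
pose Z := dist_line P2 P1 w; pose B := quad_line M2 P2 P1 w.
pose a := quad_form M1 0 w; pose b := dsq 0 w.
have qa t : quad_form M1 (P1 + t *: w) P1 = t ^+ 2 * a.
  by rewrite /a /quad_form /lin_form /relc !mxE; ring.
have qb t : dsq (P1 + t *: w) P1 = t ^+ 2 * b.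
  by rewrite /b /dsq !sum3 !mxE; ring.
have hBX t : (B * 'X^3).[t] = B.[t] * t ^+ 3 by rewrite hornerM hornerXn.
have : a%:P ^+ 2 * Z ^+ 5 = (B * 'X^3) ^+ 2 * b%:P ^+ 5.
  apply: (poly_eq_on_interval (@ltr01 R)) => t /andP[t0 _].
  rewrite !horner_sq5 !hornerC hBX dist_lineE quad_lineE.
  have := sq (P1 + t *: w); rewrite qa qb.
  move: (dsq _ P2) (quad_form M2 _ _) => z c h.
  have t4 : t ^+ 4 != 0 by rewrite expf_neq0// gt_eqF.
  by apply: (mulfI t4); ring: h.
move=> /(congr1 (horner^~ 0)).
rewrite !horner_sq5 !hornerC hBX dist_lineE expr0n /= mulr0 expr0n mul0r.
rewrite scale0r addr0 => /eqP; rewrite mulf_eq0 !expf_eq0 /= => /orP[/eqP//|/eqP].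
by move=> /dsq_eq0 P12'; rewrite P12' eqxx in P12.
Qed.

(** Equal potentials with a common centre have equal numerators. *)
Lemma moment_unique : P1 = P2 -> M1 = M2.
Proof.
move=> P12.
have eqf : forall x, quad_form M1 x P1 = quad_form M2 x P1.
  apply: on_line => v t v0; have [h _] := moment_potentials_agree v0.
  suff e : quad_line M1 P1 y0 v = quad_line M2 P1 y0 v by rewrite -!quad_lineE e.
  apply: (poly_eq_on_interval (reach_gt0 v)) => u /andP[u0 uv].
  rewrite !quad_lineE; have := h u; rewrite u0 uv => /(_ isT).
  rewrite /moment_potential -P12 => /mulIf; apply.
  have [s1 _ _] := same_field (reachP (ltW u0) uv).
  by rewrite gt_eqF// pow52_gt0.
apply/eqP; rewrite -subr_eq0; apply/eqP; apply: quad_form_eq0.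
  by rewrite linearB /= M1s M2s.
move=> w; have := eqf (P1 - w).
rewrite /quad_form /lin_form /relc !mxE => /eqP; rewrite -subr_eq0 => /eqP h.
by rewrite -[RHS]h; ring.
Qed.

End MomentUniqueness.

(** * From displacements to sources *)

Section AccelerationPairing.
Context (R : realType).
Implicit Types (Omega : set 'rV[R]_3) (t s : R).

(** When f has no weak derivative in L2, its [wderiv] is 0. *)
Lemma L2_wderiv Omega i f : mset Omega -> L2 Omega (wderiv Omega i f).
Proof.
move=> mO; have [h|h] := pselect (exists g, is_wderiv Omega i f g).
  by have [] := wderivP h.
rewrite (_ : wderiv _ _ _ = fun=> 0); first exact: L20.
by apply: xgetPN => g fg; apply: h; exists g.
Qed.

(** A displacement that vanishes almost everywhere has zero weak derivatives, so
    its stress vanishes, and so does the divergence of the stress. *)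
Lemma initial_acceleration Omega (lambda0 mu0 rho0 : R)
    (f u utt : 'rV[R]_3 -> 'rV[R]_3) : open Omega ->
  (forall i, L2 Omega (fun x => u x 0 i)) -> ae3 Omega (fun x => u x = 0) ->
  ae3 Omega (fun x => forall i, rho0 * utt x 0 i -
     \sum_j wderiv Omega j (stress Omega lambda0 mu0 u i j) x = f x 0 i) ->
  ae3 Omega (fun x => forall i, rho0 * utt x 0 i = f x 0 i).
Proof.
move=> oO Lu u0 eqn; have mO := mset_open oO.
have du0 : ae3 Omega (fun x => forall k l, wderiv Omega l (fun y => u y 0 k) x = 0).
  apply: ae3_forall => k; apply: ae3_forall => l; apply: wderiv_ae0 => //.
  by apply: ae3_mono u0 _ => x _ ->; rewrite mxE.
have ds0 : ae3 Omega (fun x => forall i j,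
    wderiv Omega j (stress Omega lambda0 mu0 u i j) x = 0).
  apply: ae3_forall => i; apply: ae3_forall => j; apply: wderiv_ae0 => //.
    apply: L2_sum => // k; apply: L2_sum => // l.
    by apply: L2Z => //; exact: L2_wderiv.
  apply: ae3_mono du0 _ => x _ h; rewrite /stress big1// => k _.
  by rewrite big1// => l _; rewrite h mulr0.
apply: ae3_mono2 eqn ds0 _ => x _ h1 h2 i.
by rewrite -h1 big1 ?subr0// => j _; exact: h2.
Qed.

Definition pairing Omega (v : 'rV[R]_3 -> 'rV[R]_3) (psi : 'I_3 -> 'rV[R]_3 -> R) : R :=
  \sum_i Int3 Omega (fun x => v x 0 i * psi i x).

Lemma deriv_at_vector_pairing Omega (v vt : R -> 'rV[R]_3 -> 'rV[R]_3) psi t :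
  mset Omega -> (forall i s, 0 <= s -> L2 Omega (fun x => v s x 0 i)) ->
  (forall i, L2 Omega (fun x => vt t x 0 i)) -> (forall i, L2 Omega (psi i)) ->
  (forall i, time_deriv Omega (fun s x => v s x 0 i) (fun s x => vt s x 0 i)) ->
  0 <= t ->
  deriv_at (fun s => pairing Omega (v s) psi) t (pairing Omega (vt t) psi).
Proof.
move=> mO Lv Lvt Lp dv t0.
have d i := deriv_at_pairing mO (Lv i) (Lvt i) (Lp i) (dv i) t0.
have := deriv_atD (deriv_atD (d o0) (d o1)) (d o2).
rewrite /pairing sum3 /deriv_at => h.
by under eq_fun do rewrite !sum3.
Qed.

(** The difference of the pairings vanishes for times up to t0, and so does its
    first derivative before t0, and its second derivative at 0; there
    rho0 u_tt is the source. *)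
Lemma elastic_source_pairing Omega (lambda0 mu0 rho0 t0 : R)
    (f1 f2 : 'rV[R]_3 -> 'rV[R]_3) u1 u2 psi :
  open Omega -> 0 < t0 -> (forall i, L2 Omega (psi i)) ->
  (forall i, mfun3 Omega (fun x => f1 x 0 i)) ->
  (forall i, mfun3 Omega (fun x => f2 x 0 i)) ->
  elastic_solution Omega lambda0 mu0 rho0 f1 u1 ->
  elastic_solution Omega lambda0 mu0 rho0 f2 u2 ->
  (forall t, 0 <= t <= t0 -> pairing Omega (u1 t) psi = pairing Omega (u2 t) psi) ->
  pairing Omega f1 psi = pairing Omega f2 psi.
Proof.
move=> oO t00 Lp mf1 mf2.
move=> [ut1 [utt1 [reg1 [eqn1 _ init1 _]]]] [ut2 [utt2 [reg2 [eqn2 _ init2 _]]]] upsi.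
have mO := mset_open oO.
have Lu1 i s : 0 <= s -> L2 Omega (fun x => u1 s x 0 i).
  by move=> s0; have [h _ _ _ _] := reg1 i; have [/Hk_L2] := h s s0.
have Lu2 i s : 0 <= s -> L2 Omega (fun x => u2 s x 0 i).
  by move=> s0; have [h _ _ _ _] := reg2 i; have [/Hk_L2] := h s s0.
have Lut1 i s : 0 <= s -> L2 Omega (fun x => ut1 s x 0 i).
  by move=> s0; have [_ h _ _ _] := reg1 i; have [/Hk_L2] := h s s0.
have Lut2 i s : 0 <= s -> L2 Omega (fun x => ut2 s x 0 i).
  by move=> s0; have [_ h _ _ _] := reg2 i; have [/Hk_L2] := h s s0.
have Lutt1 i s : 0 <= s -> L2 Omega (fun x => utt1 s x 0 i).
  by move=> s0; have [_ _ h _ _] := reg1 i; have [/Hk_L2] := h s s0.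
have Lutt2 i s : 0 <= s -> L2 Omega (fun x => utt2 s x 0 i).
  by move=> s0; have [_ _ h _ _] := reg2 i; have [/Hk_L2] := h s s0.
have du1 := fun s (s0 : 0 <= s) => deriv_at_vector_pairing mO Lu1
  (fun i => Lut1 i s s0) Lp (fun i => let: And5 _ _ _ h _ := reg1 i in h) s0.
have du2 := fun s (s0 : 0 <= s) => deriv_at_vector_pairing mO Lu2
  (fun i => Lut2 i s s0) Lp (fun i => let: And5 _ _ _ h _ := reg2 i in h) s0.
have dut1 := deriv_at_vector_pairing mO Lut1
  (fun i => Lutt1 i 0 (lexx 0)) Lp (fun i => let: And5 _ _ _ _ h := reg1 i in h) (lexx 0).
have dut2 := deriv_at_vector_pairing mO Lut2
  (fun i => Lutt2 i 0 (lexx 0)) Lp (fun i => let: And5 _ _ _ _ h := reg2 i in h) (lexx 0).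
have vel s : 0 <= s < t0 -> pairing Omega (ut1 s) psi - pairing Omega (ut2 s) psi = 0.
  move=> /andP[s0 st]; apply: (deriv_at_eq0 s0 st _ (deriv_atB (du1 s s0) (du2 s s0))).
  by move=> r /andP[r0 rt]; rewrite upsi ?subrr// r0 ltW.
have acc := deriv_at_eq0 (lexx 0) t00 vel (deriv_atB dut1 dut2).
have force (f utt : 'rV[R]_3 -> 'rV[R]_3) : (forall i, L2 Omega (fun x => utt x 0 i)) ->
    (forall i, mfun3 Omega (fun x => f x 0 i)) ->
    ae3 Omega (fun x => forall i, rho0 * utt x 0 i = f x 0 i) ->
    pairing Omega f psi = rho0 * pairing Omega utt psi.
  move=> Lu mf fu; rewrite /pairing mulr_sumr; apply: eq_bigr => i _.
  have Sp := L2_mul_summable mO (Lu i) (Lp i).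
  rewrite -(Int3Z rho0 mO Sp); apply: (ae3_eq_Int3 mO).
  - exact: measurable_funM (mf i) (L2_meas (Lp i)).
  - exact: summable_meas (summableZ rho0 mO Sp).
  - by apply: ae3_mono fu _ => x _ h; rewrite mulrA h.
rewrite (force f1 (utt1 0))//; first 1 last.
- by move=> i; exact: Lutt1.
- exact: (initial_acceleration oO (fun i => Lu1 i 0 (lexx 0)) init1 (eqn1 0 (lexx 0))).
rewrite (force f2 (utt2 0))//; first 1 last.
- by move=> i; exact: Lutt2.
- exact: (initial_acceleration oO (fun i => Lu2 i 0 (lexx 0)) init2 (eqn2 0 (lexx 0))).
by move/eqP: acc; rewrite subr_eq0 => /eqP ->.
Qed.

End AccelerationPairing.

(** * Balls and the position of the sources *)

Section Geometry.
Context (R : realType).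
Implicit Types (x y P : 'rV[R]_3) (Omega : set 'rV[R]_3).

Lemma eballE y (r : R) x : 0 < r -> eball y r x <-> dsq y x < r ^+ 2.
Proof.
move=> r0; rewrite /eball /= enorm_sub -(ltr_sqrt _ (exprn_gt0 2 r0)).
by rewrite sqrtr_sqr gtr0_norm.
Qed.

Lemma open_dsq_gt P (d : R) : open [set x | d < dsq P x].
Proof.
have cd : continuous (dsq P) := Ck_cont (Ck_dsq 0 P).
exact: (@open_comp _ _ (dsq P) [set s | d < s] (fun x _ => cd x) (@open_gt R d)).
Qed.

Lemma open_eball y (r : R) : 0 < r -> open (eball y r).
Proof.
move=> r0; rewrite (_ : eball y r = [set x | dsq y x < r ^+ 2]); last first.
  by apply/seteqP; split => x /(eballE _ _ r0).
have cd : continuous (dsq y) := Ck_cont (Ck_dsq 0 y).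
exact: (@open_comp _ _ (dsq y) [set s | s < r ^+ 2] (fun x _ => cd x) (@open_lt R (r ^+ 2))).
Qed.

Lemma open_contains_dsq_ball (A : set 'rV[R]_3) y : open A -> A y ->
  exists2 a, 0 < a & [set x | dsq y x <= a] `<=` A.
Proof.
move=> oA Ay; have /nbhs_ballP[e /= e0 eA] : nbhs y A by exact: open_nbhs_nbhs.
exists ((e / 2) ^+ 2); first by rewrite exprn_gt0// divr_gt0.
move=> x /= xy; apply: eA; rewrite mx_norm_ball /ball_ /=.
rewrite [`|_|]mx_normrE; apply: bigmax_lt => //= -[j i] _ /=.
rewrite (ord1 j) !mxE distrC; apply: (@le_lt_trans _ _ (e / 2)); last by lra.
rewrite -(ler_pXn2r (n := 2)) ?nnegrE ?normr_ge0//; last by rewrite divr_ge0 ?ltW.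
by rewrite real_normK ?num_real// (le_trans (dsq_ge_coord _ _ _)).
Qed.

Lemma bounded_dsq Omega y : bounded_set Omega ->
  exists2 r, 0 < r & forall x, Omega x -> dsq y x < r ^+ 2.
Proof.
move=> [L [_ bL]]; pose K : R := `|L| + 1.
have K0 : 0 < K by rewrite ltr_wpDl.
have LK : L < K by rewrite (le_lt_trans (ler_norm L))// ltrDl.
pose r := \sum_i (K + `|y 0 i|) + 1.
have s0 : 0 <= \sum_i (K + `|y 0 i|) by apply: sumr_ge0 => i _; rewrite addr_ge0 ?normr_ge0 ?(ltW K0).
exists r; first by rewrite ltr_wpDl.
move=> x Ox; have xK : `|x| <= K by exact: bL.
have c i : (x 0 i - y 0 i) ^+ 2 <= (K + `|y 0 i|) ^+ 2.
  rewrite -[leLHS]real_normK ?num_real// lerXn2r ?nnegrE ?addr_ge0 ?normr_ge0 ?(ltW K0)//.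
  rewrite (le_trans (ler_normB _ _))// lerD2r (le_trans _ xK)//.
  rewrite [leRHS]/Num.norm /= mx_normrE.
  exact: (le_bigmax _ (fun j : 'I_1 * 'I_3 => `|x j.1 j.2|) (0, i)).
apply: (@le_lt_trans _ _ (\sum_i (K + `|y 0 i|) ^+ 2)); first exact: ler_sum.
move: s0; rewrite /r !sum3.
have p i : 0 <= K + `|y 0 i| by rewrite addr_ge0 ?normr_ge0 ?(ltW K0).
move: (p o0) (p o1) (p o2); move: (K + _) (K + _) (K + _) => d b a a0 b0 d0 _.
have := mulr_ge0 a0 b0; have := mulr_ge0 a0 d0; have := mulr_ge0 b0 d0 => bd ad ab.
rewrite -subr_gt0.
have -> : (a + b + d + 1) ^+ 2 - (a ^+ 2 + b ^+ 2 + d ^+ 2) =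
  2 * (a * b) + 2 * (a * d) + 2 * (b * d) + 2 * a + 2 * b + 2 * d + 1 by ring.
lra.
Qed.

(** Otherwise the segment from P to x, being connected, would meet the boundary
    of Omega at a distance at most h from P. *)
Lemma inner_set_ball Omega (h : R) P x : open Omega -> inner_set Omega h P ->
  enorm (P - x) <= h -> Omega x.
Proof.
move=> oO [OP hP] Px; apply: contrapT => nOx.
pose g (t : R) := P + t *: (x - P).
have cg : continuous g.
  move=> t; apply: cvgD; first exact: cvg_cst.
  by apply: cvgZr_tmp; exact: cvg_id.
have nbd t : t \in `[0, 1]%R -> ~ boundary Omega (g t).
  rewrite in_itv /= => /andP[t0 t1] bt.
  have hlb : has_lbound [set enorm (P - y) | y in boundary Omega].
    by exists 0 => _ [z _ <-]; exact: sqrtr_ge0.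
  have : Defs.edist P (boundary Omega) <= enorm (P - g t) by apply: ge_inf => //; exists (g t).
  apply/negP; rewrite -ltNge (le_lt_trans _ hP)// (le_trans _ Px)//.
  rewrite (_ : P - g t = t *: (P - x)); last by apply/rowP => i; rewrite !mxE; ring.
  by rewrite enormZ ger0_norm// ler_piMl// sqrtr_ge0.
pose B := [set t | t \in `[0, 1]%R] `&` g @^-1` Omega.
have B1 : B = [set t | t \in `[0, 1]%R].
  apply: (@segment_connected R 0 1).
  - exists 0; split => /=; first by rewrite in_itv /= lexx ler01.
    by rewrite /g scale0r addr0.
  - by exists (g @^-1` Omega) => //; apply: open_comp => // t _; exact: cg.
  - exists (g @^-1` closure Omega).
      by apply: closed_comp => [t _|]; [exact: cg|exact: closed_closure].
    apply/seteqP; split => [t [t01 Ot]|t [t01 Ct]]; split => //.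
      exact: (@subset_closure _ Omega (g t) Ot).
    apply: contrapT => nOt; apply: (nbd t t01); split => // it; apply: nOt.
    exact: (@interior_subset _ Omega (g t) it).
have : B 1 by rewrite B1 /= in_itv /= ler01 lexx.
by move=> [_]; rewrite /g /= scale1r addrC subrK.
Qed.

End Geometry.

Section Source.
Context (R : realType).
Implicit Types (x y P : 'rV[R]_3) (M : 'M[R]_3) (q : R -> R).

Lemma source_cont q M P i : Ck 1 (fun x : 'rV[R]_3 => q (enorm x)) ->
  continuous (fun x => source q M P x 0 i).
Proof.
move=> Cq.
have pdQP j : pd j (fun x => q (enorm (x - P))) =
    (fun x => pd j (fun x => q (enorm x)) (x - P)).
  by apply: pdE => x; exact: (is_derive_translate (Ck_is_derive j Cq (x - P))).
have cpQP j : continuous (pd j (fun x => q (enorm (x - P)))).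
  by rewrite pdQP; apply: (@cont_translate R _ P); exact: (Ck_cont (Ck_pd j Cq)).
have cc (c : R) : continuous (fun _ : 'rV[R]_3 => c) by move=> x; exact: cst_continuous.
rewrite (_ : (fun x => source q M P x 0 i) = (fun x =>
    - M i o0 * pd o0 (fun x => q (enorm (x - P))) x +
    - M i o1 * pd o1 (fun x => q (enorm (x - P))) x +
    - M i o2 * pd o2 (fun x => q (enorm (x - P))) x)); last first.
  apply/funext => x; rewrite mxE sum3.
  by move: (pd o0 _ x) (pd o1 _ x) (pd o2 _ x) => a b c; ring.
exact: (cont_add (cont_add (cont_mul (cc (- M i o0)) (cpQP o0))
  (cont_mul (cc (- M i o1)) (cpQP o1))) (cont_mul (cc (- M i o2)) (cpQP o2))).
Qed.

Lemma source_eq0 q M P (d : R) x i : 0 <= d -> (forall s, d < s -> q s = 0) ->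
  d ^+ 2 < dsq P x -> source q M P x 0 i = 0.
Proof.
move=> d0 q0 xd; rewrite mxE big1 ?oppr0// => j _.
rewrite (_ : pd j _ x = 0) ?mulr0// /pd (near_eq_derive (g := cst 0)) ?derive_cst//.
have : nbhs x [set z | d ^+ 2 < dsq P z].
  by apply: open_nbhs_nbhs; split; [exact: open_dsq_gt|].
apply: filterS => z /= zd; apply: q0.
by rewrite enorm_sub -(ger0_norm d0) -sqrtr_sqr ltr_sqrt// (le_lt_trans _ zd)// sqr_ge0.
Qed.

End Source.

(** * Uniqueness of the source *)

Theorem theorem3p2 (R : realType) (Omega : set 'rV[R]_3)
    (lambda0 mu0 rho0 d0 m0 M0 t0 r0 : R) (xbar : 'rV[R]_3)
    (q : R -> R) (M1 M2 : 'M[R]_3) (P1 P2 : 'rV[R]_3)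
    (u1 u2 : R -> 'rV[R]_3 -> 'rV[R]_3) (S1 S2 : R -> 'rV[R]_3 -> R) :
  Omega !=set0 -> open Omega -> bounded_set Omega -> convex_set Omega ->
  C2_boundary Omega ->
  0 < lambda0 -> 0 < mu0 -> 0 < rho0 ->
  0 < d0 -> 0 < m0 -> m0 <= M0 -> 0 < t0 -> 0 < r0 ->
  eball xbar r0 `<=` ~` closure Omega ->
  Ck_c 2 Omega (fun x => q (enorm x)) ->
  supp q `<=` [set s | - (d0 / 2) <= s <= d0 / 2] ->
  Int3 setT (fun x => q (enorm x)) = 1 ->
  [/\ M1 != 0, M1^T = M1, \tr M1 = 0 & m0 <= frob M1 <= M0] ->
  [/\ M2 != 0, M2^T = M2, \tr M2 = 0 & m0 <= frob M2 <= M0] ->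
  inner_set Omega d0 P1 -> inner_set Omega d0 P2 ->
  elastic_solution Omega lambda0 mu0 rho0 (source q M1 P1) u1 ->
  gravity_solution Omega rho0 u1 S1 ->
  elastic_solution Omega lambda0 mu0 rho0 (source q M2 P2) u2 ->
  gravity_solution Omega rho0 u2 S2 ->
  (forall t, 0 <= t <= t0 ->
    ae3 (eball xbar r0) (fun x => forall i,
      wderiv setT i (S1 t) x = wderiv setT i (S2 t) x)) ->
  M1 = M2 /\ P1 = P2.
Proof.
move=> _ oO bO _ _ _ _ rho00 d00 _ _ t00 r00 far [Cq2 cq _] sq q1.
move=> [M10 M1s M1t _] [_ M2s M2t _] P1in P2in el1 gr1 el2 gr2 same.
have Cq : Ck 1 (fun x : 'rV[R]_3 => q (enorm x)) by move: Cq2; rewrite !CkE; exact: Cd_pred.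
have bq := compact_box_supported cq.
have mO := mset_open oO.
have h0 : 0 <= d0 / 2 by rewrite divr_ge0// ltW.
have q0 s : d0 / 2 < s -> q s = 0.
  move=> ds; apply/eqP/negP => /negP qs.
  have : supp q s by apply: subset_closure.
  move=> /sq /= /andP[_].
  by rewrite leNgt ds.
(* The source at P lives in the ball of radius d0/2, which lies in Omega. *)
have nearO P x : inner_set Omega d0 P -> dsq P x <= (d0 / 2) ^+ 2 -> Omega x.
  move=> Pin xP; apply: (inner_set_ball oO Pin).
  rewrite -[P]opprK -opprD addrC -scaleN1r enormZ normrN1 mul1r enorm_sub.
  rewrite (le_trans (_ : _ <= d0 / 2))//; last by lra.
  by rewrite -[leRHS](ger0_norm h0) -sqrtr_sqr ler_wsqrtr.
(* Since Omega is bounded and misses the ball, it lies in a shell around y on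
   which [kern a r] is the pure power. *)
have key y : eball xbar r0 y -> [/\ 0 < dsq y P1, 0 < dsq y P2 &
    forall e, moment_field M1 P1 y e = moment_field M2 P2 y e].
  move=> yB; have [a a0 aB] := open_contains_dsq_ball (@open_eball R xbar r0 r00) yB.
  have [r rr rO] := bounded_dsq y bO.
  have Oar x : Omega x -> a < dsq y x < r ^+ 2.
    move=> Ox; rewrite rO// andbT ltNge; apply/negP => /aB/far; apply.
    exact: subset_closure.
  have [inO1 _] := P1in; have [inO2 _] := P2in.
  have /andP[a1 r1] := Oar P1 inO1; have /andP[a2 r2] := Oar P2 inO2.
  split=> [||e]; [exact: lt_trans a1|exact: lt_trans a2|].
  pose psi i := pd i (field (kern a r) y e).
  have Cf : Ck 1 (field (kern a r) y e) by apply: Ck_field; exact: C1d_kern.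
  have bf : box_supported (field (kern a r) y e).
    apply: (@field_box _ _ _ (2 * r)); first by rewrite mulr_ge0// ltW.
    by move=> s rs; apply: kern_far => //; have := sqr_ge0 r; nra.
  have Lpsi i : L2 Omega (psi i) by exact: pd_L2.
  have ms M P i : mfun3 Omega (fun x => source q M P x 0 i).
    exact: (@measurable_cont R (fun x => source q M P x 0 i) _ (source_cont (M := M) (P := P) (i := i) Cq)).
  have weak t : 0 <= t <= t0 -> pairing Omega (u1 t) psi = pairing Omega (u2 t) psi.
    move=> tt0; have /andP[t_ge0 _] := tt0.
    apply: (dipole_orthogonal oO rho00 t_ge0 a0 rr Oar _ _ gr1 gr2).
    - move=> i; case: el1 => [? [? [reg _]]]; have [h _ _ _ _] := reg i.
      by have [/Hk_L2] := h t t_ge0.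
    - move=> i; case: el2 => [? [? [reg _]]]; have [h _ _ _ _] := reg i.
      by have [/Hk_L2] := h t t_ge0.
    - by apply: (ae3_sub aB); apply: ae3_mono (same t tt0) _ => x _; exact.
  have src := elastic_source_pairing oO t00 Lpsi (ms M1 P1) (ms M2 P2) el1 el2 weak.
  have eval M P : M^T = M -> \tr M = 0 -> inner_set Omega d0 P ->
      pairing Omega (source q M P) psi = 3 * moment_field M P y e.
    move=> Ms Mt Pin; have [inOP _] := Pin; rewrite /moment_field mulrA.
    rewrite -(quadrupole_kern M e a0 rr (Oar P inOP)).
    rewrite -(source_pairing e Cq bq q1 h0 q0 Ms Mt a0 rr); last first.
      by move=> x xP; apply: Oar; exact: nearO xP.
    rewrite /pairing /psi; apply: eq_bigr => i _; apply: Int3_vanish => [|x _ nOx]; first exact: subsetT.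
    have -> : source q M P x 0 i = 0; last exact: mul0r.
    apply: (source_eq0 _ _ h0 q0); rewrite ltNge; apply/negP => xP.
    by apply: nOx; exact: nearO xP.
  move: src; rewrite !eval// => /mulfI; apply.
  by rewrite pnatr_eq0.
have P12 : P1 = P2 := moment_center_unique M1s M2s r00 key M10.
by split=> //; exact: (moment_unique M1s M2s r00 key P12).
Qed.
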